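(* Let $k=\overline{\mathbb{Q}}$ be the algebraic closure of $\mathbb{Q}$. Then there exists a finitely generated infinite-dimensional prime noetherian $k$-algebra $R$ such that $R$ does not satisfy the Dixmier-Moeglin equivalence and $\mathrm{Spec}(R)$ is homeomorphic to $\mathrm{Spec}(k[t])$. Thus neither of the following two statements holds in general: (i) for every field $k$, if $R$ and $S$ are left noetherian $k$-algebras whose posets of prime ideals are isomorphic, then $R$ satisfies the Dixmier-Moeglin equivalence if and only if $S$ does; (ii) for every field $k$, if $R$ is a finitely generated left noetherian $k$-algebra such that $\mathrm{Spec}(R)$ is a finite disjoint union of locally closed subsets, each homeomorphic in the subspace topology to the prime spectrum of a finitely generated commutative $k$-algebra, then $R$ satisfies the Dixmier-Moeglin equivalence.
   Context: Algebras are associative and unital. $\mathrm{Spec}(R)$ is the set of (two-sided) prime ideals of $R$ with the Zariski topology, whose closed sets are the sets $\{P : P\supseteq I\}$ for $I$ a two-sided ideal. For a left noetherian $k$-algebra $R$ and $P\in\mathrm{Spec}(R)$: $P$ is locally closed if $\{P\}$ is a locally closed subset of $\mathrm{Spec}(R)$ (equivalently, $P$ is not equal to the intersection of all prime ideals properly containing $P$, where an empty intersection is $R$); $P$ is primitive if it is the annihilator of a simple left $R$-module; $P$ is rational if the centre $Z(Q(R/P))$ of the Goldie ring of quotients $Q(R/P)$ of $R/P$ is an algebraic extension of $k$. The left noetherian $k$-algebra $R$ satisfies the Dixmier-Moeglin equivalence if for every $P\in \mathrm{Spec}(R)$ the three properties ''locally closed'', ''primitive'' and ''rational'' are equivalent.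 *)

(* Defs.v *)
From HB Require Import structures.
From mathcomp Require Import all_boot all_order all_algebra all_field.
From mathcomp Require Import all_classical topology.

Set Implicit Arguments.
Unset Strict Implicit.
Unset Printing Implicit Defensive.

Import GRing.Theory.

Local Open Scope classical_set_scope.
Local Open Scope ring_scope.
Local Open Scope quotient_scope.

Definition locally_closed (T : topologicalType) (A : set T) : Prop :=
  exists U C : set T, [/\ open U, closed C & A = U `&` C].

Definition homeomorphic (S T : topologicalType) : Prop :=
  exists (f : S -> T) (g : T -> S),
    [/\ cancel f g, cancel g f, continuous f & continuous g].

Section Ideals.
Variable R : nzRingType.

Definition left_ideal (I : set R) : Prop :=
  [/\ I 0, forall x y, I x -> I y -> I (x - y) & forall a x, I x -> I (a * x)].

Definition right_ideal (I : set R) : Prop :=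
  [/\ I 0, forall x y, I x -> I y -> I (x - y) & forall a x, I x -> I (x * a)].

Definition two_sided_ideal (I : set R) : Prop := left_ideal I /\ right_ideal I.

(* As [P] is closed under addition, the second clause says that the product
   ideal [I J] is contained in [P]. *)
Definition prime_ideal (P : set R) : Prop :=
  [/\ two_sided_ideal P, P != setT &
      forall I J : set R, two_sided_ideal I -> two_sided_ideal J ->
        (forall x y, I x -> J y -> P (x * y)) -> I `<=` P \/ J `<=` P].

Definition left_noetherian : Prop :=
  forall I : nat -> set R, (forall n, left_ideal (I n)) ->
    (forall n, I n `<=` I n.+1) ->
    exists N, forall n, (N <= n)%N -> I n = I N.

Definition right_noetherian : Prop :=
  forall I : nat -> set R, (forall n, right_ideal (I n)) ->
    (forall n, I n `<=` I n.+1) ->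
    exists N, forall n, (N <= n)%N -> I n = I N.

Definition noetherian : Prop := left_noetherian /\ right_noetherian.

Definition prime_ring : Prop := prime_ideal [set 0].

Record Spec : Type := MkSpec {
  spec_set :> set R;
  spec_prime : prime_ideal spec_set
}.

End Ideals.

HB.instance Definition _ (R : nzRingType) := gen_eqMixin (Spec R).
HB.instance Definition _ (R : nzRingType) := gen_choiceMixin (Spec R).

Section Zariski.
Variable R : nzRingType.

Definition zariski_V (I : set R) : set (Spec R) := [set P | I `<=` P].

Definition zariski_open (U : set (Spec R)) : Prop :=
  exists2 I, two_sided_ideal I & U = ~` zariski_V I.

Lemma two_sidedT : two_sided_ideal [set: R].
Proof. by []. Qed.

Lemma two_sidedI (I J : set R) :
  two_sided_ideal I -> two_sided_ideal J -> two_sided_ideal (I `&` J).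
Proof.
move=> [[I0 IB IM] [_ _ IM']] [[J0 JB JM] [_ _ JM']].
by split; split=> // [x y [Ix Jx] [Iy Jy]|a x [Ix Jx]]; split; auto.
Qed.

Definition ideal_gen (X : set R) : set R :=
  [set x | forall I, two_sided_ideal I -> X `<=` I -> I x].

Lemma two_sided_gen (X : set R) : two_sided_ideal (ideal_gen X).
Proof.
split; split.
- by move=> I [[]].
- move=> x y hx hy I hI XI; have [[_ h _] _] := hI.
  by apply: h; [exact: hx|exact: hy].
- by move=> a x hx I hI XI; have [[_ _ h] _] := hI; apply: h; exact: hx.
- by move=> I [[]].
- move=> x y hx hy I hI XI; have [[_ h _] _] := hI.
  by apply: h; [exact: hx|exact: hy].
- by move=> a x hx I hI XI; have [_ [_ _ h]] := hI; apply: h; exact: hx.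
Qed.

Lemma zariski_openT : zariski_open setT.
Proof.
exists setT; first exact: two_sidedT.
apply/esym/seteqP; split=> // P _ /= TP.
case: (spec_prime P) => _ /eqP PT _; apply: PT.
by apply/seteqP; split.
Qed.

Lemma zariski_openI : setI_closed zariski_open.
Proof.
move=> _ _ [I hI ->] [J hJ ->]; exists (I `&` J); first exact: two_sidedI.
rewrite -setCU; congr (~` _); apply/seteqP; split=> P /=.
  by move=> [IP|JP] x [Ix Jx]; [exact: IP|exact: JP].
move=> IJP; case: (spec_prime P) => _ _ /(_ I J hI hJ); apply=> x y Ix Jy.
apply: IJP; split.
  by case: hI => _ [_ _ h]; apply: h.
by case: hJ => [[_ _ h] _]; apply: h.
Qed.

Lemma zariski_open_bigU (T : Type) (f : T -> set (Spec R)) :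
  (forall i, zariski_open (f i)) -> zariski_open (\bigcup_i f i).
Proof.
move=> fop.
have /choice[I hI] : forall i, exists I,
    two_sided_ideal I /\ f i = ~` zariski_V I.
  by move=> i; have [I ? ?] := fop i; exists I.
exists (ideal_gen (\bigcup_i I i)); first exact: two_sided_gen.
apply/seteqP; split=> P /=.
  move=> [i _]; rewrite (hI i).2 /= => nIP genP; apply: nIP => x Ix.
  by apply: genP => K _; apply; exists i.
move=> ngenP; apply: contrapT => nU; apply: ngenP => x; apply.
  by case: (spec_prime P).
move=> y [i _ Iiy]; apply: contrapT => nPy; apply: nU; exists i => //.
by rewrite (hI i).2 /= => /(_ y Iiy).
Qed.

End Zariski.

HB.instance Definition _ (R : nzRingType) :=
  isOpenTopological.Build (Spec R) (@zariski_openT R) (@zariski_openI R)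
    (@zariski_open_bigU R).

Lemma zariski_closedP (R : nzRingType) (C : set (Spec R)) :
  closed C <-> exists2 I, two_sided_ideal I & C = zariski_V I.
Proof.
rewrite -openC; split=> -[I hI CI]; exists I => //; last by rewrite CI.
by rewrite -[C]setCK CI setCK.
Qed.

(* MathComp only equips quotients of commutative rings with a ring structure;
   here is the residue ring, and the residue algebra, of a prime two-sided
   ideal of an arbitrary ring. *)
Section ResidueRing.
Variables (R : nzRingType) (P : Spec R).

Definition spec_pred : {pred R} := [in spec_set P].

Lemma spec_zmod_closed : zmod_closed spec_pred.
Proof.
have [[[P0 PB _] _] _ _] := spec_prime P.
by split=> [|x y]; rewrite !inE //; exact: PB.
Qed.

HB.instance Definition _ := GRing.isZmodClosed.Build R spec_pred
  spec_zmod_closed.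

Lemma spec_predMl a x : x \in spec_pred -> a * x \in spec_pred.
Proof. by rewrite !inE; have [[[_ _ h] _] _ _] := spec_prime P; exact: h. Qed.

Lemma spec_predMr a x : x \in spec_pred -> x * a \in spec_pred.
Proof. by rewrite !inE; have [[_ [_ _ h]] _ _] := spec_prime P; exact: h. Qed.

Lemma spec_pred1 : 1 \notin spec_pred.
Proof.
apply/negP => P1; have [_ /eqP PT _] := spec_prime P; apply: PT.
apply/seteqP; split=> // x _; have := spec_predMl x P1.
by rewrite mulr1 inE.
Qed.

Definition residue_ring : Type := Quotient.quot spec_pred.

HB.instance Definition _ := GRing.Zmodule.on residue_ring.

Definition residue (x : R) : residue_ring := \pi_(Quotient.quot spec_pred) x.

Lemma residueP x y : (residue x = residue y) <-> spec_set P (x - y).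
Proof.
rewrite /residue; split=> [/eqP|h].
  by rewrite -Quotient.idealrBE inE.
by apply/eqP; rewrite -Quotient.idealrBE inE.
Qed.

Definition residue_repr (u : residue_ring) : R :=
  repr (u : Quotient.quot spec_pred).

Lemma residueK u : residue (residue_repr u) = u.
Proof. exact: reprK. Qed.

Lemma residueD x y : residue (x + y) = residue x + residue y.
Proof. exact: (@Quotient.pi_add _ spec_pred x y). Qed.

Lemma residue0 : residue 0 = 0.
Proof. by apply: (addrI (residue 0)); rewrite -residueD !addr0. Qed.

Definition residue_mul (u v : residue_ring) : residue_ring :=
  residue (residue_repr u * residue_repr v).

Lemma residue_mulE x y : residue_mul (residue x) (residue y) = residue (x * y).
Proof.
apply/residueP.
set x' := residue_repr (residue x); set y' := residue_repr (residue y).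
have hx : x' - x \in spec_pred by apply/mem_set/residueP; rewrite residueK.
have hy : y' - y \in spec_pred by apply/mem_set/residueP; rewrite residueK.
have -> : x' * y' - x * y = (x' - x) * y' + x * (y' - y).
  by rewrite mulrBl mulrBr addrA subrK.
suff : (x' - x) * y' + x * (y' - y) \in spec_pred by move/set_mem.
by apply: rpredD; [exact: (spec_predMr _ hx)|exact: (spec_predMl _ hy)].
Qed.

Let mulA : associative residue_mul.
Proof.
move=> u v w; rewrite -[u]residueK -[v]residueK -[w]residueK.
by rewrite !residue_mulE mulrA.
Qed.

Let mul1 : left_id (residue 1) residue_mul.
Proof. by move=> u; rewrite -[u]residueK residue_mulE mul1r. Qed.

Let mulr_1 : right_id (residue 1) residue_mul.
Proof. by move=> u; rewrite -[u]residueK residue_mulE mulr1. Qed.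

Let mulDl : left_distributive residue_mul +%R.
Proof.
move=> u v w; rewrite -[u]residueK -[v]residueK -[w]residueK.
by rewrite -residueD !residue_mulE -residueD mulrDl.
Qed.

Let mulDr : right_distributive residue_mul +%R.
Proof.
move=> u v w; rewrite -[u]residueK -[v]residueK -[w]residueK.
by rewrite -residueD !residue_mulE -residueD mulrDr.
Qed.

Let one_neq0 : residue 1 != 0.
Proof.
apply/negP => /eqP; rewrite -residue0 => /residueP; rewrite subr0 => P1.
by move/negP: spec_pred1; apply; apply/mem_set.
Qed.

HB.instance Definition _ := GRing.Zmodule_isNzRing.Build residue_ring
  mulA mul1 mulr_1 mulDl mulDr one_neq0.

Lemma residueM x y : residue (x * y) = residue x * residue y.
Proof. by rewrite -residue_mulE. Qed.

End ResidueRing.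

Section ResidueAlgebra.
Variables (k : fieldType) (R : algType k) (P : Spec R).

Definition residue_scale (c : k) (u : residue_ring P) : residue_ring P :=
  residue P (c *: residue_repr u).

Lemma residue_scaleE c x : residue_scale c (residue P x) = residue P (c *: x).
Proof.
rewrite /residue_scale -[in LHS]mulr_algl -[in RHS]mulr_algl.
by rewrite !residueM residueK.
Qed.

Let scaleA a b u : residue_scale a (residue_scale b u) = residue_scale (a * b) u.
Proof. by rewrite -[u]residueK !residue_scaleE scalerA. Qed.

Let scale1 : left_id 1 residue_scale.
Proof. by move=> u; rewrite -[u]residueK residue_scaleE scale1r. Qed.

Let scaleDr : right_distributive residue_scale +%R.
Proof.
move=> c u v; rewrite -[u]residueK -[v]residueK.
by rewrite -residueD !residue_scaleE -residueD scalerDr.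
Qed.

Let scaleDl u : {morph residue_scale^~ u : a b / a + b}.
Proof.
by move=> a b; rewrite -[u]residueK !residue_scaleE -residueD scalerDl.
Qed.

HB.instance Definition _ := GRing.Zmodule_isLmodule.Build k (residue_ring P)
  scaleA scale1 scaleDr scaleDl.

Let scaleAl (c : k) (u v : residue_ring P) : c *: (u * v) = (c *: u) * v.
Proof.
rewrite -[u]residueK -[v]residueK -residueM.
rewrite -[c *: residue P _]/(residue_scale _ _).
rewrite -[c *: residue P (residue_repr u)]/(residue_scale _ _).
by rewrite !residue_scaleE -residueM scalerAl.
Qed.

HB.instance Definition _ := GRing.Lmodule_isLalgebra.Build k (residue_ring P)
  scaleAl.

Let scaleAr (c : k) (u v : residue_ring P) : c *: (u * v) = u * (c *: v).
Proof.
rewrite -[u]residueK -[v]residueK -residueM.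
rewrite -[c *: residue P _]/(residue_scale _ _).
rewrite -[c *: residue P (residue_repr v)]/(residue_scale _ _).
by rewrite !residue_scaleE -residueM scalerAr.
Qed.

HB.instance Definition _ := GRing.Lalgebra_isAlgebra.Build k (residue_ring P)
  scaleAr.

End ResidueAlgebra.

Section Primitive.
Variable R : nzRingType.

Definition annihilator (M : lmodType R) : set R :=
  [set a | forall m : M, a *: m = 0].

Definition simple_module (M : lmodType R) : Prop :=
  (exists m : M, m != 0) /\
  forall N : {pred M}, GRing.submod_closed N ->
    (forall m, m \in N -> m = 0) \/ (forall m, m \in N).

Definition primitive (P : Spec R) : Prop :=
  exists M : lmodType R, simple_module M /\ spec_set P = annihilator M.

End Primitive.

Section Rational.
Variable k : fieldType.

Definition regular_elt (A : nzRingType) (s : A) : Prop :=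
  GRing.lreg s /\ GRing.rreg s.

Definition invertible_elt (A : nzRingType) (s : A) : Prop :=
  exists t : A, t * s = 1 /\ s * t = 1.

(* [Q], with [iota], is a classical left ring of quotients of [A]: it consists
   of the left fractions [s^-1 a] with [s] regular. Such a [Q] is unique up to
   isomorphism over [A], and it exists if [A] is prime and left noetherian, by
   Goldie's theorem. *)
Definition goldie_quotient_ring (A Q : algType k) (iota : {lrmorphism A -> Q})
    : Prop :=
  [/\ injective iota,
      forall s, regular_elt s -> invertible_elt (iota s) &
      forall q, exists s a, regular_elt s /\ iota s * q = iota a].

Definition algebraic_elt (Q : algType k) (z : Q) : Prop :=
  exists2 p : {poly k}, p != 0 & root (map_poly (in_alg Q) p) z.

Definition center_algebraic (Q : algType k) : Prop :=
  forall z : Q, (forall x, GRing.comm z x) -> algebraic_elt z.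

Definition rational (R : algType k) (P : Spec R) : Prop :=
  exists (Q : algType k) (iota : {lrmorphism residue_ring P -> Q}),
    goldie_quotient_ring iota /\ center_algebraic Q.

Definition dixmier_moeglin (R : algType k) : Prop :=
  forall P : Spec R,
    (locally_closed [set P] <-> primitive P) /\ (primitive P <-> rational P).

Definition fg_algebra (R : algType k) : Prop :=
  exists s : seq R, forall B : {pred R}, GRing.subalg_closed B ->
    {subset s <= B} -> forall x, x \in B.

Definition finite_dimensional (R : algType k) : Prop :=
  exists (n : nat) (e : 'I_n -> R), forall x, exists c : 'I_n -> k,
    x = \sum_(i < n) c i *: e i.

End Rational.

Definition spec_poset_iso (R S : nzRingType) : Prop :=
  exists2 f : Spec R -> Spec S, bijective f &
    forall P Q : Spec R, (f P `<=` f Q) <-> (P `<=` Q).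

(* The space [X i] below is [set_type (X i)], which carries the subspace
   topology. *)
Definition finitely_stratified (k : fieldType) (R : algType k) : Prop :=
  exists (n : nat) (X : 'I_n -> set (Spec R)),
    [/\ \bigcup_i X i = setT, trivIset setT X,
        forall i, locally_closed (X i) &
        forall i, exists A : comAlgType k,
          fg_algebra A /\ homeomorphic (X i) (Spec A)].

(* Main.v *)
(** Let phi be the hyperbolic automorphism (x, y) |-> (y, x y) of the torus
    T = (k^* )^2, extended by u |-> u + 1 to T x A^1, and take the skew Laurent
    ring R = A[u][z, z^-1; phi], where A = k[x, x^-1, y, y^-1]. Because
    [z, u] = z, every ideal of R is graded by powers of z, hence is generated by
    a phi-stable ideal J of A[u]. Torsion points are periodic and dense in T, and
    comparing J with its translates above a periodic point shows that J meets A.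
    Hyperbolicity makes every nonzero phi-stable ideal of A of finite
    codimension, so the nonzero primes of R correspond to the finite orbits of
    phi; the translation of u makes the factor ring of each finite orbit simple.
    Thus Spec R consists of 0 and of countably many closed points, any nonzero
    ideal lying in finitely many of them, exactly as for k[t]. But 0 is
    primitive: the functions with finite support in the orbit of the
    nonperiodic point (2, 2, 0) form a faithful simple module. Since 0 is not
    locally closed, R fails the Dixmier-Moeglin equivalence, which holds for
    k[t].

    R is realised as an algebra of linear operators on the functions on
    T x k: functions act by multiplication, z by composition with phi. *)

From HB Require Import structures.
Require Import Defs.
From mathcomp Require Import all_boot all_order all_algebra all_field.
From mathcomp Require Import all_classical topology.
From mathcomp Require Import zify ring.

Set Implicit Arguments.
Unset Strict Implicit.
Unset Printing Implicit Defensive.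

Import GRing.Theory Num.Theory Order.TTheory.

Local Open Scope classical_set_scope.
Local Open Scope ring_scope.

(** * Noetherian extensions by a normalizing element *)

(** The variable u serves two purposes. In the skew Laurent ring over A alone, some power of z is
    central modulo the ideal of a finite orbit, and the factor ring has further primes; the
    translation of u destroys these central elements. Moreover z u = (u + 1) z, so that commutators
    with u separate the powers of z by eigenvalues. This yields homogeneity for any expression of an
    operator as a sum of powers of z, and the uniqueness of such expressions never has to be
    established.

    Finite codimension comes from the exponents of monomials: phi acts on them by a matrix with
    characteristic polynomial X^2 - X - 1, so that two distinct iterates of a nonzero vector are
    never parallel. Hence, for every exponent far enough from the origin, some iterate of a given
    Laurent polynomial has a strictly dominant monomial in that direction.

    As the field is countable, so is the spectrum. Its topology is then so coarse that any bijection
    matching the zero ideals is a homeomorphism, and the comparison with k[t] needs no explicit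
    map. *)

Section SubringExtensions.
Variable E : nzRingType.
Implicit Types (B S I : set E) (t ti : E).

Definition subring_set S : Prop :=
  [/\ S 1, forall x y, S x -> S y -> S (x - y) &
      forall x y, S x -> S y -> S (x * y)].

Definition lideal_in S I : Prop :=
  [/\ I `<=` S, I 0, forall x y, I x -> I y -> I (x - y) &
      forall a x, S a -> I x -> I (a * x)].

Definition left_noetherian_in S : Prop :=
  forall I : nat -> set E, (forall n, lideal_in S (I n)) ->
    (forall n, I n `<=` I n.+1) ->
    exists N, forall n, (N <= n)%N -> I n `<=` I N.

(** Both inclusions are required, so that coefficients cross powers of [t] in either direction; the
    two clauses trade places in the converse ring. *)
Definition normalizes B t : Prop :=
  (forall b, B b -> exists2 b', B b' & t * b = b' * t) /\
  (forall b, B b -> exists2 b', B b' & b * t = t * b').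

Definition pol_left B t : set E :=
  [set r | exists n (b : nat -> E), (forall i, B (b i)) /\
           r = \sum_(i < n) b i * t ^+ i].

Definition pol_right B t : set E :=
  [set r | exists n (b : nat -> E), (forall i, B (b i)) /\
           r = \sum_(i < n) t ^+ i * b i].

Definition loc_left S ti : set E :=
  [set r | exists n s, S s /\ r = ti ^+ n * s].

Definition loc_right S ti : set E :=
  [set r | exists n s, S s /\ r = s * ti ^+ n].

Lemma subring_set0 S : subring_set S -> S 0.
Proof. by move=> [S1 SB _]; rewrite -(subrr 1); apply: SB. Qed.

Lemma subring_setN S x : subring_set S -> S x -> S (- x).
Proof. by move=> hS Sx; rewrite -sub0r; have [_ SB _] := hS; apply: SB => //; apply: subring_set0. Qed.

Lemma subring_setD S x y : subring_set S -> S x -> S y -> S (x + y).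
Proof.
move=> hS Sx Sy; rewrite -(opprK y); have [_ SB _] := hS.
by apply: SB => //; apply: subring_setN.
Qed.

Lemma subring_setX S x n : subring_set S -> S x -> S (x ^+ n).
Proof.
by move=> [S1 _ SM] Sx; elim: n => [|n IH]; rewrite ?expr0 // exprS; apply: SM.
Qed.

Lemma subring_set_sum (I : Type) (r : seq I) (P : pred I) S (F : I -> E) :
  subring_set S -> (forall i, P i -> S (F i)) -> S (\sum_(i <- r | P i) F i).
Proof.
move=> hS hF; apply: (big_ind S) => //; first exact: subring_set0.
by move=> x y; apply: subring_setD.
Qed.

Lemma exprMV (x y : E) n : x * y = 1 -> x ^+ n * y ^+ n = 1.
Proof.
move=> xy; elim: n => [|n IH]; first by rewrite !expr0 mul1r.
by rewrite exprSr exprS mulrA -(mulrA _ x) xy mulr1.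
Qed.

Lemma normalizesX B t n b : normalizes B t -> B b ->
  (exists2 b', B b' & t ^+ n * b = b' * t ^+ n) /\
  (exists2 b', B b' & b * t ^+ n = t ^+ n * b').
Proof.
move=> [nl nr]; elim: n b => [|n IH] b Bb.
  by split; exists b => //; rewrite expr0 mulr1 mul1r.
have [[b1 Bb1 e1] [b2 Bb2 e2]] := IH b Bb; split.
  have [b' Bb' e'] := nl _ Bb1; exists b' => //.
  by rewrite exprS -mulrA e1 mulrA e' mulrA.
have [b' Bb' e'] := nr _ Bb2; exists b' => //.
by rewrite exprSr mulrA e2 -mulrA e' mulrA.
Qed.

Lemma pol_left_right B t : normalizes B t -> pol_left B t = pol_right B t.
Proof.
move=> nBt; apply/seteqP; split=> r [n [b [Bb ->]]].
  have /choice[b' hb'] : forall i, exists b', B b' /\ b i * t ^+ i = t ^+ i * b'.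
    by move=> i; have [_ [b' ? ?]] := normalizesX i nBt (Bb i); exists b'.
  exists n, b'; split=> [i|]; first exact: (hb' i).1.
  by apply: eq_bigr => i _; exact: (hb' i).2.
have /choice[b' hb'] : forall i, exists b', B b' /\ t ^+ i * b i = b' * t ^+ i.
  by move=> i; have [[b' ? ?] _] := normalizesX i nBt (Bb i); exists b'.
exists n, b'; split=> [i|]; first exact: (hb' i).1.
by apply: eq_bigr => i _; exact: (hb' i).2.
Qed.

Lemma loc_left_right S t ti : t * ti = 1 -> ti * t = 1 -> normalizes S t ->
  loc_left S ti = loc_right S ti.
Proof.
move=> tti tit nSt.
have Xti n : t ^+ n * ti ^+ n = 1 by exact: exprMV.
have Xit n : ti ^+ n * t ^+ n = 1 by exact: exprMV.
apply/seteqP; split=> _ [n [s [Ss ->]]]; exists n.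
  have [_ [s' Ss' e]] := normalizesX n nSt Ss; exists s'; split=> //.
  by rewrite -[LHS]mulr1 -(Xti n) mulrA -(mulrA _ s) e mulrA Xit mul1r.
have [[s' Ss' e] _] := normalizesX n nSt Ss; exists s'; split=> //.
by rewrite -[LHS]mul1r -(Xit n) mulrA -(mulrA _ _ s) e -!mulrA Xti mulr1.
Qed.

(** Extending the coefficients by zero lets one family serve every larger degree bound, so that two
    elements can be combined termwise. *)
Lemma pol_right_pad B t r : subring_set B -> pol_right B t r ->
  exists n (b : nat -> E), (forall i, B (b i)) /\
    forall m, (n <= m)%N -> r = \sum_(i < m) t ^+ i * b i.
Proof.
move=> hB [n [b [Bb ->]]]; exists n, (fun i => if (i < n)%N then b i else 0).
split=> [i|m nm]; first by case: ifP => _ //; exact: subring_set0.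
rewrite (big_ord_widen m (fun i => t ^+ i * b i) nm).
rewrite big_mkcond; apply: eq_bigr => i _ /=.
by case: ifP => //; rewrite mulr0.
Qed.

Lemma pol_rightB B t x y : subring_set B ->
  pol_right B t x -> pol_right B t y -> pol_right B t (x - y).
Proof.
move=> hB /(pol_right_pad hB)[n [b [Bb hx]]] /(pol_right_pad hB)[m [c [Bc hy]]].
exists (maxn n m), (fun i => b i - c i); split=> [i|].
  by have [_ SB _] := hB; apply: SB.
rewrite (hx (maxn n m)) ?leq_maxl // (hy (maxn n m)) ?leq_maxr //.
by rewrite -sumrB; apply: eq_bigr => i _; rewrite mulrBr.
Qed.

Lemma pol_right_mem B t n b : B b -> subring_set B -> pol_right B t (t ^+ n * b).
Proof.
move=> Bb hB; exists n.+1, (fun i => if i == n then b else 0); split=> [i|].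
  by case: ifP => _ //; exact: subring_set0.
rewrite big_ord_recr /= eqxx big1 ?add0r // => i _.
by rewrite ltn_eqF // mulr0.
Qed.

Lemma pol_rightD B t x y : subring_set B ->
  pol_right B t x -> pol_right B t y -> pol_right B t (x + y).
Proof.
move=> hB /(pol_right_pad hB)[n [b [Bb hx]]] /(pol_right_pad hB)[m [c [Bc hy]]].
exists (maxn n m), (fun i => b i + c i); split=> [i|].
  exact: subring_setD.
rewrite (hx (maxn n m)) ?leq_maxl // (hy (maxn n m)) ?leq_maxr //.
by rewrite -big_split; apply: eq_bigr => i _; rewrite mulrDr.
Qed.

Lemma pol_right_subring B t : subring_set B -> normalizes B t ->
  subring_set (pol_right B t).
Proof.
move=> hB nBt; have [B1 BB BM] := hB; split.
- by rewrite -[1]mulr1 -(expr0 t); apply: pol_right_mem.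
- by move=> x y; apply: pol_rightB.
move=> _ _ [n [b [Bb ->]]] [m [c [Bc ->]]].
rewrite mulr_suml; apply: (big_ind (pol_right B t)) => [|x y|i _].
- by rewrite -(mulr0 (t ^+ 0)); apply: pol_right_mem => //; exact: subring_set0.
- exact: pol_rightD.
rewrite mulr_sumr; apply: (big_ind (pol_right B t)) => [|x y|j _].
- by rewrite -(mulr0 (t ^+ 0)); apply: pol_right_mem => //; exact: subring_set0.
- exact: pol_rightD.
have [_ [b' Bb' e]] := normalizesX j nBt (Bb i).
have -> : t ^+ i * b i * (t ^+ j * c j) = t ^+ (i + j) * (b' * c j).
  by rewrite -mulrA (mulrA (b i)) e exprD !mulrA.
by apply: pol_right_mem => //; apply: BM.
Qed.

Lemma pol_right_sub B t : subring_set B -> B `<=` pol_right B t.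
Proof. by move=> hB b Bb; rewrite -[b]mul1r -(expr0 t); apply: pol_right_mem. Qed.

Lemma pol_right_gen B t : subring_set B -> pol_right B t t.
Proof.
move=> hB; have [B1 _ _] := hB; rewrite -[X in _ X]mulr1 -{2}(expr1 t).
exact: pol_right_mem.
Qed.

Lemma loc_left_sub S ti : S `<=` loc_left S ti.
Proof. by move=> s Ss; exists 0%N, s; rewrite expr0 mul1r. Qed.

Lemma loc_left_gen S ti : subring_set S -> loc_left S ti ti.
Proof. by move=> [S1 _ _]; exists 1%N, 1; rewrite expr1 mulr1. Qed.

Lemma loc_left_subring S t ti : t * ti = 1 -> ti * t = 1 ->
  S t -> subring_set S -> normalizes S t -> subring_set (loc_left S ti).
Proof.
move=> tti tit St hS nSt; have [S1 SB SM] := hS.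
have Xti n : t ^+ n * ti ^+ n = 1 by exact: exprMV.
have Xit n : ti ^+ n * t ^+ n = 1 by exact: exprMV.
split; first by exists 0%N, 1; rewrite expr0 mulr1.
  move=> _ _ [n [x [Sx ->]]] [m [y [Sy ->]]].
  exists (n + m)%N, (t ^+ m * x - t ^+ n * y); split.
    by apply: SB; apply: SM => //; apply: subring_setX.
  rewrite mulrBr !mulrA {1}exprD -(mulrA _ _ (t ^+ m)) Xit mulr1.
  by rewrite addnC exprD -(mulrA _ _ (t ^+ n)) Xit mulr1.
move=> _ _ [n [x [Sx ->]]] [m [y [Sy ->]]].
have [[x' Sx' e] _] := normalizesX m nSt Sx.
exists (n + m)%N, (x' * y); split; first exact: SM.
rewrite exprD -!mulrA; congr (_ * _).
rewrite -[LHS]mul1r -(Xit m) -!mulrA; congr (_ * _).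
by rewrite !mulrA e -(mulrA x') Xti mulr1.
Qed.

Lemma chain_le (I_ : nat -> set E) : (forall n, I_ n `<=` I_ n.+1) ->
  forall m n, (m <= n)%N -> I_ m `<=` I_ n.
Proof.
move=> asc m n /subnK <-; elim: (n - m)%N => [|d IH]; first by rewrite add0n.
by rewrite addSn => x /IH; apply: asc.
Qed.

(* Hilbert's basis theorem: the leading coefficients of the elements of degree
   at most [j] in the [n]-th ideal form a left ideal that grows with both [j]
   and [n], so that the diagonal bounds the whole array. Coefficients are
   written on the right, which makes these left ideals stable under the passage
   from [j] to [j.+1]. *)
Lemma left_noetherian_pol B t : subring_set B -> normalizes B t ->
  left_noetherian_in B -> left_noetherian_in (pol_right B t).
Proof.
move=> hB nBt noeB I hI asc.
have hS := pol_right_subring hB nBt.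
pose L j n : set E := [set c | exists b : nat -> E,
  [/\ forall i, B (b i), I n (\sum_(i < j.+1) t ^+ i * b i) & b j = c]].
have LI j n : lideal_in B (L j n).
  have [_ I0 IB IM] := hI n; split.
  - by move=> c [b [Bb _ <-]].
  - exists (fun=> 0); split=> //; first by move=> i; exact: subring_set0.
    by rewrite big1 // => i _; rewrite mulr0.
  - move=> _ _ [b [Bb Ib <-]] [c [Bc Ic <-]]; exists (fun i => b i - c i); split=> //.
      by move=> i; have [_ BB _] := hB; apply: BB.
    under eq_bigr do rewrite mulrBr.
    by rewrite sumrB; apply: IB.
  - move=> a _ Ba [b [Bb Ib <-]].
    (* Multiplying on the left by [a'], where [t ^+ j * a = a' * t ^+ j], changes the leading
       coefficient [b j] into exactly [a * b j]. *)
    have [[a' Ba' ea'] _] := normalizesX j nBt Ba.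
    have /choice[c hc] : forall i, exists c, B c /\ a' * t ^+ i = t ^+ i * c.
      by move=> i; have [_ [c ? ?]] := normalizesX i nBt Ba'; exists c.
    exists (fun i => if i == j then a * b j else c i * b i); split; last by rewrite eqxx.
      have [_ _ BM] := hB.
      by move=> i; case: ifP => _; apply: BM => //; exact: (hc i).1.
    have := IM a' _ (pol_right_sub t hB Ba') Ib.
    rewrite mulr_sumr; congr (I n _); apply: eq_bigr => i _.
    case: eqP => [->|_]; first by rewrite mulrA -ea' -mulrA.
    by rewrite mulrA (hc i).2 mulrA.
have Lj j n : L j n `<=` L j.+1 n.
  move=> _ [b [Bb Ib <-]]; exists (fun i => if i is i'.+1 then b i' else 0); split=> //.
    by case=> // ; exact: subring_set0.
  have [_ _ _ IM] := hI n.
  have := IM t _ (pol_right_gen t hB) Ib.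
  rewrite mulr_sumr [X in _ -> I n X]big_ord_recl mulr0 add0r.
  by congr (I n _); apply: eq_bigr => i _; rewrite /= exprS mulrA.
have Ln j n : L j n `<=` L j n.+1.
  by move=> c [b [Bb Ib bj]]; exists b; split=> //; exact: asc.
have [N0 hN0] : exists N, forall n, (N <= n)%N -> L n n `<=` L N N.
  apply: (noeB (fun n => L n n)) => // n x Lx.
  by apply: Ln; exact: Lj.
have /choice[Nf hNf] : forall j, exists N, forall n, (N <= n)%N -> L j n `<=` L j N.
  by move=> j; apply: (noeB (L j)).
(* [N0] stabilizes the diagonal, hence all degrees from [N0] on; the finitely many smaller degrees
   are stabilized by their own [Nf j]. *)
pose N := (N0 + \sum_(j < N0) Nf j)%N.
have Lle j n n' : (n <= n')%N -> L j n `<=` L j n' by exact: (chain_le (Ln j)).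
have hL j n : (N <= n)%N -> L j n `<=` L j N.
  move=> Nn; have [jN0|N0j] := ltnP j N0.
    have jN : (Nf j <= N)%N.
      by rewrite /N (bigD1 (Ordinal jN0)) //= addnCA leq_addr.
    move=> x /(hNf j n (leq_trans jN Nn)); exact: Lle.
  have N0N : (N0 <= N)%N by rewrite leq_addr.
  move=> x Lx; apply: (Lle j N0 N N0N); apply: (chain_le (fun j => Lj j N0) N0j).
  apply: (hN0 (maxn j n)); first by rewrite leq_max N0j.
  apply: (chain_le (fun j => Lj j _) (leq_maxl j n)).
  exact: (Lle _ _ _ (leq_maxr j n)).
exists N => n Nn r Ir.
have [sub _ _ _] := hI n; have [m [b [Bb er]]] := sub _ Ir.
(* Subtracting an element of [I N] with the same leading coefficient lowers the degree. *)
move: Ir; rewrite {}er; elim: m b Bb => [|m IH] b Bb Ib.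
  by rewrite big_ord0; have [] := hI N.
have [c [Bc Ic cb]] : L m N (b m) by apply: (hL m n Nn); exists b.
have [_ _ IBN _] := hI N; have [_ _ IBn _] := hI n.
have e : \sum_(i < m.+1) t ^+ i * b i - \sum_(i < m.+1) t ^+ i * c i
    = \sum_(i < m) t ^+ i * (b i - c i).
  rewrite -sumrB big_ord_recr /= cb subrr addr0.
  by apply: eq_bigr => i _; rewrite mulrBr.
have : I N (\sum_(i < m) t ^+ i * (b i - c i)).
  apply: (IH (fun i => b i - c i)) => [i|]; first by have [_ BB _] := hB; apply: BB.
  by rewrite -e; apply: IBn => //; exact: (chain_le asc Nn).
rewrite -e => h; rewrite -[X in I N X](subrK (\sum_(i < m.+1) t ^+ i * c i)).
rewrite -[X in _ + X]opprK; apply: (IBN) => //.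
by rewrite -sub0r; apply: IBN => //; have [] := hI N.
Qed.

(** A left ideal of the localization is generated by its trace on [S], since a power of [t] clears
    the denominator on the left; chains of traces therefore control chains of ideals. *)
Lemma left_noetherian_loc S t ti : t * ti = 1 -> ti * t = 1 ->
  S t -> subring_set S ->
  left_noetherian_in S -> left_noetherian_in (loc_left S ti).
Proof.
move=> tti tit St hS noeS I hI asc.
have Xti n : t ^+ n * ti ^+ n = 1 by exact: exprMV.
have hX n : loc_left S ti (ti ^+ n).
  by exists n, 1; rewrite mulr1; split=> //; have [] := hS.
have [n||N hN] := noeS (fun n => I n `&` S).
- have [I1 I2 I3 I4] := hI n; have [S1 SB SM] := hS; split.
  + by move=> x [].
  + by split=> //; exact: subring_set0.
  + by move=> x y [? ?] [? ?]; split; [apply: I3|apply: SB].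
  + by move=> a x Sa [? ?]; split; [apply: I4 => //; apply: loc_left_sub|apply: SM].
- by move=> n x [? ?]; split=> //; apply: asc.
exists N => n Nn r Ir.
have [sub _ _ IM] := hI n; have [m [s [Ss er]]] := sub _ Ir.
have [_ _ _ IMN] := hI N; rewrite er; apply: IMN => //.
have [] // := hN n Nn s; split=> //.
rewrite -[s]mul1r -(Xti m) -mulrA -er; apply: IM => //.
by apply: loc_left_sub; exact: subring_setX.
Qed.

End SubringExtensions.

Section BothSides.
Variable E : nzRingType.
Implicit Types (B S I : set E) (t ti : E).

(** The right-hand condition is the left-hand one in the converse ring, so that each extension
    theorem is proved on one side only. *)
Definition noetherian_in S : Prop :=
  left_noetherian_in S /\ @left_noetherian_in E^c S.

Lemma subring_set_converse S : subring_set S -> @subring_set E^c S.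
Proof. by move=> [S1 SB SM]; split=> // x y Sx Sy; exact: SM. Qed.

Lemma normalizes_converse B t : normalizes B t -> @normalizes E^c B t.
Proof.
move=> [n1 n2]; split=> b Bb.
  by have [b' Bb' e] := n2 b Bb; exists b'.
by have [b' Bb' e] := n1 b Bb; exists b'.
Qed.

Lemma exprc t n : (t : E^c) ^+ n = t ^+ n.
Proof. by elim: n => [|n IH] //; rewrite exprS exprSr IH. Qed.

Lemma pol_right_converse B t : @pol_right E^c B t = pol_left B t.
Proof.
apply/seteqP; split=> _ [n [b [Bb ->]]]; exists n, b; split=> //;
by apply: eq_bigr => i _; rewrite exprc.
Qed.

Lemma loc_left_converse B t : @loc_left E^c B t = loc_right B t.
Proof.
by apply/seteqP; split=> _ [n [b [Bb ->]]]; exists n, b; split=> //; rewrite exprc.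
Qed.

(** In the converse ring right coefficients become left ones; as [t] normalizes [B], both forms
    describe the same subring. *)
Lemma noetherian_pol B t : subring_set B -> normalizes B t ->
  noetherian_in B -> noetherian_in (pol_right B t).
Proof.
move=> hB nBt [lB rB]; split; first exact: left_noetherian_pol.
rewrite -pol_left_right // -pol_right_converse.
by apply: left_noetherian_pol => //;
  [exact: subring_set_converse|exact: normalizes_converse].
Qed.

Lemma noetherian_loc S t ti : t * ti = 1 -> ti * t = 1 ->
  S t -> subring_set S -> normalizes S t ->
  noetherian_in S -> noetherian_in (loc_left S ti).
Proof.
move=> tti tit St hS nSt [lS rS]; split; first exact: left_noetherian_loc tti tit _ _ _.
rewrite (loc_left_right tti tit nSt) -loc_left_converse.
by apply: (@left_noetherian_loc E^c S t ti) => //; exact: subring_set_converse.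
Qed.

End BothSides.

Section Scalars.
Variables (k : fieldType) (E : algType k).

Definition scalars : set E := range (in_alg E).

Lemma subring_scalars : subring_set scalars.
Proof.
split; first by exists 1 => //; rewrite /= scale1r.
  by move=> _ _ [a _ <-] [b _ <-]; exists (a - b) => //; rewrite rmorphB.
by move=> _ _ [a _ <-] [b _ <-]; exists (a * b) => //; rewrite rmorphM.
Qed.

Lemma normalizes_scalars t : normalizes scalars t.
Proof.
by split=> _ [a _ <-]; exists (a%:A); rewrite ?mulr_algl ?mulr_algr //; exists a.
Qed.

End Scalars.

Arguments scalars {k} E.

(** A nonzero left ideal contains a unit, so it is everything. The map [f] is a bare function so
    that the lemma also applies to the converse of an algebra. *)
Lemma left_noetherian_field (k : fieldType) (E : nzRingType) (f : k -> E)
    (S : set E) : S = range f ->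
    (forall a : k, a != 0 -> exists2 b, S b & b * f a = 1) ->
    f 0 = 0 -> left_noetherian_in S.
Proof.
move=> SE inv f0 I hI asc.
have [[N [x [Ix x0]]]|h] := pselect (exists N x, I N x /\ x != 0).
  exists N => n Nn r Ir.
  have [sub _ _ IM] := hI N; have /sub := Ix; rewrite SE => -[a _ xa].
  have a0 : a != 0 by apply: contraNneq x0 => a0; rewrite -xa a0 f0.
  have [b Sb bfa] := inv a a0.
  rewrite -[r]mulr1 -bfa; apply: (IM); last by apply: (IM) => //; rewrite xa.
  by have [sub' _ _ _] := hI n; apply: sub'.
exists 0%N => n _ r Ir.
have -> : r = 0 by apply: contrapT => /eqP r0; apply: h; exists n, r.
by have [] := hI 0%N.
Qed.

Lemma noetherian_scalars (k : fieldType) (E : algType k) :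
  noetherian_in (scalars E).
Proof.
split.
  apply: (@left_noetherian_field k E (in_alg E)) => // [a a0|]; last exact: scale0r.
  by exists (in_alg E a^-1); [exists a^-1|rewrite -rmorphM mulVf // rmorph1].
apply: (@left_noetherian_field k E^c (in_alg E)) => // [a a0|]; last exact: scale0r.
exists (in_alg E a^-1); first by exists a^-1.
by rewrite -[LHS]/(in_alg E a * in_alg E a^-1) -rmorphM mulfV // rmorph1.
Qed.

(** * Operators on functions and the skew Laurent ring *)

Local Notation C := algC.
Definition Cx := {c : C | c != 0}.
Definition torus := (Cx * Cx)%type.
Definition point := (torus * C)%type.

Definition Cx_mul (a b : Cx) : Cx := exist (fun c : C => c != 0) _ (mulf_neq0 (valP a) (valP b)).
Definition Cx_div (a b : Cx) : Cx :=
  exist (fun c : C => c != 0) _ (mulf_neq0 (valP a) (invr_neq0 (valP b))).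

Definition tphi (w : torus) : torus := (w.2, Cx_mul w.1 w.2).
Definition tpsi (w : torus) : torus := (Cx_div w.2 w.1, w.1).

Lemma tphiK : cancel tphi tpsi.
Proof.
by case=> a b; congr (_, _); apply: val_inj; rewrite /= mulfK // (valP b).
Qed.

Lemma tpsiK : cancel tpsi tphi.
Proof.
case=> a b; congr (_, _); apply: val_inj.
by rewrite /= divfK // (valP a).
Qed.

Definition phi (t : point) : point := (tphi t.1, t.2 + 1).
Definition psi (t : point) : point := (tpsi t.1, t.2 - 1).

Lemma phiK : cancel phi psi.
Proof. by case=> w s; rewrite /psi /phi /= tphiK addrK. Qed.

Lemma psiK : cancel psi phi.
Proof. by case=> w s; rewrite /psi /phi /= tpsiK subrK. Qed.

Lemma iter_phi n t : iter n phi t = (iter n tphi t.1, t.2 + n%:R).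
Proof.
elim: n => [|n IH]; first by rewrite addr0; case: t.
by rewrite iterS IH /phi /= -addrA -natr1.
Qed.

Local Notation Fn := (point -> C).

Definition fscale (c : C) (F : Fn) : Fn := fun t => c * F t.

(** Linearity is what makes composition distribute over a sum on its right and commute with
    scalars. *)
Record lop := Lop {
  lop_fun :> Fn -> Fn;
  lopP : forall (c : C) (F G : Fn),
    lop_fun (fscale c F + G) = fscale c (lop_fun F) + lop_fun G
}.

Lemma lop_ext (r s : lop) : (forall F t, r F t = s F t) -> r = s.
Proof.
case: r s => r hr [s hs] /= rs.
have ers : r = s by apply/funext => F; apply/funext => t.
by case: s / ers hs rs => hs _; congr Lop; apply: Prop_irrelevance.
Qed.

HB.instance Definition _ := gen_eqMixin lop.
HB.instance Definition _ := gen_choiceMixin lop.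

Lemma fscale1 F : fscale 1 F = F.
Proof. by apply/funext => t; exact: mul1r. Qed.

Lemma lopD (r : lop) F G : r (F + G) = r F + r G.
Proof. by have := lopP r 1 F G; rewrite !fscale1. Qed.

Lemma lop0 (r : lop) : r 0 = 0.
Proof. by apply: (addrI (r 0)); rewrite -lopD !addr0. Qed.

Lemma lopZ (r : lop) c F : r (fscale c F) = fscale c (r F).
Proof. by have := lopP r c F 0; rewrite lop0 !addr0. Qed.

Lemma fscaleD c (F G : Fn) : fscale c (F + G) = fscale c F + fscale c G.
Proof. by apply/funext => t; exact: mulrDr. Qed.

Lemma fscaleN c (F : Fn) : fscale c (- F) = - fscale c F.
Proof. by apply/funext => t; exact: mulrN. Qed.

Lemma fscaleA a b (F : Fn) : fscale a (fscale b F) = fscale (a * b) F.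
Proof. by apply/funext => t; exact: mulrA. Qed.

Lemma fscale0 c : fscale c 0 = 0.
Proof. by apply/funext => t; exact: mulr0. Qed.

Fact lop_zero_subproof (c : C) (F G : Fn) : (0 : Fn) = fscale c 0 + 0.
Proof. by rewrite fscale0 addr0. Qed.
Definition lop_zero : lop := @Lop (fun=> 0) lop_zero_subproof.

Fact lop_add_subproof (r s : lop) c (F G : Fn) :
  r (fscale c F + G) + s (fscale c F + G) =
  fscale c (r F + s F) + (r G + s G).
Proof. by rewrite !lopP fscaleD addrACA. Qed.
Definition lop_add (r s : lop) : lop := @Lop (fun F => r F + s F) (lop_add_subproof r s).

Fact lop_opp_subproof (r : lop) c (F G : Fn) :
  - r (fscale c F + G) = fscale c (- r F) + - r G.
Proof. by rewrite lopP opprD fscaleN. Qed.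
Definition lop_opp (r : lop) : lop := @Lop (fun F => - r F) (lop_opp_subproof r).

Fact lop_one_subproof c (F G : Fn) : fscale c F + G = fscale c F + G.
Proof. by []. Qed.
Definition lop_one : lop := @Lop id lop_one_subproof.

Fact lop_mul_subproof (r s : lop) c (F G : Fn) :
  r (s (fscale c F + G)) = fscale c (r (s F)) + r (s G).
Proof. by rewrite !lopP. Qed.
Definition lop_mul (r s : lop) : lop := @Lop (fun F => r (s F)) (lop_mul_subproof r s).

Fact lop_scale_subproof (a : C) (r : lop) c (F G : Fn) :
  fscale a (r (fscale c F + G)) = fscale c (fscale a (r F)) + fscale a (r G).
Proof. by rewrite lopP fscaleD !fscaleA mulrC. Qed.
Definition lop_scale (a : C) (r : lop) : lop := @Lop (fun F => fscale a (r F)) (lop_scale_subproof a r).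

Fact lop_addA : associative lop_add.
Proof. by move=> r s t; apply: lop_ext => F w; exact: addrA. Qed.
Fact lop_addC : commutative lop_add.
Proof. by move=> r s; apply: lop_ext => F w; exact: addrC. Qed.
Fact lop_add0 : left_id lop_zero lop_add.
Proof. by move=> r; apply: lop_ext => F w; exact: add0r. Qed.
Fact lop_addN : left_inverse lop_zero lop_opp lop_add.
Proof. by move=> r; apply: lop_ext => F w; exact: addNr. Qed.

HB.instance Definition _ :=
  GRing.isZmodule.Build lop lop_addA lop_addC lop_add0 lop_addN.

Fact lop_mulA : associative lop_mul.
Proof. by move=> r s t; apply: lop_ext. Qed.
Fact lop_mul1 : left_id lop_one lop_mul.
Proof. by move=> r; apply: lop_ext. Qed.
Fact lop_mulr1 : right_id lop_one lop_mul.
Proof. by move=> r; apply: lop_ext. Qed.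
Fact lop_mulDl : left_distributive lop_mul lop_add.
Proof. by move=> r s t; apply: lop_ext. Qed.
Fact lop_mulDr : right_distributive lop_mul lop_add.
Proof. by move=> r s t; apply: lop_ext => F w /=; rewrite lopD. Qed.

Definition one_Cx : Cx := exist (fun c : C => c != 0) 1 (oner_neq0 C).

Fact lop_one_neq0 : lop_one != lop_zero.
Proof.
apply/eqP => /(congr1 (fun r : lop => r (fun=> 1) ((one_Cx, one_Cx), 0))) /= /eqP.
by rewrite oner_eq0.
Qed.

HB.instance Definition _ := GRing.Zmodule_isNzRing.Build lop
  lop_mulA lop_mul1 lop_mulr1 lop_mulDl lop_mulDr lop_one_neq0.

Fact lop_scaleA a b r : lop_scale a (lop_scale b r) = lop_scale (a * b) r.
Proof. by apply: lop_ext => F w; exact: mulrA. Qed.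
Fact lop_scale1 : left_id 1 lop_scale.
Proof. by move=> r; apply: lop_ext => F w; exact: mul1r. Qed.
Fact lop_scaleDr : right_distributive lop_scale +%R.
Proof. by move=> a r s; apply: lop_ext => F w; exact: mulrDr. Qed.
Fact lop_scaleDl r : {morph lop_scale^~ r : a b / a + b}.
Proof. by move=> a b; apply: lop_ext => F w; exact: mulrDl. Qed.

HB.instance Definition _ := GRing.Zmodule_isLmodule.Build C lop
  lop_scaleA lop_scale1 lop_scaleDr lop_scaleDl.

Fact lop_scaleAl (a : C) (r s : lop) : a *: (r * s) = (a *: r) * s.
Proof. exact: lop_ext. Qed.
HB.instance Definition _ := GRing.Lmodule_isLalgebra.Build C lop lop_scaleAl.
Fact lop_scaleAr (a : C) (r s : lop) : a *: (r * s) = r * (a *: s).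
Proof. by apply: lop_ext => F w /=; rewrite lopZ. Qed.
HB.instance Definition _ := GRing.Lalgebra_isAlgebra.Build C lop lop_scaleAr.

Lemma lop_sumE (I : Type) (r : seq I) (P : pred I) (f : I -> lop) F t :
  (\sum_(i <- r | P i) f i) F t = \sum_(i <- r | P i) f i F t.
Proof. by apply: (big_morph (fun s : lop => s F t)). Qed.

Fact mu_subproof (f : Fn) c (F G : Fn) :
  f * (fscale c F + G) = fscale c (f * F) + f * G.
Proof.
apply/funext => t; rewrite -[LHS]/(f t * (c * F t + G t)).
by rewrite -[RHS]/(c * (f t * F t) + f t * G t) mulrDr mulrCA.
Qed.
Definition mu (f : Fn) : lop := @Lop (fun F => f * F) (mu_subproof f).

Lemma muE f F t : mu f F t = f t * F t. Proof. by []. Qed.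

Fact pull_subproof (h : point -> point) c (F G : Fn) :
  (fscale c F + G) \o h = fscale c (F \o h) + (G \o h).
Proof. by []. Qed.
Definition pull h := @Lop (fun F => F \o h) (pull_subproof h).

Definition opZ := pull phi.
Definition opZi := pull psi.

Lemma opZK : opZi * opZ = 1.
Proof. by apply: lop_ext => F t; rewrite /= psiK. Qed.

Lemma opZiK : opZ * opZi = 1.
Proof. by apply: lop_ext => F t; rewrite /= phiK. Qed.

Lemma opZX n F t : (opZ ^+ n) F t = F (iter n phi t).
Proof.
elim: n F t => [|n IH] F t; first by rewrite expr0.
by rewrite exprSr -[LHS]/((opZ ^+ n) (opZ F) t) IH.
Qed.

Lemma opZ_mu f : opZ * mu f = mu (f \o phi) * opZ.
Proof. exact: lop_ext. Qed.

Lemma opZi_mu f : opZi * mu f = mu (f \o psi) * opZi.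
Proof. exact: lop_ext. Qed.

Lemma opZX_mu n f : opZ ^+ n * mu f = mu (f \o iter n phi) * opZ ^+ n.
Proof.
apply: lop_ext => F t.
rewrite -[LHS]/((opZ ^+ n) (mu f F) t) -[RHS]/(f (iter n phi t) * (opZ ^+ n) F t).
by rewrite !opZX.
Qed.

Lemma muM f g : mu (f * g) = mu f * mu g.
Proof. by apply: lop_ext => F t; rewrite /= -mulrA. Qed.

Lemma muD f g : mu (f + g) = mu f + mu g.
Proof. by apply: lop_ext => F t; rewrite -[LHS]/((f t + g t) * F t) mulrDl. Qed.

Lemma muN f : mu (- f) = - mu f.
Proof. by apply: lop_ext => F t; rewrite -[LHS]/((- f t) * F t) mulNr. Qed.

Lemma muB f g : mu (f - g) = mu f - mu g.
Proof. by rewrite muD muN. Qed.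

Lemma mu1 : mu 1 = 1.
Proof. by apply: lop_ext => F t; rewrite -[LHS]/(1 * F t) mul1r. Qed.

Lemma mu0 : mu 0 = 0.
Proof. by apply: lop_ext => F t; rewrite -[LHS]/(0 * F t) mul0r. Qed.

Lemma muZ (c : C) f : mu (fscale c f) = c *: mu f.
Proof. by apply: lop_ext => F t; rewrite -[LHS]/((c * f t) * F t) -mulrA. Qed.

Lemma muC f g : mu f * mu g = mu g * mu f.
Proof. by rewrite -!muM; congr mu; apply/funext => t; exact: mulrC. Qed.

Lemma mu_inj : injective mu.
Proof.
move=> f g /(congr1 (fun r : lop => r 1)) /= e; apply/funext => t.
by have := congr1 (fun F : Fn => F t) e; rewrite /= -[LHS]/(f t * 1) -[RHS]/(g t * 1) !mulr1.
Qed.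

Lemma muX f n : mu f ^+ n = mu (fun t => f t ^+ n).
Proof.
elim: n => [|n IH]; first by rewrite expr0 -mu1.
by rewrite exprS IH -muM; congr mu; apply/funext => t; rewrite exprS.
Qed.

Definition mono (v : int * int) (w : torus) : C := val w.1 ^ v.1 * val w.2 ^ v.2.

Definition lift (f : torus -> C) : Fn := fun t => f t.1.
Definition muT (f : torus -> C) := mu (lift f).

Definition height (t : point) : C := t.2.
Definition opU := mu height.

Definition opX := muT (mono (1, 0)).
Definition opXi := muT (mono (-1, 0)).
Definition opY := muT (mono (0, 1)).
Definition opYi := muT (mono (0, -1)).

Lemma monoD u v w : mono (u + v) w = mono u w * mono v w.
Proof.
case: w => [[a a0] [b b0]]; rewrite /mono /=.
by rewrite !expfzDr // mulrACA.
Qed.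

Lemma mono0 w : mono 0 w = 1.
Proof. by rewrite /mono /= !expr0z mulr1. Qed.

Lemma mono_tphi v w : mono v (tphi w) = mono (v.2, v.1 + v.2) w.
Proof.
case: w v => [[a a0] [b b0]] [i j]; rewrite /mono /= exprzMl ?unitfE //.
by rewrite expfzDr // mulrCA.
Qed.

Lemma muT_mono_M u v : muT (mono u) * muT (mono v) = muT (mono (u + v)).
Proof. by rewrite -muM; congr mu; apply/funext => t; rewrite /lift monoD. Qed.

Lemma muT_mono0 : muT (mono 0) = 1.
Proof. by rewrite -mu1; congr mu; apply/funext => t; rewrite /lift mono0. Qed.

Lemma opXK : opXi * opX = 1. Proof. by rewrite muT_mono_M -muT_mono0. Qed.
Lemma opXiK : opX * opXi = 1. Proof. by rewrite muT_mono_M -muT_mono0. Qed.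
Lemma opYK : opYi * opY = 1. Proof. by rewrite muT_mono_M -muT_mono0. Qed.
Lemma opYiK : opY * opYi = 1. Proof. by rewrite muT_mono_M -muT_mono0. Qed.

(** Each stage adjoins a normalizing element or inverts one, so that the noetherian property climbs
    the tower. Commutativity provides the normalizing condition up to [setB]; only the adjunction of
    [opZ] is noncommutative. *)
Definition setAx := loc_left (pol_right (scalars lop) opX) opXi.
Definition setA := loc_left (pol_right setAx opY) opYi.
Definition setB := pol_right setA opU.
Definition setR := loc_left (pol_right setB opZ) opZi.

Lemma pol_right_min (E : nzRingType) (B S : set E) t :
  subring_set S -> B `<=` S -> S t -> pol_right B t `<=` S.
Proof.
move=> hS BS St _ [n [b [Bb ->]]]; apply: subring_set_sum => // i _.
by have [_ _ SM] := hS; apply: SM; [exact: subring_setX|exact: BS].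
Qed.

Lemma loc_left_min (E : nzRingType) (B S : set E) t :
  subring_set S -> B `<=` S -> S t -> loc_left B t `<=` S.
Proof.
move=> hS BS St _ [n [b [Bb ->]]].
by have [_ _ SM] := hS; apply: SM; [exact: subring_setX|exact: BS].
Qed.

(** This and its two analogues serve as induction principles: a property of all elements is checked
    on the generators, once it is known to define a subring. *)
Lemma setA_min S : subring_set S -> scalars lop `<=` S ->
  S opX -> S opXi -> S opY -> S opYi -> setA `<=` S.
Proof.
by move=> hS Sk SX SXi SY SYi; do 4!
  [apply: loc_left_min => //|apply: pol_right_min => //].
Qed.

Lemma setB_min S : subring_set S -> scalars lop `<=` S ->
  S opX -> S opXi -> S opY -> S opYi -> S opU -> setB `<=` S.
Proof. by move=> *; apply: pol_right_min => //; apply: setA_min. Qed.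

Lemma setR_min S : subring_set S -> scalars lop `<=` S ->
  S opX -> S opXi -> S opY -> S opYi -> S opU -> S opZ -> S opZi -> setR `<=` S.
Proof.
by move=> *; apply: loc_left_min => //; apply: pol_right_min => //; apply: setB_min.
Qed.

Lemma subring_range_mu : subring_set (range mu).
Proof.
split; first by exists 1 => //; exact: mu1.
  by move=> _ _ [f _ <-] [g _ <-]; exists (f - g) => //; exact: muB.
by move=> _ _ [f _ <-] [g _ <-]; exists (f * g) => //; exact: muM.
Qed.

Lemma scalars_range_mu : scalars lop `<=` range mu.
Proof. by move=> _ [c _ <-]; exists (fscale c 1) => //; rewrite muZ mu1. Qed.

Lemma setB_mu : setB `<=` range mu.
Proof.
apply: setB_min; try (by eexists); [exact: subring_range_mu|exact: scalars_range_mu].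
Qed.

Lemma range_mu_normalizes (S : set lop) f : S `<=` range mu -> normalizes S (mu f).
Proof.
move=> Smu; split=> b Sb; exists b => //; have [g _ <-] := Smu _ Sb;
exact: muC.
Qed.

(** Multiplication operators commute, so that lying in [range mu] makes every further multiplication
    operator normalize [S]. *)
Definition noeth_mu (S : set lop) : Prop :=
  [/\ subring_set S, S `<=` range mu & noetherian_in S].

Lemma noeth_mu_pol S f : noeth_mu S -> noeth_mu (pol_right S (mu f)).
Proof.
move=> [hS Smu nS]; have nSf := range_mu_normalizes f Smu.
split; [exact: pol_right_subring| |exact: noetherian_pol].
by apply: pol_right_min => //; exact: subring_range_mu.
Qed.

Lemma noeth_mu_loc S f fi : noeth_mu S -> S (mu f) -> mu f * mu fi = 1 ->
  noeth_mu (loc_left S (mu fi)).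
Proof.
move=> [hS Smu nS] Sf ffi; have nSf := range_mu_normalizes f Smu.
have fif : mu fi * mu f = 1 by rewrite muC.
split; [exact: loc_left_subring ffi fif _ _ _| |exact: noetherian_loc ffi fif _ _ _ _].
by apply: loc_left_min => //; exact: subring_range_mu.
Qed.

Lemma noeth_mu_scalars : noeth_mu (scalars lop).
Proof.
split; [exact: subring_scalars|exact: scalars_range_mu|exact: noetherian_scalars].
Qed.

Lemma noeth_mu_setAx : noeth_mu setAx.
Proof.
have h := noeth_mu_pol (lift (mono (1, 0))) noeth_mu_scalars.
apply: (noeth_mu_loc h) opXiK; apply: pol_right_gen; exact: subring_scalars.
Qed.

Lemma noeth_mu_setA : noeth_mu setA.
Proof.
have h := noeth_mu_pol (lift (mono (0, 1))) noeth_mu_setAx.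
apply: (noeth_mu_loc h) opYiK; apply: pol_right_gen.
by have [] := noeth_mu_setAx.
Qed.

Lemma noeth_mu_setB : noeth_mu setB.
Proof. exact: noeth_mu_pol noeth_mu_setA. Qed.

Lemma subring_setA : subring_set setA. Proof. by have [] := noeth_mu_setA. Qed.
Lemma subring_setB : subring_set setB. Proof. by have [] := noeth_mu_setB. Qed.

Lemma setA_gens : [/\ scalars lop `<=` setA, setA opX, setA opXi, setA opY & setA opYi].
Proof.
have hAx : subring_set setAx by have [] := noeth_mu_setAx.
have Ax1 : pol_right (scalars lop) opX `<=` setAx by exact: loc_left_sub.
have AxA : setAx `<=` setA.
  by move=> x Sx; apply: loc_left_sub; exact: pol_right_sub.
have hk := subring_scalars lop; split.
- by move=> x kx; apply/AxA/Ax1; exact: pol_right_sub.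
- by apply/AxA/Ax1; exact: pol_right_gen.
- apply/AxA; apply: loc_left_gen.
  by have [] := noeth_mu_pol (lift (mono (1, 0))) noeth_mu_scalars.
- by apply: loc_left_sub; apply: pol_right_gen.
- apply: loc_left_gen.
  by have [] := noeth_mu_pol (lift (mono (0, 1))) noeth_mu_setAx.
Qed.

Lemma setA_sub_setB : setA `<=` setB.
Proof. by apply: pol_right_sub; exact: subring_setA. Qed.

Lemma setB_opU : setB opU.
Proof. by apply: pol_right_gen; exact: subring_setA. Qed.

Lemma conj_subring (E : nzRingType) (S : set E) t ti : t * ti = 1 -> ti * t = 1 ->
  subring_set S -> subring_set [set b | S (t * b * ti)].
Proof.
move=> tti tit [S1 SB SM]; split => /=.
- by rewrite mulr1 tti.
- by move=> x y Sx Sy; rewrite mulrBr mulrBl; apply: SB.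
move=> x y Sx Sy.
have -> : t * (x * y) * ti = t * x * ti * (t * y * ti).
  by rewrite -!mulrA (mulrA ti t) tit mul1r.
exact: SM.
Qed.

Lemma opZ_muK f : opZ * mu f * opZi = mu (f \o phi).
Proof. by rewrite opZ_mu -mulrA opZiK mulr1. Qed.

Lemma opZi_muK f : opZi * mu f * opZ = mu (f \o psi).
Proof. by rewrite opZi_mu -mulrA opZK mulr1. Qed.

Lemma lift_phi f : lift f \o phi = lift (f \o tphi). Proof. by []. Qed.
Lemma lift_psi f : lift f \o psi = lift (f \o tpsi). Proof. by []. Qed.

Lemma mono_tpsi v w : mono v (tpsi w) = mono (v.2 - v.1, v.1) w.
Proof.
rewrite -{2}(tpsiK w) mono_tphi /=; case: v => a b /=.
by rewrite subrK.
Qed.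

Lemma scalar_conj c t ti : t * ti = 1 -> (t * (c%:A : lop) * ti) = c%:A.
Proof. by move=> tti; rewrite mulr_algr -scalerAl tti. Qed.

Lemma setA_mono_gens (S : set lop) : subring_set S ->
  S opX -> S opXi -> S opY -> S opYi -> forall v, S (muT (mono v)).
Proof.
move=> hS SX SXi SY SYi.
have [_ _ SM] := hS.
have SX' : forall i : int, S (muT (mono (i, 0))).
  suff h : forall n : nat, S (muT (mono (n%:Z, 0))) /\ S (muT (mono (- n%:Z, 0))).
    (* The second constructor of [int] stands for -(n + 1), whence the shift. *)
    by case=> n; [exact: (h n).1|exact: (h n.+1).2].
  elim=> [|n [IH1 IH2]]; first by rewrite oppr0 muT_mono0; have [] := hS.
  split.
    by rewrite -(_ : (1, 0) + (n%:Z, 0) = (n.+1%:Z, 0)) ?muT_mono_M -?muT_mono_M //; apply: SM.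
  rewrite -(_ : (-1, 0) + (- n%:Z, 0) = (- n.+1%:Z, 0)) -?muT_mono_M; first exact: SM.
  by congr (_, _); rewrite -opprD.
have SY' : forall i : int, S (muT (mono (0, i))).
  suff h : forall n : nat, S (muT (mono (0, n%:Z))) /\ S (muT (mono (0, - n%:Z))).
    by case=> n; [exact: (h n).1|exact: (h n.+1).2].
  elim=> [|n [IH1 IH2]]; first by rewrite oppr0 muT_mono0; have [] := hS.
  split.
    by rewrite -(_ : (0, 1) + (0, n%:Z) = (0, n.+1%:Z)) ?muT_mono_M -?muT_mono_M //; apply: SM.
  rewrite -(_ : (0, -1) + (0, - n%:Z) = (0, - n.+1%:Z)) -?muT_mono_M; first exact: SM.
  by congr (_, _); rewrite -opprD.
case=> i j; rewrite -(_ : (i, 0) + (0, j) = (i, j)) -?muT_mono_M; first exact: SM.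
by congr (_, _); rewrite ?addr0 ?add0r.
Qed.

Lemma setA_mono v : setA (muT (mono v)).
Proof.
have [_ ? ? ? ?] := setA_gens.
by apply: setA_mono_gens v => //; exact: subring_setA.
Qed.

Lemma setA_conjZ x : setA x -> setA (opZ * x * opZi).
Proof.
suff : setA `<=` [set b | setA (opZ * b * opZi)] by apply.
have mZ v : setA (opZ * muT (mono v) * opZi).
  rewrite opZ_muK lift_phi.
  rewrite (_ : mono v \o tphi = mono (v.2, v.1 + v.2)); first exact: setA_mono.
  by apply/funext => w; exact: mono_tphi.
apply: setA_min => //; try exact: mZ.
  by apply: conj_subring opZiK opZK _; exact: subring_setA.
move=> _ [c _ <-]; rewrite /= scalar_conj ?opZiK //.
by have [h _ _ _ _] := setA_gens; apply: h; exists c.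
Qed.

Lemma setA_conjZi x : setA x -> setA (opZi * x * opZ).
Proof.
suff : setA `<=` [set b | setA (opZi * b * opZ)] by apply.
have mZ v : setA (opZi * muT (mono v) * opZ).
  rewrite opZi_muK lift_psi.
  rewrite (_ : mono v \o tpsi = mono (v.2 - v.1, v.1)); first exact: setA_mono.
  by apply/funext => w; exact: mono_tpsi.
apply: setA_min => //; try exact: mZ.
  by apply: conj_subring opZK opZiK _; exact: subring_setA.
move=> _ [c _ <-]; rewrite /= scalar_conj ?opZK //.
by have [h _ _ _ _] := setA_gens; apply: h; exists c.
Qed.

Lemma setB_conjZ x : setB x -> setB (opZ * x * opZi).
Proof.
suff : setB `<=` [set b | setB (opZ * b * opZi)] by apply.
apply: pol_right_min.
- by apply: conj_subring opZiK opZK _; exact: subring_setB.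
- by move=> a Aa; apply: setA_sub_setB; exact: setA_conjZ.
rewrite /= opZ_muK.
have -> : height \o phi = height + 1 by [].
rewrite muD mu1; apply: subring_setD; [exact: subring_setB|exact: setB_opU|].
by have [] := subring_setB.
Qed.

Lemma setB_conjZi x : setB x -> setB (opZi * x * opZ).
Proof.
suff : setB `<=` [set b | setB (opZi * b * opZ)] by apply.
apply: pol_right_min.
- by apply: conj_subring opZK opZiK _; exact: subring_setB.
- by move=> a Aa; apply: setA_sub_setB; exact: setA_conjZi.
rewrite /= opZi_muK.
have -> : height \o psi = height - 1 by [].
have [B1 BB _] := subring_setB.
by rewrite muB mu1; apply: BB => //; exact: setB_opU.
Qed.

Lemma setB_normalizesZ : normalizes setB opZ.
Proof.
split=> b Bb.
  exists (opZ * b * opZi); first exact: setB_conjZ.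
  by rewrite -(mulrA (opZ * b)) opZK mulr1.
exists (opZi * b * opZ); first exact: setB_conjZi.
by rewrite !mulrA opZiK mul1r.
Qed.

Lemma subring_setBZ : subring_set (pol_right setB opZ).
Proof. by apply: pol_right_subring; [exact: subring_setB|exact: setB_normalizesZ]. Qed.

Lemma setBZ_opZ : pol_right setB opZ opZ.
Proof. by apply: pol_right_gen; exact: subring_setB. Qed.

(** Inverting [opZ] requires it to normalize the whole skew polynomial ring, not only its
    coefficient ring. *)
Lemma setBZ_normalizesZ : normalizes (pol_right setB opZ) opZ.
Proof.
have conjZ x : pol_right setB opZ x -> pol_right setB opZ (opZ * x * opZi).
  suff : pol_right setB opZ `<=` [set b | pol_right setB opZ (opZ * b * opZi)] by apply.
  apply: pol_right_min.
  - by apply: conj_subring opZiK opZK _; exact: subring_setBZ.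
  - by move=> b Bb; apply: pol_right_sub; [exact: subring_setB|exact: setB_conjZ].
  suff : pol_right setB opZ (opZ * opZ * opZi) by [].
  by rewrite -mulrA opZiK mulr1; exact: setBZ_opZ.
have conjZi x : pol_right setB opZ x -> pol_right setB opZ (opZi * x * opZ).
  suff : pol_right setB opZ `<=` [set b | pol_right setB opZ (opZi * b * opZ)] by apply.
  apply: pol_right_min.
  - by apply: conj_subring opZK opZiK _; exact: subring_setBZ.
  - by move=> b Bb; apply: pol_right_sub; [exact: subring_setB|exact: setB_conjZi].
  suff : pol_right setB opZ (opZi * opZ * opZ) by [].
  by rewrite opZK mul1r; exact: setBZ_opZ.
split=> b Bb.
  exists (opZ * b * opZi); first exact: conjZ.
  by rewrite -(mulrA (opZ * b)) opZK mulr1.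
exists (opZi * b * opZ); first exact: conjZi.
by rewrite !mulrA opZiK mul1r.
Qed.

Lemma subring_setR : subring_set setR.
Proof.
by apply: loc_left_subring opZiK opZK _ _ _;
  [exact: setBZ_opZ|exact: subring_setBZ|exact: setBZ_normalizesZ].
Qed.

Lemma noetherian_setR : noetherian_in setR.
Proof.
apply: noetherian_loc opZiK opZK _ _ _ _;
  [exact: setBZ_opZ|exact: subring_setBZ|exact: setBZ_normalizesZ|].
apply: noetherian_pol; [exact: subring_setB|exact: setB_normalizesZ|].
by have [] := noeth_mu_setB.
Qed.

Lemma setB_sub_setR : setB `<=` setR.
Proof. by move=> b Bb; apply: loc_left_sub; apply: pol_right_sub => //; exact: subring_setB. Qed.

Lemma setA_sub_setR : setA `<=` setR.
Proof. by move=> a Aa; apply/setB_sub_setR/setA_sub_setB. Qed.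

Lemma setR_opZ : setR opZ.
Proof. by apply: loc_left_sub; exact: setBZ_opZ. Qed.

Lemma setR_opZi : setR opZi.
Proof. by apply: loc_left_gen; exact: subring_setBZ. Qed.

Definition laurent (f : torus -> C) : Prop :=
  exists l : seq (C * (int * int)), forall w, f w = \sum_(p <- l) p.1 * mono p.2 w.

Lemma setA_laurent f : setA (muT f) <-> laurent f.
Proof.
split; last first.
  move=> [l fE].
  have -> : muT f = \sum_(p <- l) p.1 *: muT (mono p.2).
    apply: lop_ext => F t; rewrite lop_sumE.
    rewrite -[LHS]/(f t.1 * F t) fE mulr_suml; apply: eq_bigr => p _.
    by rewrite -mulrA.
  apply: subring_set_sum => [|p _]; first exact: subring_setA.
  have [_ _ SM] := subring_setA; rewrite -mulr_algl; apply: SM; last exact: setA_mono.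
  by have [h _ _ _ _] := setA_gens; apply: h; exists p.1.
(* As [mu] is injective, it suffices to find some Laurent function with the same operator, a
   property that can be checked on generators. *)
move=> Af; suff [g lg /mu_inj e] : exists2 g, laurent g & muT f = muT g.
  have -> // : f = g.
  by apply/funext => w; have := congr1 (fun F : Fn => F (w, 0)) e.
move: Af; move: (muT f) => r.
suff : setA `<=` [set r | exists2 g, laurent g & r = muT g] by apply.
have lmono v : exists2 g, laurent g & muT (mono v) = muT g.
  by exists (mono v) => //; exists [:: (1, v)] => w; rewrite big_seq1 mul1r.
apply: setA_min; try exact: lmono.
  split.
  - by rewrite -muT_mono0; exact: lmono.
  - move=> _ _ [f1 [l1 h1] ->] [f2 [l2 h2] ->]; exists (f1 - f2); last first.
      by rewrite -muB.
    exists (l1 ++ [seq (- p.1, p.2) | p <- l2]) => w.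
    rewrite big_cat big_map /= -h1 (_ : \sum_(j <- l2) _ = - f2 w) //.
    by rewrite h2 -sumrN; apply: eq_bigr => p _; rewrite mulNr.
  - move=> _ _ [f1 [l1 h1] ->] [f2 [l2 h2] ->]; exists (f1 * f2); last first.
      by rewrite -muM.
    exists [seq (p.1 * q.1, p.2 + q.2) | p <- l1, q <- l2] => w.
    rewrite -[LHS]/(f1 w * f2 w) big_allpairs_dep h1 h2 mulr_suml.
    apply: eq_bigr => p _; rewrite mulr_sumr; apply: eq_bigr => q _ /=.
    by rewrite monoD mulrACA.
move=> _ [c _ <-]; exists (fun=> c).
  by exists [:: (c, 0)] => w; rewrite big_seq1 mono0 mulr1.
by apply: lop_ext => F t; rewrite -[LHS]/(c * F t).
Qed.

Lemma setA_muT r : setA r -> exists2 f, laurent f & r = muT f.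
Proof.
move=> Ar; suff [f e] : exists f, r = muT f.
  by exists f => //; apply/setA_laurent; rewrite -e.
move: r Ar.
suff : setA `<=` [set r | exists f, r = muT f] by move=> h r /h.
apply: setA_min; try by eexists.
  split; first by exists (mono 0); rewrite muT_mono0.
    by move=> _ _ [f ->] [g ->]; exists (f - g); rewrite -muB.
  by move=> _ _ [f ->] [g ->]; exists (f * g); rewrite -muM.
by move=> _ [c _ <-]; exists (fun=> c); apply: lop_ext.
Qed.

Lemma setB_mu_sum r : setB r ->
  exists n (a : nat -> torus -> C), (forall i, laurent (a i)) /\
    r = mu (fun t => \sum_(i < n) a i t.1 * t.2 ^+ i).
Proof.
move=> [n [b [Ab ->]]].
have /choice[a ha] : forall i, exists f, laurent f /\ b i = muT f.
  by move=> i; have [f ? ?] := setA_muT (Ab i); exists f.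
exists n, a; split=> [i|]; first exact: (ha i).1.
apply: lop_ext => F t; rewrite lop_sumE muE mulr_suml; apply: eq_bigr => i _.
rewrite (ha i).2 /opU muX.
by rewrite -[LHS]/(t.2 ^+ i * (a i t.1 * F t)) mulrCA mulrA.
Qed.

Lemma setB_sum n (a : nat -> torus -> C) : (forall i, laurent (a i)) ->
  setB (mu (fun t => \sum_(i < n) a i t.1 * t.2 ^+ i)).
Proof.
move=> la; exists n, (fun i => muT (a i)); split=> [i|]; first exact/setA_laurent.
apply: lop_ext => F t; rewrite lop_sumE muE mulr_suml; apply: eq_bigr => i _.
by rewrite /opU muX -[RHS]/(t.2 ^+ i * (a i t.1 * F t)) mulrCA mulrA.
Qed.

(** * Finite codimension of stable ideals of the torus *)

Local Notation vec := (int * int)%type.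
(** The action of [tphi] on exponents of monomials, by the Fibonacci matrix. *)
Definition Mv (v : vec) : vec := (v.2, v.1 + v.2).
Definition dot (u v : vec) : int := u.1 * v.1 + u.2 * v.2.
Definition det2 (u v : vec) : int := u.1 * v.2 - u.2 * v.1.

Lemma iter_MvD n u v : iter n Mv (u + v) = iter n Mv u + iter n Mv v.
Proof.
elim: n => //= n ->; case: (iter n Mv u) (iter n Mv v) => [a b] [c d].
by congr (_, _); rewrite /= addrACA.
Qed.

Lemma iter_MvB n u v : iter n Mv (u - v) = iter n Mv u - iter n Mv v.
Proof. by apply/eqP; rewrite eq_sym subr_eq -iter_MvD subrK. Qed.

Lemma mono_iter v n w : mono v (iter n tphi w) = mono (iter n Mv v) w.
Proof. by elim: n v => // n IH v; rewrite iterS mono_tphi IH -iterSr. Qed.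

(** This is the norm form of the ring of integers generated by the golden ratio. Infinite descent:
    modulo 2 the form vanishes only at the origin, so both coordinates are even and can be
    halved. *)
Lemma golden_norm_eq0 (a b : int) : a * a + a * b - b * b = 0 -> a = 0 /\ b = 0.
Proof.
have [n] := ubnP (`|a| + `|b|)%N; elim: n a b => // n IH a b lt h.
have [x [ra [xa ha]]] : exists x r, a = 2 * x + r /\ (r = 0 \/ r = 1).
  by exists (a %/ 2)%Z, (a %% 2)%Z; lia.
have [y [rb [yb hb]]] : exists x r, b = 2 * x + r /\ (r = 0 \/ r = 1).
  by exists (b %/ 2)%Z, (b %% 2)%Z; lia.
have [ra0 rb0] : ra = 0 /\ rb = 0.
  move: h; rewrite xa yb; case: ha hb => -> [] ->; first by [].
  - by move=> h; exfalso; lia.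
  - by move=> h; exfalso; lia.
  - by move=> h; exfalso; lia.
move: xa yb; rewrite ra0 rb0 !addr0 => xa yb.
have [a0|a0] := eqVneq a 0.
  by split=> //; move: h; rewrite a0; nia.
have [||x0 y0] := IH x y; [lia|by move: h; rewrite xa yb; lia|].
by rewrite xa yb x0 y0.
Qed.

(** Since the square of [Mv] is [Mv] plus the identity, these determinants obey the Fibonacci
    recurrence; they start with 0 and the norm of [d], hence are Fibonacci numbers times that
    norm. *)
Lemma det2_iter d m : d != 0 -> (0 < m)%N -> det2 d (iter m Mv d) != 0.
Proof.
case: d => a b d0; case: m => // m _.
have N0 : a * a + a * b - b * b != 0.
  apply: contraNneq d0 => /golden_norm_eq0[-> ->] //.
have rec n : det2 (a, b) (iter n.+2 Mv (a, b)) =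
    det2 (a, b) (iter n.+1 Mv (a, b)) + det2 (a, b) (iter n Mv (a, b)).
  by rewrite /= /det2; case: (iter n Mv (a, b)) => x y /=; ring.
suff [c [c' [c0 c'0 _ ->]]] : exists c c' : int, [/\ 0 <= c, 0 < c',
    det2 (a, b) (iter m Mv (a, b)) = c * (a * a + a * b - b * b) &
    det2 (a, b) (iter m.+1 Mv (a, b)) = c' * (a * a + a * b - b * b)].
  by rewrite mulf_neq0 // gt_eqF.
elim: m => [|m [c [c' [c0 c'0 e e']]]].
  by exists 0, 1; split=> //; rewrite /det2 /=; ring.
exists c', (c' + c); split=> //; first exact: ltW.
  exact: ltr_pwDl.
by rewrite rec e e' mulrDl.
Qed.

Lemma det2_Mv u v : det2 (Mv u) (Mv v) = - det2 u v.
Proof. by rewrite /det2 /=; ring. Qed.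

(** [Mv] has determinant -1, so that up to sign the first iterate may be replaced by [d] itself. *)
Lemma det2_iter2 d m n : d != 0 -> (m < n)%N ->
  det2 (iter m Mv d) (iter n Mv d) != 0.
Proof.
move=> d0 mn; have := @det2_iter d (n - m) d0; rewrite subn_gt0 => /(_ mn).
rewrite -{2}(subnK (ltnW mn)); move: (n - m)%N => l.
elim: m {mn} => [|m IH] h; first by rewrite addn0.
by rewrite addnS !iterS det2_Mv oppr_eq0 IH.
Qed.

Lemma seq_bound (T : eqType) (g : T -> int) (l : seq T) :
  exists2 c, 0 <= c & forall x, x \in l -> g x <= c.
Proof.
elim: l => [|x l [c c0 IH]]; first by exists 0.
exists (Num.max (g x) c); first by rewrite le_max c0 orbT.
by move=> y; rewrite inE le_max => /predU1P[->|/IH ->]; rewrite ?lexx ?orbT.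
Qed.

Lemma seq_argmax (T : eqType) (g : T -> int) (l : seq T) : l != [::] ->
  exists2 x, x \in l & forall y, y \in l -> g y <= g x.
Proof.
elim: l => // x [|y l] IH _; first by exists x; rewrite ?mem_head // => z; rewrite inE => /eqP ->.
have [//|z zl hz] := IH; have [le|lt] := leP (g z) (g x).
  exists x; first exact: mem_head.
  by move=> u; rewrite inE => /predU1P[-> //|/hz] /le_trans; apply.
exists z; first by rewrite inE zl orbT.
by move=> u; rewrite inE => /predU1P[->|/hz //]; exact: ltW.
Qed.

Lemma pigeonhole (T : eqType) (l : seq T) (f : nat -> T) :
  (forall n, (n <= size l)%N -> f n \in l) ->
  exists m n, [/\ (m < n)%N, (n <= size l)%N & f m = f n].
Proof.
move=> hf; set s := [seq f n | n <- iota 0 (size l).+1].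
have us : ~~ uniq s.
  apply/negP => us; have : (size s <= size l)%N.
    apply: uniq_leq_size => // x /mapP[n]; rewrite mem_iota ltnS => /andP[_ nl] ->.
    exact: hf.
  by rewrite size_map size_iota ltnn.
have /(uniqPn (f 0%N)) [i [j [ij]]] := us.
rewrite size_map size_iota ltnS => jl.
rewrite !(nth_map 0%N) ?size_iota ?ltnS ?(leq_trans (ltnW ij)) //.
rewrite !nth_iota ?ltnS ?(leq_trans (ltnW ij)) // !add0n => e.
by exists i, j.
Qed.

Lemma norm_le_sqr (a : int) : `|a| <= a * a.
Proof.
have [->|a0] := eqVneq a 0; first by rewrite normr0 mulr0.
have -> : a * a = `|a| * `|a| by rewrite -normrM ger0_norm // -expr2 sqr_ge0.
by rewrite ler_peMr // -gtz0_ge1 normr_gt0.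
Qed.

(* If every [n <= size D] fails, the same [d] fails for two values of [n]; by
   Cramer's rule the two inequalities confine [v] to a bounded box. *)
Lemma separating_iterate (D : seq vec) (c : int) :
  (forall d, d \in D -> d != 0) ->
  (forall d n, d \in D -> (n <= size D)%N ->
    dot (iter n Mv d) (iter n Mv d) <= c) -> 0 <= c ->
  exists b : int, forall v, b < dot v v ->
    exists2 n, (n <= size D)%N & forall d, d \in D -> c < `|dot v (iter n Mv d)|.
Proof.
(* Cramer's rule will bound both coordinates of [v] by 2 c^2, hence [dot v v] by twice the square of
   that bound, namely 8 c^4. *)
move=> D0 hc c0; exists (8 * (c * c) * (c * c)) => v hv.
apply: contrapT => hn.
have /choice[f hf] : forall n, exists d, (n <= size D)%N ->
    d \in D /\ `|dot v (iter n Mv d)| <= c.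
  move=> n; apply: contrapT => hd; apply: hn.
  have nD : (n <= size D)%N.
    by apply: contrapT => nD; apply: hd; exists 0.
  exists n => // d dD; rewrite ltNge; apply/negP => le; apply: hd.
  by exists d.
have [m [n [mn nD fmn]]] := pigeonhole (fun n h => (hf n h).1).
have mD := leq_trans (ltnW mn) nD.
have [dD hm] := hf _ mD; have [_] := hf _ nD; rewrite -fmn => hn'.
have := det2_iter2 (D0 _ dD) mn.
have := hc _ _ dD mD; have := hc _ _ dD nD; move: hm hn' hv.
case: (iter m Mv _) (iter n Mv _) v {hn hf} => [a b] [a' b'] [x y].
rewrite /dot /det2 /= => h1 h2 hv h3 h4 h5.
set p := x * a + y * b in h1; set q := x * a' + y * b' in h2.
have aa : `|a| <= c by move: (norm_le_sqr a) (norm_le_sqr b) (norm_le_sqr a') (norm_le_sqr b') h3 h4; lia.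
have bb : `|b| <= c by move: (norm_le_sqr a) (norm_le_sqr b) (norm_le_sqr a') (norm_le_sqr b') h3 h4; lia.
have aa' : `|a'| <= c by move: (norm_le_sqr a) (norm_le_sqr b) (norm_le_sqr a') (norm_le_sqr b') h3 h4; lia.
have bb' : `|b'| <= c by move: (norm_le_sqr a) (norm_le_sqr b) (norm_le_sqr a') (norm_le_sqr b') h3 h4; lia.
have bd (u : int) (z z' : int) : u * (a * b' - b * a') = z * p + z' * q ->
    `|z| <= c -> `|z'| <= c -> `|u| <= 2 * (c * c).
  move=> e hz hz'.
  (* The determinant is a nonzero integer, so its absolute value is at least 1. *)
  have e1 : `|u| <= `|u * (a * b' - b * a')|.
    by rewrite normrM ler_peMr // -gtz0_ge1 normr_gt0.
  apply: (le_trans e1); rewrite e; apply: (le_trans (ler_normD _ _)).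
  rewrite !normrM mulr_natl mulr2n.
  by apply: lerD; apply: ler_pM.
have hx : `|x| <= 2 * (c * c).
  by apply: (bd x b' (- b)); rewrite ?normrN //; rewrite /p /q; ring.
have hy : `|y| <= 2 * (c * c).
  by apply: (bd y (- a') a); rewrite ?normrN //; rewrite /p /q; ring.
have sq (u : int) : `|u| <= 2 * (c * c) -> u * u <= 4 * (c * c) * (c * c).
  move=> hu; have := ler_pM (normr_ge0 u) (normr_ge0 u) hu hu.
  rewrite -normrM ger0_norm; last by rewrite -expr2 sqr_ge0.
  by move/le_trans; apply; rewrite !mulrA; lia.
move: (sq _ hx) (sq _ hy) hv; lia.
Qed.

Lemma left_kernel_nonzero (F : fieldType) m n (M : 'M[F]_(m, n)) : (n < m)%N ->
  exists2 d : 'rV_m, d != 0 & d *m M = 0.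
Proof.
move=> nm; have : kermx M != 0.
  by rewrite -mxrank_eq0 mxrank_ker -lt0n subn_gt0 (leq_ltn_trans (rank_leq_col M)).
by case/rowV0Pn => d /sub_kermxP dM d0; exists d.
Qed.

Definition stable (I0 : set (torus -> C)) : Prop :=
  [/\ forall f g, I0 f -> I0 g -> I0 (f + g),
      forall c v f, I0 f -> I0 (fun w => c * mono v w * f w) &
      forall f, I0 f -> I0 (f \o tphi)].

(** Equal exponents are collected, so that differences of distinct members of the support are
    nonzero vectors, to which hyperbolicity applies. *)
Lemma laurent_support f : laurent f -> exists s (c : vec -> C),
  [/\ uniq s, forall v, v \in s -> c v != 0 &
      forall w, f w = \sum_(v <- s) c v * mono v w].
Proof.
move=> [l fE]; pose s := undup [seq p.2 | p <- l].
pose c v := \sum_(p <- l | p.2 == v) p.1.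
exists [seq v <- s | c v != 0], c; split=> [|v|w].
- by rewrite filter_uniq // undup_uniq.
- by rewrite mem_filter => /andP[].
rewrite big_filter big_mkcond fE /=.
transitivity (\sum_(v <- s) c v * mono v w); last first.
  by apply: eq_bigr => v _; case: eqP => // ->; rewrite mul0r.
under [RHS]eq_bigr do rewrite /c big_mkcond mulr_suml.
rewrite exchange_big /=; apply: eq_big_seq => p pl.
have ps : p.2 \in s by rewrite mem_undup map_f.
rewrite (bigD1_seq p.2) ?undup_uniq //= eqxx big1 ?addr0 // => v /negPf.
by rewrite eq_sym => ->; rewrite mul0r.
Qed.

Section FiniteCodimension.
Variables (I0 : set (torus -> C)) (hI : stable I0).
Variables (f : torus -> C) (If : I0 f) (lf : laurent f) (f0 : f != 0).

Lemma stableZ c g : I0 g -> I0 (fun w => c * g w).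
Proof.
have [_ IM _] := hI => /(IM c 0); congr I0; apply/funext => w.
by rewrite mono0 mulr1.
Qed.

Lemma stable0 : I0 0.
Proof.
have := stableZ 0 If; congr I0; apply/funext => w; exact: mul0r.
Qed.

Lemma stable_sum (J : eqType) (r : seq J) (F : J -> torus -> C) :
  (forall j, j \in r -> I0 (F j)) -> I0 (fun w => \sum_(j <- r) F j w).
Proof.
elim: r => [|j r IH] h.
  by have := stable0; congr I0; apply/funext => w; rewrite big_nil.
have [ID _ _] := hI.
have : I0 (F j + (fun w => \sum_(j <- r) F j w)).
  by apply: ID; [apply: h; exact: mem_head|apply: IH => i ir; apply: h; rewrite inE ir orbT].
by congr I0; apply/funext => w; rewrite big_cons.
Qed.

Lemma stable_iter n g : I0 g -> I0 (g \o iter n tphi).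
Proof.
have [_ _ IS] := hI; elim: n g => // n IH g Ig.
have := IH _ (IS _ Ig); congr I0.
Qed.

(** Congruence modulo [I0] to a combination of the monomials of the box; finite codimension means
    that one box serves all monomials. *)
Definition reducible (box : seq vec) (g : torus -> C) : Prop :=
  exists e : vec -> C, I0 (fun w => g w - \sum_(u <- box) e u * mono u w).

Lemma reducible_comb box (J : eqType) (r : seq J) (c : J -> C) (F : J -> torus -> C) :
  (forall j, j \in r -> reducible box (F j)) ->
  reducible box (fun w => \sum_(j <- r) c j * F j w).
Proof.
move=> h; have /choice[e he] : forall j, exists e : vec -> C, j \in r ->
    I0 (fun w => F j w - \sum_(u <- box) e u * mono u w).
  move=> j; have [/h[e he]|_] := boolP (j \in r); first by exists e.
  by exists (fun=> 0).
exists (fun u => \sum_(j <- r) c j * e j u).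
have := stable_sum (fun j jr => stableZ (c j) (he j jr)); congr I0.
apply/funext => w; under [X in _ - X]eq_bigr do rewrite mulr_suml.
rewrite [X in _ - X]exchange_big /= -sumrB; apply: eq_bigr => j _.
by rewrite mulrBr mulr_sumr; congr (_ - _); apply: eq_bigr => u _; rewrite mulrA.
Qed.

Lemma reducible_add box g h : I0 g -> reducible box h ->
  reducible box (fun w => g w + h w).
Proof.
move=> Ig [e he]; exists e; have [ID _ _] := hI.
by have := ID _ _ Ig he; congr I0; apply/funext => w; exact: addrA.
Qed.

(* An iterate of [f] has a single monomial that is extremal, with a margin, in
   the direction of [v]; it rewrites the monomial of [v] into monomials of
   smaller exponents. *)
Lemma exists_box : exists2 box : seq vec, uniq box & forall v, reducible box (mono v).
Proof.
have [s [c [us c0 fE]]] := laurent_support lf.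
have s0 : s != [::].
  apply: contraNneq f0 => s0; apply/eqP/funext => w.
  by rewrite fE s0 big_nil.
pose D := [seq u - u' | u <- s, u' <- [seq z <- s | u != z]].
have memD u u' : u \in s -> u' \in s -> u != u' -> u - u' \in D.
  move=> us' u's uu'; apply/allpairsPdep; exists u, u'; split=> //.
  by rewrite mem_filter uu'.
have D0 d : d \in D -> d != 0.
  case/allpairsPdep => u [u' [_]]; rewrite mem_filter => /andP[uu' _] ->.
  by rewrite subr_eq0.
(* [C0] bounds the squared lengths of the finitely many iterates that [separating_iterate] may
   select. *)
have [C0 C00 hC0] := seq_bound (fun p : vec * nat => dot (iter p.2 Mv p.1) (iter p.2 Mv p.1))
  [seq (d, n) | d <- D, n <- iota 0 (size D).+1].
have {}hC0 d n : d \in D -> (n <= size D)%N ->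
    dot (iter n Mv d) (iter n Mv d) <= C0.
  move=> dD nD; apply: (hC0 (d, n)).
  by apply/allpairsP; exists (d, n); split=> //; rewrite mem_iota add0n ltnS.
have [b hb] := separating_iterate D0 hC0 C00.
(* The box is a square that contains every integer vector of squared length at most [b], because an
   integer is at most its square in absolute value. *)
pose rng := [seq (i%:Z - `|b|%:Z : int) | i <- iota 0 (2 * `|b|).+1].
pose box := undup [seq (x, y) | x <- rng, y <- rng].
have mem_rng (x : int) : `|x| <= `|b| -> x \in rng.
  move=> xb; apply/mapP; exists (absz (x + `|b|)); last by lia.
  by rewrite mem_iota; lia.
have mem_box v : dot v v <= b -> v \in box.
  case: v => x y; rewrite /dot /= => h; rewrite mem_undup.
  apply/allpairsP; exists (x, y); split=> //; apply: mem_rng;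
  by move: (norm_le_sqr x) (norm_le_sqr y) h => /=; lia.
exists box; first exact: undup_uniq.
move=> v; have dv0 u : 0 <= dot u u by rewrite /dot addr_ge0 // -expr2 sqr_ge0.
have [n] := ubnP `|dot v v|%N; elim: n v => // n IH v ltv.
have [vb|vb] := leP (dot v v) b.
  exists (fun u => (u == v)%:R).
  have := stable0; congr I0; apply/funext => w.
  rewrite (bigD1_seq v) ?undup_uniq ?mem_box //= eqxx mul1r big1 ?addr0 ?subrr //.
  by move=> u /negPf ->; rewrite mul0r.
have [m mD hm] := hb v vb.
have [x xs hx] := seq_argmax (fun u => dot v (iter m Mv u)) s0.
pose t u := v - iter m Mv (x - u).
have red u : u \in s -> u != x -> reducible box (mono (t u)).
  move=> us' ux; apply: IH.
  have dD : x - u \in D by apply: memD => //; rewrite eq_sym.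
  (* With e the iterate of x - u, the squared length of v - e is that of v minus 2 (v.e) plus e.e.
     Maximality of x makes v.e nonnegative, and separation then makes it exceed [C0], hence e.e: the
     length drops. *)
  move: (hm _ dD) (hx _ us') (hC0 _ _ dD mD) ltv (dv0 v) (dv0 (t u)).
  rewrite /t iter_MvB; case: (iter m Mv x) (iter m Mv u) v {vb hm hx t} => [a a'] [e e'] [p q].
  by rewrite /dot /=; nia.
(* The iterate of [f] is scaled and shifted so that its dominant monomial becomes exactly that of
   [v]; its other monomials have exponents [t u]. *)
pose g w := (c x)^-1 * mono (v - iter m Mv x) w * f (iter m tphi w).
have Ig : I0 g by have [_ IM _] := hI; apply: IM; exact: stable_iter.
have gE w : mono v w = g w + \sum_(u <- [seq u <- s | u != x]) (- (c u / c x)) * mono (t u) w.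
  rewrite /g fE mulr_sumr (bigD1_seq x) //= big_filter.
  rewrite mono_iter mulrACA mulVf ?c0 // mul1r -monoD subrK -addrA.
  rewrite -big_split /= big1 ?addr0 // => u ux.
  rewrite mono_iter mulrACA -monoD /t iter_MvB opprB addrA addrAC.
  by rewrite mulNr [c u / c x]mulrC subrr.
rewrite (_ : mono v = fun w => g w +
   \sum_(u <- [seq u <- s | u != x]) (- (c u / c x)) * mono (t u) w); last exact/funext.
apply: reducible_add => //; apply: reducible_comb => u.
by rewrite mem_filter => /andP[ux us']; exact: red.
Qed.

Lemma mono_mulrn u i w : mono (u *+ i) w = mono u w ^+ i.
Proof. by elim: i => [|i IH]; rewrite ?mono0 // mulrS monoD IH exprS. Qed.

(** With n monomials in the box, the first n + 1 powers of one monomial are linearly dependent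
    modulo [I0]. *)
Lemma stable_poly u : exists2 p : {poly C}, p != 0 & I0 (fun w => p.[mono u w]).
Proof.
have [box ubox red] := exists_box.
have /choice[e he] : forall i : nat, exists e : vec -> C,
    I0 (fun w => mono (u *+ i) w - \sum_(j <- box) e j * mono j w).
  by move=> i; exact: red.
set n := size box.
pose M : 'M[C]_(n.+1, n) := \matrix_(i, j) e i (nth 0 box j).
have [d d0 dM] := left_kernel_nonzero M (ltnSn n).
exists (\poly_(i < n.+1) d 0 (inord i)).
  apply: contraNneq d0 => p0; apply/eqP/rowP => i; rewrite mxE.
  by have := congr1 (fun p : {poly C} => p`_i) p0; rewrite coef_poly ltn_ord coef0 inord_val.
have := stable_sum (fun (i : 'I_n.+1) (_ : i \in index_enum _) =>
  stableZ (d 0 i) (he i)); congr I0; apply/funext => w.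
rewrite horner_poly; under eq_bigr do rewrite mulrBr.
rewrite sumrB; under eq_bigr do rewrite mono_mulrn.
under [RHS]eq_bigr do rewrite inord_val.
rewrite [X in _ - X](_ : _ = 0) ?subr0 //.
under eq_bigr do rewrite mulr_sumr.
rewrite exchange_big /= (big_nth 0) big_mkord big1 // => j _.
have := congr1 (fun A : 'rV_n => A 0 j) dM; rewrite !mxE => h.
transitivity ((\sum_i d 0 i * M i j) * mono (nth 0 box j) w); last by rewrite h mul0r.
by rewrite mulr_suml; apply: eq_bigr => i _; rewrite mxE mulrA.
Qed.

End FiniteCodimension.

(** * Ideals of the skew Laurent ring *)

Lemma iter_periodic (T : eqType) (f : T -> T) (l : seq T) x : injective f ->
  (forall n, iter n f x \in l) -> exists2 n, (0 < n)%N & iter n f x = x.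
Proof.
move=> injf hl; have [m [n [mn _ e]]] := pigeonhole (fun n _ => hl n).
exists (n - m)%N; first by rewrite subn_gt0.
move: e; rewrite -{1}(subnK (ltnW mn)) addnC iterD.
move: (n - m)%N => d /esym; elim: m {mn} => [//|m IH].
by rewrite !iterS => /injf.
Qed.

(** * Torsion points: periodicity and density *)

Definition torsion (w : torus) : Prop :=
  exists2 n, (0 < n)%N & val w.1 ^+ n = 1 /\ val w.2 ^+ n = 1.

(** The points killed by n form a finite set preserved by [tphi]. *)
Lemma torsion_periodic w : torsion w -> exists2 n, (0 < n)%N & iter n tphi w = w.
Proof.
move=> [n n0 wn]; have [z hz] := C_prim_root_exists n0.
pose l : seq Cx := pmap insub [seq z ^+ i | i <- iota 0 n].
have lP (x : Cx) : val x ^+ n = 1 -> x \in l.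
  move=> xn; rewrite mem_pmap_sub; have [i xi] := prim_rootP hz xn.
  by apply/mapP; exists (val i) => //; rewrite mem_iota /=.
apply: (@iter_periodic _ _ [seq (x, y) | x <- l, y <- l]); first exact: can_inj tphiK.
move=> m; have [h1 h2] : val (iter m tphi w).1 ^+ n = 1 /\ val (iter m tphi w).2 ^+ n = 1.
  by elim: m => [//|m [h1 h2]]; rewrite iterS /=; split=> //; rewrite exprMn h1 h2 mulr1.
by apply/allpairsP; exists (iter m tphi w); split; [exact: lP|exact: lP|case: (iter m tphi w)].
Qed.

(** After clearing negative exponents this is a nonzero polynomial [P]; it has fewer than [size P]
    roots, so it cannot vanish at all the roots of unity of order dividing [size P]. *)
Lemma laurent1_root_unity (l : seq (C * int)) (x0 : Cx) :
  \sum_(p <- l) p.1 * val x0 ^ p.2 != 0 ->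
  exists x : Cx, (exists2 n, (0 < n)%N & val x ^+ n = 1) /\
    \sum_(p <- l) p.1 * val x ^ p.2 != 0.
Proof.
move=> gx0; have [m m0 hm] := seq_bound (fun p : C * int => - p.2) l.
pose P : {poly C} := \sum_(p <- l) p.1 *: 'X^(absz (p.2 + m)).
have PE (x : Cx) : P.[val x] = val x ^ m * \sum_(p <- l) p.1 * val x ^ p.2.
  rewrite horner_sum mulr_sumr; apply: eq_big_seq => p pl.
  rewrite hornerZ hornerXn mulrCA -expfzDr ?(valP x) // [m + _]addrC.
  congr (_ * _); rewrite exprnP; congr (_ ^ _).
  by have := hm p pl; lia.
have P0 : P != 0.
  apply: contraNneq gx0 => P0; have := PE x0; rewrite P0 horner0 => /esym/eqP.
  by rewrite mulf_eq0 expfz_eq0 (negPf (valP x0)) andbF.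
have N0 : (0 < size P)%N by rewrite size_poly_gt0.
have [z hz] := C_prim_root_exists N0.
have z0 i : z ^+ i != 0.
  rewrite expf_neq0 //; apply/eqP => z0; have /eqP := prim_expr_order hz.
  by rewrite z0 expr0n gtn_eqF // eq_sym oner_eq0.
have [i hi] : exists i : 'I_(size P), P.[z ^+ i] != 0.
  apply: contrapT => h; have := max_poly_roots (rs := [seq z ^+ i | i <- iota 0 (size P)]) P0.
  rewrite size_map size_iota ltnn => H; suff : false by [].
  apply: H.
    apply/allP => y /mapP[i]; rewrite mem_iota => /andP[_ iP] ->.
    by apply: contrapT => /negP Pi; apply: h; exists (Ordinal iP).
  rewrite map_inj_in_uniq ?iota_uniq // => i j; rewrite !mem_iota => /andP[_ iP] /andP[_ jP].
  by move/eqP; rewrite (eq_prim_root_expr hz) !modn_small // => /eqP.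
exists (exist (fun c : C => c != 0) _ (z0 i)); split.
  exists (size P) => //=; rewrite exprAC (prim_expr_order hz) ?expr1n //.
by apply: contraNneq hi => h; rewrite (PE (exist (fun c : C => c != 0) _ (z0 i))) h mulr0.
Qed.

(** One coordinate is moved at a time: first the abscissa with the ordinate frozen at [y0], then the
    ordinate with the new abscissa frozen. *)
Lemma torsion_dense f : laurent f -> f != 0 -> exists2 w, torsion w & f w != 0.
Proof.
move=> [l fE] f0; have [[x0 y0] fw0] : exists w, f w != 0.
  apply: contrapT => h; move/eqP: f0; apply; apply/funext => w.
  by apply: contrapT => /eqP fw; apply: h; exists w.
pose l1 := [seq (p.1 * val y0 ^ p.2.2, p.2.1) | p <- l].
have [|x [[n n0 xn] hx]] := @laurent1_root_unity l1 x0.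
  apply: contraNneq fw0; rewrite big_map /= => h; apply/eqP; rewrite -[RHS]h fE.
  by apply: eq_bigr => p _; rewrite /mono /= mulrAC mulrA.
pose l2 := [seq (p.1 * val x ^ p.2.1, p.2.2) | p <- l].
have [|y [[m m0 ym] hy]] := @laurent1_root_unity l2 y0.
  apply: contraNneq hx; rewrite !big_map /= => h; apply/eqP; rewrite -[RHS]h.
  by apply: eq_bigr => p _; rewrite mulrAC.
exists (x, y).
  exists (n * m)%N; first by rewrite muln_gt0 n0.
  by rewrite /= exprM xn expr1n mulnC exprM ym expr1n.
apply: contraNneq hy => h; rewrite big_map /=; apply/eqP; rewrite -[RHS]h fE.
by apply: eq_bigr => p _; rewrite /mono /= mulrA.
Qed.

Lemma poly_eq0_nat (p : {poly C}) m : (0 < m)%N ->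
  (forall i, p.[(i * m)%:R] = 0) -> p = 0.
Proof.
move=> m0 hp; apply/eqP; apply: contrapT => /negP p0.
have := max_poly_roots (rs := [seq (i * m)%:R | i <- iota 0 (size p)]) p0.
rewrite size_map size_iota ltnn => H; suff : false by [].
apply: H; first by apply/allP => y /mapP[i _ ->]; rewrite rootE hp.
rewrite map_inj_uniq ?iota_uniq // => i j /eqP.
by rewrite eqr_nat eqn_mul2r (gtn_eqF m0) => /eqP.
Qed.

Lemma poly_eq0_horner (p : {poly C}) : (forall c, p.[c] = 0) -> p = 0.
Proof. by move=> hp; apply: (@poly_eq0_nat p 1) => // i; exact: hp. Qed.

Lemma nonzero_horner (p : {poly C}) : p != 0 -> exists c, p.[c] != 0.
Proof.
move/eqP => p0; apply: contrapT => h; apply: p0; apply: poly_eq0_horner => c.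
by apply: contrapT => /eqP pc; apply: h; exists c.
Qed.

Lemma periodic_poly_const (q : {poly C}) (m : nat) : (0 < m)%N ->
  (forall s, q.[s] = q.[s + m%:R]) -> (size q <= 1)%N.
Proof.
move=> m0 hq; pose p := q - q.[0]%:P.
suff p0 : p = 0 by move/eqP: p0; rewrite subr_eq0 => /eqP ->; exact: size_polyC_leq1.
apply: (poly_eq0_nat m0) => i; rewrite hornerD hornerN hornerC; apply/eqP.
rewrite subr_eq0; apply/eqP.
by elim: i => // i <-; rewrite mulSn addnC natrD -hq.
Qed.

(** * Degree in the variable u *)

Section Degree.
Implicit Types (f g : Fn) (a : torus -> C).

Lemma laurent_add a b : laurent a -> laurent b -> laurent (a + b).
Proof.
move=> /setA_laurent Aa /setA_laurent Ab; apply/setA_laurent.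
rewrite (_ : muT _ = muT a + muT b); first exact: subring_setD subring_setA Aa Ab.
by rewrite -muD.
Qed.

Lemma laurent_mul a b : laurent a -> laurent b -> laurent (a * b).
Proof.
move=> /setA_laurent Aa /setA_laurent Ab; apply/setA_laurent.
rewrite (_ : muT _ = muT a * muT b); first by have [_ _ h] := subring_setA; apply: h.
by rewrite -muM.
Qed.

Lemma laurent_cst c : laurent (fun=> c).
Proof. by exists [:: (c, 0)] => w; rewrite big_seq1 mono0 mulr1. Qed.

Lemma laurent_mono v : laurent (mono v).
Proof. by exists [:: (1, v)] => w; rewrite big_seq1 mul1r. Qed.

Lemma laurent_opp a : laurent a -> laurent (- a).
Proof.
move=> la; rewrite (_ : - a = (fun=> -1) * a); first exact: laurent_mul (laurent_cst _) la.
by apply/funext => w; rewrite -[RHS]/(-1 * a w) mulN1r.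
Qed.

Lemma laurent_tphi a n : laurent a -> laurent (a \o iter n tphi).
Proof.
elim: n a => // n IH a la.
have := IH (a \o tphi); apply.
apply/setA_laurent; rewrite /muT -lift_phi -opZ_muK; apply: setA_conjZ.
exact/setA_laurent.
Qed.

Definition poly_fun n (a : nat -> torus -> C) : Fn :=
  fun t => \sum_(i < n) a i t.1 * t.2 ^+ i.

Definition deg_lt n f : Prop := exists2 a, forall i, laurent (a i) & f = poly_fun n a.

Lemma deg_ltW n m f : (n <= m)%N -> deg_lt n f -> deg_lt m f.
Proof.
move=> nm [a la ->]; exists (fun i => if (i < n)%N then a i else 0).
  by move=> i; case: ifP => // _; exact: (laurent_cst 0).
apply/funext => t; rewrite /poly_fun.
rewrite (big_ord_widen m (fun i => a i t.1 * t.2 ^+ i) nm) big_mkcond /=.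
by apply: eq_bigr => i _; case: ifP => // _; rewrite mul0r.
Qed.

Lemma deg_ltD n f g : deg_lt n f -> deg_lt n g -> deg_lt n (f + g).
Proof.
move=> [a la ->] [b lb ->]; exists (fun i => a i + b i).
  by move=> i; exact: laurent_add.
apply/funext => t; rewrite -[LHS]/(poly_fun n a t + poly_fun n b t) /poly_fun.
rewrite -big_split; apply: eq_bigr => i _.
by rewrite -[RHS]/((a i t.1 + b i t.1) * t.2 ^+ i) mulrDl.
Qed.

Lemma deg_ltM n a f : laurent a -> deg_lt n f -> deg_lt n (lift a * f).
Proof.
move=> la [b lb ->]; exists (fun i => a * b i).
  by move=> i; exact: laurent_mul.
apply/funext => t; rewrite -[LHS]/(a t.1 * poly_fun n b t) /poly_fun mulr_sumr.
by apply: eq_bigr => i _; rewrite mulrA -[RHS]/(a t.1 * b i t.1 * t.2 ^+ i).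
Qed.

Lemma deg_ltN n f : deg_lt n f -> deg_lt n (- f).
Proof.
move=> df; rewrite (_ : - f = lift (fun=> -1) * f); first exact: deg_ltM (laurent_cst _) df.
by apply/funext => w; rewrite -[RHS]/(-1 * f w) mulN1r.
Qed.

Lemma deg_ltU n f : deg_lt n f -> deg_lt n.+1 (height * f).
Proof.
move=> [b lb ->]; exists (fun i => if i is i'.+1 then b i' else 0).
  by case=> // ; exact: (laurent_cst 0).
apply/funext => t; rewrite -[LHS]/(t.2 * poly_fun n b t) /poly_fun mulr_sumr.
rewrite big_ord_recl mul0r add0r; apply: eq_bigr => i _.
by rewrite /= exprS mulrCA.
Qed.

Lemma deg_lt0 n : deg_lt n 0.
Proof.
exists (fun=> 0) => [i|]; first exact: (laurent_cst 0).
by apply/funext => t; rewrite /poly_fun big1 // => i _; rewrite mul0r.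
Qed.

Lemma deg_lt_monomial n a : laurent a -> deg_lt n.+1 (fun t => a t.1 * t.2 ^+ n).
Proof.
move=> la; exists (fun i => if i == n then a else 0).
  by move=> i; case: ifP => // _; exact: (laurent_cst 0).
apply/funext => t; rewrite /poly_fun big_ord_recr /= eqxx big1 ?add0r // => i _.
by rewrite ltn_eqF // mul0r.
Qed.

Lemma deg_lt_shift_pow n (c : C) : deg_lt n (fun t => (t.2 + c) ^+ n - t.2 ^+ n).
Proof.
elim: n => [|n IH].
  by rewrite (_ : (fun=> _) = 0); [exact: deg_lt0|apply/funext => t; rewrite !expr0 subrr].
pose d : Fn := fun t => (t.2 + c) ^+ n - t.2 ^+ n.
rewrite (_ : (fun=> _) = height * d + lift (fun=> c) * d +
  (fun t => (fun=> c) t.1 * t.2 ^+ n)).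
  apply: deg_ltD; last by apply: deg_lt_monomial; exact: laurent_cst.
  apply: deg_ltD; first exact: deg_ltU.
  by apply: deg_ltW (leqnSn n) _; apply: deg_ltM => //; exact: laurent_cst.
apply/funext => t.
rewrite -[RHS]/(t.2 * ((t.2 + c) ^+ n - t.2 ^+ n) + c * ((t.2 + c) ^+ n - t.2 ^+ n) + c * t.2 ^+ n).
by rewrite !exprS; ring.
Qed.

Lemma deg_lt_sum k n (F : nat -> Fn) :
  (forall i, (i < k)%N -> deg_lt n (F i)) -> deg_lt n (fun t => \sum_(i < k) F i t).
Proof.
elim: k => [|m IH] hF.
  by rewrite (_ : (fun=> _) = 0); [exact: deg_lt0|apply/funext => t; rewrite big_ord0].
rewrite (_ : (fun=> _) = (fun t => \sum_(i < m) F i t) + F m).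
  by apply: deg_ltD; [apply: IH => i im; apply: hF; exact: ltnW|exact: hF].
by apply/funext => t; rewrite big_ord_recr.
Qed.

(** Translating u affects only lower terms, so that the leading coefficient is merely composed with
    the iterate of [tphi]. This lets leading terms cancel in [ideal_setA]. *)
Lemma deg_lt_shift n (a : nat -> torus -> C) m : (forall i, laurent (a i)) ->
  deg_lt n (poly_fun n.+1 a \o iter m phi -
            (fun t => a n (iter m tphi t.1) * t.2 ^+ n)).
Proof.
move=> la.
have la' i : laurent (a i \o iter m tphi) by exact: laurent_tphi.
pose F i : Fn := lift (a i \o iter m tphi) * (fun t => (t.2 + m%:R) ^+ i).
rewrite (_ : _ - _ = (fun t => \sum_(i < n) F i t) +
   lift (a n \o iter m tphi) * (fun t => (t.2 + m%:R) ^+ n - t.2 ^+ n)).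
  apply: deg_ltD; last by apply: deg_ltM => //; exact: deg_lt_shift_pow.
  apply: deg_lt_sum => i lin.
  rewrite (_ : F i = lift (a i \o iter m tphi) * (fun t => (t.2 + m%:R) ^+ i - t.2 ^+ i)
     + (fun t => (a i \o iter m tphi) t.1 * t.2 ^+ i)).
    apply: deg_ltD; last by apply: deg_ltW lin _; exact: deg_lt_monomial.
    by apply: deg_ltM => //; apply: deg_ltW (ltnW lin) _; exact: deg_lt_shift_pow.
  apply/funext => t; rewrite -[RHS]/(a i (iter m tphi t.1) * ((t.2 + m%:R) ^+ i - t.2 ^+ i) +
      a i (iter m tphi t.1) * t.2 ^+ i).
  by rewrite -mulrDr subrK.
apply/funext => t.
rewrite -[LHS]/(poly_fun n.+1 a (iter m phi t) - a n (iter m tphi t.1) * t.2 ^+ n).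
rewrite iter_phi /poly_fun /= big_ord_recr /= -addrA; congr (_ + _).
by rewrite -[RHS]/(a n (iter m tphi t.1) * ((t.2 + m%:R) ^+ n - t.2 ^+ n)) mulrBr.
Qed.

Lemma setB_deg r : setB r -> exists n f, deg_lt n f /\ r = mu f.
Proof. by move=> /setB_mu_sum[n [a [la ->]]]; exists n, (poly_fun n a); split=> //; exists a. Qed.

Lemma deg_setB n f : deg_lt n f -> setB (mu f).
Proof. by move=> [a la ->]; exact: setB_sum. Qed.

End Degree.

Definition ideal_in (E : nzRingType) (S I : set E) : Prop :=
  lideal_in S I /\ forall a x, S a -> I x -> I (x * a).

(** * Homogeneity of ideals and contraction to the torus *)

Section IdealsOfR.
Variables (I : set lop) (hI : ideal_in setR I).

Lemma idealB x y : I x -> I y -> I (x - y). Proof. by have [[_ _ h _] _] := hI; exact: h. Qed.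
Lemma ideal0 : I 0. Proof. by have [[]] := hI. Qed.
Lemma idealN x : I x -> I (- x). Proof. by rewrite -sub0r; exact/idealB/ideal0. Qed.
Lemma idealD x y : I x -> I y -> I (x + y).
Proof. by move=> Ix Iy; rewrite -[y]opprK; apply: idealB => //; exact: idealN. Qed.
Lemma idealMl a x : setR a -> I x -> I (a * x).
Proof. by have [[_ _ _ h] _] := hI; exact: h. Qed.
Lemma idealMr a x : setR a -> I x -> I (x * a).
Proof. by have [_ h] := hI; exact: h. Qed.
Lemma ideal_sum (J : Type) (r : seq J) (P : pred J) (F : J -> lop) :
  (forall i, P i -> I (F i)) -> I (\sum_(i <- r | P i) F i).
Proof. by move=> h; apply: (big_ind I) => //; [exact: ideal0|exact: idealD]. Qed.

Lemma scalars_setR : scalars lop `<=` setR.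
Proof. by have [h _ _ _ _] := setA_gens; move=> x /h; exact: setA_sub_setR. Qed.

Lemma idealZ c x : I x -> I (c *: x).
Proof. by move=> Ix; rewrite -mulr_algl; apply: idealMl => //; apply: scalars_setR; exists c. Qed.

Lemma setR_opU : setR opU. Proof. exact/setB_sub_setR/setB_opU. Qed.

Lemma opZX_opU i : opZ ^+ i * opU = opU * opZ ^+ i + i%:R *: opZ ^+ i.
Proof.
rewrite /opU opZX_mu; have -> : height \o iter i phi = height + fscale i%:R 1.
  by apply/funext => t; rewrite /= iter_phi -[RHS]/(t.2 + i%:R * 1) mulr1.
by rewrite muD mulrDl muZ mu1 -scalerAl mul1r.
Qed.

Lemma setRX_opZ n : setR (opZ ^+ n).
Proof. by apply: subring_setX; [exact: subring_setR|exact: setR_opZ]. Qed.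
Lemma setRX_opZi n : setR (opZi ^+ n).
Proof. by apply: subring_setX; [exact: subring_setR|exact: setR_opZi]. Qed.

Lemma opZXK n : opZi ^+ n * opZ ^+ n = 1. Proof. exact: exprMV opZK. Qed.

Lemma opZiXK n : opZ ^+ n * opZi ^+ n = 1. Proof. exact: exprMV opZiK. Qed.

(* Bracketing with [u] multiplies the coefficient of [z ^ i] by [i]. *)
Lemma ideal_homogeneous n (b : nat -> lop) : (forall i, setB (b i)) ->
  I (\sum_(i < n) b i * opZ ^+ i) -> forall i, (i < n)%N -> I (b i).
Proof.
elim: n b => // n IH b Bb; set r := \sum_(i < _) _ => Ir.
have bU i : b i * opU = opU * b i.
  by have [f _ <-] := setB_mu (Bb i); rewrite muC.
(* The correction by [n%:R *: r] kills the top term and multiplies the others by i - n, nonzero in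
   characteristic zero; the induction then applies with one term fewer. *)
have e : r * opU - opU * r - n%:R *: r =
    \sum_(i < n) ((i%:R - n%:R) *: b i) * opZ ^+ i.
  have -> : r * opU - opU * r - n%:R *: r =
      \sum_(i < n.+1) ((i%:R - n%:R) *: b i) * opZ ^+ i.
    rewrite /r mulr_suml mulr_sumr scaler_sumr -!sumrB; apply: eq_bigr => i _.
    rewrite -mulrA opZX_opU mulrDr !mulrA bU -scalerAr -scalerAl scalerBl.
    by rewrite [_ + i%:R *: _]addrC addrK.
  by rewrite big_ord_recr /= subrr scale0r mul0r addr0.
have Ilow i : (i < n)%N -> I (b i).
  move=> lin; have c0 : i%:R - n%:R != 0 :> C by rewrite subr_eq0 eqr_nat ltn_eqF.
  rewrite -[b i]scale1r -(mulVf c0) -scalerA; apply: idealZ.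
  apply: (IH (fun i => (i%:R - n%:R) *: b i)) lin => [j|].
    rewrite -mulr_algl; have [_ _ BM] := subring_setB; apply: BM => //.
    by apply: setA_sub_setB; have [h _ _ _ _] := setA_gens; apply: h; exists (j%:R - n%:R).
  rewrite -e; apply: idealB; last exact: idealZ.
  by apply: idealB; [apply: idealMr|apply: idealMl] => //; exact: setR_opU.
move=> i; rewrite ltnS leq_eqVlt => /predU1P[->|]; last exact: Ilow.
rewrite -[b n]mulr1 -(opZiXK n) mulrA; apply: idealMr; first exact: setRX_opZi.
have -> : b n * opZ ^+ n = r - \sum_(i < n) b i * opZ ^+ i.
  by rewrite /r big_ord_recr /= addrAC subrr add0r.
apply: idealB => //; apply: ideal_sum => j _.
by apply: idealMr; [exact: setRX_opZ|exact: Ilow].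
Qed.

Lemma ideal_coefs x : I x -> exists n m (b : nat -> lop),
  [/\ forall i, setB (b i), forall i, (i < m)%N -> I (b i) &
      x = opZi ^+ n * \sum_(i < m) b i * opZ ^+ i].
Proof.
move=> Ix; have [[sub _ _ _] _] := hI; have [n [s [Ss xE]]] := sub _ Ix.
move: Ss; rewrite -(pol_left_right setB_normalizesZ) => -[m [b [Bb sE]]].
exists n, m, b; split=> //; last by rewrite -sE.
apply: ideal_homogeneous => //; rewrite -sE.
rewrite -[s]mul1r -(opZiXK n) -mulrA -xE; apply: idealMl => //; exact: setRX_opZ.
Qed.

Lemma ideal_setB x : I x -> x != 0 -> exists f, [/\ setB (mu f), I (mu f) & f != 0].
Proof.
move=> Ix x0; have [n [m [b [Bb Ib xE]]]] := ideal_coefs Ix.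
have [[i bi]|h] := pselect (exists i : 'I_m, b i != 0).
  have [f _ fE] := setB_mu (Bb i); exists f; rewrite fE; split=> //; first exact: Ib.
  by apply: contraNneq bi => f0; rewrite -fE f0 mu0.
case/eqP: x0; rewrite xE big1 ?mulr0 // => i _.
suff -> : b i = 0 by rewrite mul0r.
by apply: contrapT => /eqP bi; apply: h; exists i.
Qed.

(* For [f] of minimal degree in [u] with leading coefficient [a], minimality
   forces [a(phi^m w) f = a f(phi^m)]; at a point of the torus of period [m]
   where [a] does not vanish, [f] is then periodic in [u], hence constant. *)
Lemma ideal_setA x : I x -> x != 0 ->
  exists f, [/\ laurent f, I (muT f) & f != 0].
Proof.
move=> Ix x0; have [f [Bf If f0]] := ideal_setB Ix x0.
pose P n := `[< exists f, [/\ deg_lt n f, I (mu f) & f != 0] >].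
have exP : exists n, P n.
  have [n [g [dg /mu_inj fg]]] := setB_deg Bf; exists n; apply/asboolP.
  by exists f; split=> //; rewrite fg.
case: (ex_minnP exP) => n /asboolP[{Bf If f0}f [[a la fE] If f0]] minP.
case: n => [|n] in fE minP.
  by case/eqP: f0; rewrite fE; apply/funext => t; rewrite /poly_fun big_ord0.
have small g : deg_lt n g -> I (mu g) -> g = 0.
  move=> dg Ig; apply: contrapT => /eqP g0.
  by have := minP n; rewrite ltnn => H; suff : false by []; apply: H; apply/asboolP; exists g.
have an0 : a n != 0.
  apply: contraNneq f0 => an0; apply/eqP; apply: small => //; exists a => //.
  by rewrite fE; apply/funext => t; rewrite /poly_fun big_ord_recr /= an0 mul0r addr0.
have [w tw aw] := torsion_dense (la n) an0.
have [m m0 mw] := torsion_periodic tw.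
pose a' := a n \o iter m tphi.
have la' : laurent a' by exact: laurent_tphi.
pose g : Fn := lift a' * f - lift (a n) * (f \o iter m phi).
have g0 : g = 0.
  apply: small.
    (* Both products have leading term a' (a n) u^n; what remains of [g] has degree below [n], and
       minimality forces it to vanish. *)
    pose f1 : Fn := poly_fun n a.
    have -> : g = lift a' * f1 - lift (a n) * (f \o iter m phi - (fun t => a' t.1 * t.2 ^+ n)).
      apply/funext => t; rewrite -[LHS]/(a' t.1 * f t - a n t.1 * f (iter m phi t)).
      rewrite -[RHS]/(a' t.1 * f1 t - a n t.1 * (f (iter m phi t) - a' t.1 * t.2 ^+ n)).
      rewrite {1}fE /poly_fun big_ord_recr /= -/(poly_fun n a t) -/(f1 t).
      by ring.
    apply: deg_ltD; first by apply: deg_ltM => //; exists a.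
    by apply: deg_ltN; apply: deg_ltM => //; rewrite fE; exact: deg_lt_shift.
  rewrite muB !muM; apply: idealB; apply: idealMl => //.
  - by apply: setA_sub_setR; apply/setA_laurent.
  - by apply: setA_sub_setR; apply/setA_laurent.
  have -> : mu (f \o iter m phi) = opZ ^+ m * mu f * opZi ^+ m.
    by rewrite opZX_mu -mulrA opZiXK mulr1.
  by apply: idealMr; [exact: setRX_opZi|apply: idealMl => //; exact: setRX_opZ].
(* The restriction of [f] to the line above [w]; its degree is exactly [n] because [a n] does not
   vanish there. *)
pose q : {poly C} := \poly_(i < n.+1) a i w.
have qE s : q.[s] = f (w, s) by rewrite horner_poly fE.
have sq : size q = n.+1 by rewrite size_poly_eq.
have : (size q <= 1)%N.
  apply: (periodic_poly_const m0) => s; rewrite !qE.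
  have := congr1 (fun F : Fn => F (w, s)) g0.
  rewrite -[LHS]/(a n (iter m tphi w) * f (w, s) - a n w * f (iter m phi (w, s))).
  rewrite iter_phi /= mw -mulrBr => /eqP; rewrite mulf_eq0 (negPf aw) /=.
  by rewrite subr_eq0 => /eqP.
rewrite sq; case: n {small minP g g0 q qE sq la' a'} fE an0 aw => // fE an0 _ _.
exists (a 0%N); split=> //; rewrite (_ : muT _ = mu f) // fE; congr mu.
by apply/funext => t; rewrite /poly_fun big_ord1 expr0 mulr1.
Qed.

(** Conjugation by [opZ] composes with [tphi], so that the finite codimension results apply to the
    contraction of an ideal. *)
Lemma ideal_stable : stable [set f | I (muT f)].
Proof.
split=> /=.
- move=> f g If Ig; rewrite (_ : muT _ = muT f + muT g); first exact: idealD.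
  by rewrite -muD.
- move=> c v f If; rewrite (_ : muT _ = c *: (muT (mono v) * muT f)).
    apply: idealZ; apply: idealMl => //; apply/setA_sub_setR; exact: setA_mono.
  rewrite -muM -muZ; congr mu; apply/funext => t.
  by rewrite -[RHS]/(c * (mono v t.1 * f t.1)) mulrA.
- move=> f If; rewrite /muT -lift_phi -opZ_muK; apply: idealMr; first exact: setR_opZi.
  by apply: idealMl => //; exact: setR_opZ.
Qed.

(** Used for the two coordinate monomials: together they confine the zeros of a nonzero ideal to a
    finite set. *)
Lemma ideal_polys x u : I x -> x != 0 ->
  exists2 p : {poly C}, p != 0 & I (muT (fun w => p.[mono u w])).
Proof.
move=> Ix x0; have [f [lf If f0]] := ideal_setA Ix x0.
exact: (stable_poly ideal_stable If lf f0).
Qed.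

End IdealsOfR.

(** * Prime ideals and finite orbits *)

Lemma laurent_sep v v' : v != v' -> exists e, [/\ laurent e, e v = 1 & e v' = 0].
Proof.
have sep u : mono u v != mono u v' -> exists e, [/\ laurent e, e v = 1 & e v' = 0].
  move=> h; pose d := mono u v - mono u v'.
  have d0 : d != 0 by rewrite subr_eq0.
  exists ((fun=> d^-1) * (mono u + (fun=> - mono u v'))); split.
  - apply: laurent_mul; first exact: laurent_cst.
    by apply: laurent_add; [exact: laurent_mono|exact: laurent_cst].
  - by rewrite -[LHS]/(d^-1 * d) mulVf.
  - by rewrite -[LHS]/(d^-1 * (mono u v' - mono u v')) subrr mulr0.
move=> vv'; have [h|] := eqVneq (val v.1) (val v'.1); last first.
  by move=> h; apply: (sep (1, 0)); rewrite /mono /= !expr1z !expr0z !mulr1.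
apply: (sep (0, 1)); rewrite /mono /= !expr1z !expr0z !mul1r.
apply: contraNneq vv' => h'; case: v v' h h' {sep} => [a b] [c d] /= h h'.
by apply/eqP; congr (_, _); exact: val_inj.
Qed.

Lemma laurent_sep_list v (l : seq torus) : v \notin l ->
  exists e, [/\ laurent e, e v = 1 & forall v', v' \in l -> e v' = 0].
Proof.
elim: l => [|z l IH]; first by exists (fun=> 1); split=> //; exact: laurent_cst.
rewrite inE negb_or => /andP[/laurent_sep[e [le ev ez]] /IH[e' [le' ev' el]]].
exists (e * e'); split=> [||v']; first exact: laurent_mul.
  by rewrite -[LHS]/(e v * e' v) ev ev' mulr1.
rewrite inE => /predU1P[->|/el h]; first by rewrite -[LHS]/(e z * e' z) ez mul0r.
by rewrite -[LHS]/(e v' * e' v') h mulr0.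
Qed.

Definition periodic (w : torus) := exists2 n, (0 < n)%N & iter n tphi w = w.

(** The two-sided orbit, expressed without negative powers: some forward iterates of the two points
    meet. *)
Definition orbit (w : torus) : set torus :=
  [set v | exists m n, iter m tphi w = iter n tphi v].

Lemma orbit_refl w : orbit w w. Proof. by exists 0%N, 0%N. Qed.

Lemma orbit_tphi w v : orbit w (tphi v) <-> orbit w v.
Proof.
split=> -[m [n e]]; first by exists m, n.+1; rewrite e iterSr.
by exists m.+1, n; rewrite iterS e -iterS iterSr.
Qed.

Lemma orbit_tpsi w v : orbit w (tpsi v) <-> orbit w v.
Proof. by rewrite -[in X in _ <-> X](tpsiK v) orbit_tphi. Qed.

Lemma iter_tphi_inj n : injective (iter n tphi).
Proof. by elim: n => // n IH x y; rewrite !iterS => /(can_inj tphiK); exact: IH. Qed.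

Lemma iter_period p k w : iter p tphi w = w -> iter (k * p) tphi w = w.
Proof. by move=> h; elim: k => // k IH; rewrite mulSn iterD IH. Qed.

Lemma orbit_periodic w p v : (0 < p)%N -> iter p tphi w = w -> orbit w v ->
  exists2 i, (i < p)%N & v = iter i tphi w.
Proof.
move=> p0 pw [m [n e]].
(* Applying [tphi] n more times gives n p + m iterations, and a multiple of the period acts
   trivially. *)
have -> : v = iter (n * p.-1 + m) tphi w.
  apply: (@iter_tphi_inj n); rewrite -e -iterD addnA -mulnS prednK //.
  by rewrite addnC iterD iter_period.
exists ((n * p.-1 + m) %% p)%N; first exact: ltn_pmod.
by rewrite {1}(divn_eq (n * p.-1 + m) p) addnC iterD iter_period.
Qed.

(** The condition ranges over all functions [F], which makes stability under right multiplication
    immediate; on the left it follows from [setR_local]. *)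
Definition orbit_ideal (w : torus) : set lop :=
  [set r | setR r /\ forall F t, orbit w t.1 -> r F t = 0].

Lemma setR_mu_gens (S : set lop) : subring_set S -> (forall f, S (mu f)) ->
  S opZ -> S opZi -> setR `<=` S.
Proof.
move=> hS Smu SZ SZi; apply: setR_min => //; try exact: Smu.
by move=> x /scalars_range_mu[f _ <-].
Qed.

(** An operator of R evaluates its argument only at points above the same orbit, as the generators
    show. *)
Lemma setR_local w a : setR a -> forall G : Fn,
  (forall t, orbit w t.1 -> G t = 0) -> forall t, orbit w t.1 -> a G t = 0.
Proof.
move: a; apply: setR_mu_gens => [|f G h t wt|G h t wt|G h t wt].
- split=> // [x y hx hy G h t wt|x y hx hy G h t wt].
    by rewrite -[LHS]/(x G t - y G t) hx // hy // subrr.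
  by apply: hx => // t' wt'; apply: hy.
- by rewrite muE h // mulr0.
- by apply: h => /=; apply/orbit_tphi.
- by apply: h => /=; apply/orbit_tpsi.
Qed.

Lemma orbit_ideal_ideal w : ideal_in setR (orbit_ideal w).
Proof.
have [R1 RB RM] := subring_setR; split; first split.
- by move=> x [].
- by split=> //; exact: subring_set0 subring_setR.
- move=> x y [Rx hx] [Ry hy]; split; first exact: RB.
  by move=> F t wt; rewrite -[LHS]/(x F t - y F t) hx // hy // subrr.
- move=> a x Ra [Rx hx]; split; first exact: RM.
  by move=> F t wt; apply: (setR_local Ra) wt => t' wt'; exact: hx.
- move=> a x Ra [Rx hx]; split; first exact: RM.
  by move=> F t wt; exact: hx.
Qed.

Lemma orbit_ideal_mu w f : setR (mu f) ->
  orbit_ideal w (mu f) <-> (forall t, orbit w t.1 -> f t = 0).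
Proof.
move=> Rf; split=> [[_ h] t wt|h].
  by have := h 1 t wt; rewrite -[LHS]/(f t * 1) mulr1.
by split=> // F t wt; rewrite muE h // mul0r.
Qed.

Lemma orbit_ideal1 w : ~ orbit_ideal w 1.
Proof.
have R1 : setR (mu 1) by rewrite mu1; have [] := subring_setR.
rewrite -mu1 => /(orbit_ideal_mu w R1) h; have /eqP := h (w, 0) (orbit_refl w).
by rewrite -[X in X == _]/(1 : C) oner_eq0.
Qed.

Lemma size_shift_sub (g : {poly C}) (c : C) : g != 0 ->
  (size (g \Po ('X + c%:P) - g)%R < size g)%N.
Proof.
move=> g0; have sX : size ('X + c%:P) = 2 by rewrite size_XaddC.
have lX : lead_coef ('X + c%:P) = 1 by rewrite lead_coefXaddC.
have sg : (0 < size g)%N by rewrite size_poly_gt0.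
rewrite -(prednK sg) ltnS; apply/leq_sizeP => j.
rewrite leq_eqVlt coefB => /predU1P[<-|lt].
  have := lead_coef_comp g (q := 'X + c%:P); rewrite sX => /(_ isT).
  rewrite lX expr1n mulr1 !lead_coefE size_comp_poly2 // => ->.
  by rewrite subrr.
have lej : (size g <= j)%N by rewrite -(prednK sg).
by rewrite !nth_default ?subrr // size_comp_poly2.
Qed.

(** * Maximality of the ideal of a finite orbit *)

Section OrbitIdealMaximal.
Variables (w : torus) (p : nat) (p0 : (0 < p)%N) (pw : iter p tphi w = w).
Variables (I : set lop) (hI : ideal_in setR I) (wI : orbit_ideal w `<=` I).

(** Modulo [I], a function of [setB] is determined by its values above the orbit. *)
Lemma congr_orbit f g : setB (mu f) -> setB (mu g) ->
  (forall t, orbit w t.1 -> f t = g t) -> I (mu f) -> I (mu g).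
Proof.
move=> Bf Bg fg If.
have Bgf : setB (mu (g - f)).
  by rewrite muB; have [_ BB _] := subring_setB; exact: BB.
have -> : g = (g - f) + f by rewrite subrK.
rewrite muD; apply: (idealD hI) => //; apply: wI; apply/orbit_ideal_mu.
  exact: setB_sub_setR.
by move=> t wt; rewrite -[LHS]/(g t - f t) fg // subrr.
Qed.

Lemma setB_lift a : laurent a -> setB (mu (lift a)).
Proof. by move=> la; apply: setA_sub_setB; apply/setA_laurent. Qed.

Lemma setB_poly (g : {poly C}) : setB (mu (fun t => g.[t.2])).
Proof.
apply: (@deg_setB (size g)); exists (fun i _ => g`_i); first by move=> i; exact: laurent_cst.
by apply/funext => t; rewrite horner_coef.
Qed.

Lemma setBM f g : setB (mu f) -> setB (mu g) -> setB (mu (f * g)).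
Proof. by rewrite muM; have [_ _ h] := subring_setB; exact: h. Qed.

(* Modulo the ideal of the orbit, multiplying by the indicator function [e] of
   a point [v] of the orbit turns an element of [I] into [g(u) e]; the
   polynomials [g] so obtained form a translation-invariant subspace. *)
Lemma orbit_ideal_indicator x : I x -> ~ orbit_ideal w x ->
  exists v e, [/\ orbit w v, laurent e, e v = 1,
    forall v', orbit w v' -> v' != v -> e v' = 0 & I (muT e)].
Proof.
move=> Ix nx; have [n [m [b [Bb Ib xE]]]] := ideal_coefs hI Ix.
have [i nb] : exists i : 'I_m, ~ orbit_ideal w (b i).
  apply: contrapT => h; apply: nx; rewrite xE.
  have hO := orbit_ideal_ideal w.
  apply: (idealMl hO); first exact: setRX_opZi.
  apply: (ideal_sum hO) => i _; apply: (idealMr hO); first exact: setRX_opZ.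
  by apply: contrapT => nb; apply: h; exists i.
have Ibi := Ib i (ltn_ord i); have Bbi := Bb i.
have [d [f [[a la fE] bE]]] := setB_deg Bbi.
rewrite bE in Ibi Bbi nb.
have [t [wt ft]] : exists t, orbit w t.1 /\ f t != 0.
  apply: contrapT => h; apply: nb; apply/orbit_ideal_mu; first exact: setB_sub_setR.
  by move=> t wt; apply: contrapT => /eqP ft; apply: h; exists t.
set v := t.1 in wt.
pose l := [seq z <- [seq iter i tphi w | i <- iota 0 p] | z != v].
have [e [le ev el]] : exists e, [/\ laurent e, e v = 1 & forall v', v' \in l -> e v' = 0].
  by apply: laurent_sep_list; rewrite mem_filter eqxx.
have eO v' : orbit w v' -> v' != v -> e v' = 0.
  move=> wv' v'v; apply: el; rewrite mem_filter v'v.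
  have [j jp ->] := orbit_periodic p0 pw wv'.
  by apply: map_f; rewrite mem_iota.
exists v, e; split=> //.
pose E (g : {poly C}) : Fn := lift e * (fun t => g.[t.2]).
have BE g : setB (mu (E g)) by apply: setBM; [exact: setB_lift|exact: setB_poly].
(* Above the orbit, the indicator times [f] involves only the restriction of [f] to the line above
   [v], a nonzero polynomial. *)
have [g Ig g0] : exists2 g, I (mu (E g)) & g != 0.
  exists (\poly_(i < d) a i v); last first.
    apply: contraNneq ft => g0; rewrite fE /poly_fun -/v -(horner_poly _ (fun i => a i v)).
    by rewrite g0 horner0.
  apply: (@congr_orbit (lift e * f)) => //.
  - by apply: setBM => //; exact: setB_lift.
  - move=> t' wt'; rewrite -[LHS]/(e t'.1 * f t').
    rewrite -[RHS]/(e t'.1 * (\poly_(i < d) a i v).[t'.2]) horner_poly fE /poly_fun.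
    by have [->//|/eO ->] := eqVneq t'.1 v; rewrite ?mul0r.
  - rewrite muM; apply: (idealMl hI) => //.
    by apply: setB_sub_setR; exact: setB_lift.
(* Conjugation by [opZ ^+ p] fixes the orbit pointwise, so that on it only u is moved, by [p]. *)
have shift g1 : I (mu (E g1)) -> I (mu (E (g1 \Po ('X + p%:R%:P)))).
  move=> I1; have I2 : I (mu (E g1 \o iter p phi)).
    rewrite -[X in I X]mulr1 -(opZiXK p) mulrA -opZX_mu.
    apply: (idealMr hI); first exact: setRX_opZi.
    by apply: (idealMl hI); first exact: setRX_opZ.
  apply: congr_orbit I2 => //.
    rewrite (_ : E g1 \o iter p phi = lift (e \o iter p tphi) *
      (fun t => (g1 \Po ('X + p%:R%:P)).[t.2])).
      by apply: setBM; [apply: setB_lift; exact: laurent_tphi|exact: setB_poly].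
    apply/funext => t'; rewrite /E /=.
    rewrite -[RHS]/(e (iter p tphi t'.1) * (g1 \Po ('X + p%:R%:P)).[t'.2]).
    rewrite -[LHS]/(e (iter p phi t').1 * g1.[(iter p phi t').2]).
    by rewrite iter_phi /= horner_comp hornerD hornerX hornerC.
  move=> t' wt'; rewrite -[LHS]/(e (iter p phi t').1 * g1.[(iter p phi t').2]).
  rewrite -[RHS]/(e t'.1 * (g1 \Po ('X + p%:R%:P)).[t'.2]).
  rewrite iter_phi /= horner_comp hornerD hornerX hornerC.
  have [j _ ->] := orbit_periodic p0 pw wt'.
  by rewrite -iterD addnC iterD pw.
pose P n := `[< exists g : {poly C}, [/\ size g = n, I (mu (E g)) & g != 0] >].
have exP : exists n, P n by exists (size g); apply/asboolP; exists g.
case: (ex_minnP exP) => _ /asboolP[{Ig g0}g [<- Ig g0]] minP.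
(* The difference of [g] and its translate has smaller degree and still gives an element of [I]; by
   minimality it is zero, and a polynomial with a nonzero period is constant. *)
have sg1 : (size g <= 1)%N.
  apply: (periodic_poly_const p0) => s.
  have : g \Po ('X + p%:R%:P) - g = 0.
    apply: contrapT => /eqP g'0.
    have := size_shift_sub p%:R g0; rewrite ltnNge => /negP; apply.
    apply: minP; apply/asboolP; eexists; split; [by []| |exact: g'0].
    rewrite (_ : E _ = E (g \Po ('X + p%:R%:P)) - E g).
      by rewrite muB; apply: (idealB hI) => //; exact: shift.
    apply/funext => t'.
    rewrite -[LHS]/(e t'.1 * (g \Po ('X + p%:R%:P) - g).[t'.2]).
    rewrite -[RHS]/(e t'.1 * (g \Po ('X + p%:R%:P)).[t'.2] - e t'.1 * g.[t'.2]).
    by rewrite hornerD hornerN mulrBr.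
  move/eqP; rewrite subr_eq0 => /eqP/(congr1 (fun h : {poly C} => h.[s])).
  by rewrite horner_comp hornerD hornerX hornerC.
have gC := size1_polyC sg1; set c := g`_0 in gC.
have c0 : c != 0 by move: g0; rewrite gC polyC_eq0.
have := idealZ hI c^-1 Ig; rewrite -muZ; congr (I (mu _)).
apply/funext => t'; rewrite gC -[LHS]/(c^-1 * (e t'.1 * c%:P.[t'.2])) hornerC.
by rewrite mulrCA mulVf // mulr1.
Qed.

(** The translates of the indicator [e] lie in [I] and cover the orbit. The product of the 1 -
    e(tphi^i) over one period vanishes on the orbit, hence lies in [I]; each factor being 1 modulo
    [I], so is the product. *)
Lemma orbit_ideal_maximal x : I x -> ~ orbit_ideal w x -> I 1.
Proof.
move=> Ix nx; have [v [e [wv le ev eO Ie]]] := orbit_ideal_indicator Ix nx.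
pose f i : Fn := 1 - lift (e \o iter i tphi).
have If i : I (1 - mu (f i)).
  rewrite muB mu1 opprB addrC subrK.
  have -> : mu (lift (e \o iter i tphi)) = opZ ^+ i * muT e * opZi ^+ i.
    rewrite /muT opZX_mu -mulrA opZiXK mulr1; congr mu; apply/funext => t.
    by rewrite /= iter_phi.
  apply: (idealMr hI); first exact: setRX_opZi.
  by apply: (idealMl hI); first exact: setRX_opZ.
pose g n : Fn := \prod_(i < n) f i.
have [_ BB BM] := subring_setB; have [B1 _ _] := subring_setB.
have Bf i : setB (mu (f i)).
  by rewrite muB mu1; apply: BB => //; apply: setB_lift; exact: laurent_tphi.
have Bg n : setB (mu (g n)).
  elim: n => [|n IH]; first by rewrite /g big_ord0 mu1.
  by rewrite /g big_ord_recr muM; exact: BM.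
have Ig n : I (1 - mu (g n)).
  elim: n => [|n IH]; first by rewrite /g big_ord0 mu1 subrr; exact: ideal0.
  rewrite /g big_ord_recr muM /= -/(g n).
  have -> : 1 - mu (g n) * mu (f n) = (1 - mu (g n)) + mu (g n) * (1 - mu (f n)).
    by rewrite mulrBr mulr1 addrA subrK.
  apply: (idealD hI) => //; apply: (idealMl hI) => //; exact: setB_sub_setR.
rewrite -[X in I X](subrK (mu (g p))); apply: (idealD hI) => //.
apply: wI; apply/orbit_ideal_mu; first exact: setB_sub_setR.
move=> t wt; rewrite /g fct_prodE.
have [i ip vE] : exists2 i, (i < p)%N & iter i tphi t.1 = v.
  have [j jp tE] := orbit_periodic p0 pw wt.
  have [k kp vE] := orbit_periodic p0 pw wv.
  have [le_jk|lt_kj] := leqP j k.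
    exists (k - j)%N; first by rewrite (leq_ltn_trans (leq_subr _ _)).
    by rewrite tE vE -iterD subnK.
  exists (k + p - j)%N; first lia.
  by rewrite tE vE -iterD subnK ?iterD ?pw //; lia.
rewrite (bigD1 (Ordinal ip)) //= [X in X * _](_ : _ = 0) ?mul0r //.
by rewrite -[LHS]/(1 - e (iter i tphi t.1)) vE ev subrr.
Qed.

End OrbitIdealMaximal.

Definition vX : vec := (1, 0).
Definition vY : vec := (0, 1).

Lemma mono_vX w : mono vX w = val w.1.
Proof. by rewrite /mono /= expr1z expr0z mulr1. Qed.

Lemma mono_vY w : mono vY w = val w.2.
Proof. by rewrite /mono /= expr1z expr0z mul1r. Qed.

Definition opMinus (u : vec) (c : C) : lop := muT (mono u + (fun=> - c)).

Lemma laurent_minus u c : laurent (mono u + (fun=> - c)).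
Proof. by apply: laurent_add; [exact: laurent_mono|exact: laurent_cst]. Qed.

Lemma setR_muT f : laurent f -> setR (muT f).
Proof. by move=> lf; apply: setA_sub_setR; exact/setA_laurent. Qed.

Lemma setR_opMinus u c : setR (opMinus u c).
Proof. exact/setR_muT/laurent_minus. Qed.

Lemma muTC f g : muT f * muT g = muT g * muT f. Proof. exact: muC. Qed.

Lemma muTM f g : muT (f * g) = muT f * muT g.
Proof. by rewrite -muM. Qed.

Lemma muTD f g : muT (f + g) = muT f + muT g.
Proof. by rewrite -muD. Qed.

(** The ideal of a point is generated by the two coordinate differences: the functions congruent to
    their value at [w] modulo these form a subring, which contains the generators. *)
Lemma laurent_vanish f w : laurent f -> f w = 0 -> exists b c,
  [/\ laurent b, laurent c &
      f = (mono vX + (fun=> - mono vX w)) * b + (mono vY + (fun=> - mono vY w)) * c].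
Proof.
pose Q (f : torus -> C) := exists b c,
  [/\ laurent b, laurent c & f = (fun=> f w) +
      (mono vX + (fun=> - mono vX w)) * b + (mono vY + (fun=> - mono vY w)) * c].
pose hx := mono vX + (fun=> - mono vX w); pose hy := mono vY + (fun=> - mono vY w).
have eqf (f1 f2 : torus -> C) : (forall v, f1 v = f2 v) -> f1 = f2 by move=> h; exact/funext.
suff : setA `<=` [set r | exists2 f, laurent f /\ Q f & r = muT f].
  move=> h lf fw; have /h[g [lg [b [c [lb lc gE]]]] /mu_inj fg] : setA (muT f) by exact/setA_laurent.
  have {}fg : f = g by apply: eqf => v; have := congr1 (fun F : Fn => F (v, 0)) fg.
  exists b, c; split=> //; rewrite -fg in gE; rewrite {1}gE; apply: eqf => v.
  rewrite -[LHS]/(f w + hx v * b v + hy v * c v) -[RHS]/(hx v * b v + hy v * c v).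
  by rewrite fw add0r.
have sub : subring_set [set r | exists2 f, laurent f /\ Q f & r = muT f].
  split.
  - exists (fun=> 1); last by rewrite -mu1.
    split; first exact: laurent_cst.
    exists (fun=> 0), (fun=> 0); split; try exact: laurent_cst.
    by apply: eqf => v; rewrite -[RHS]/(1 + hx v * 0 + hy v * 0) !mulr0 !addr0.
  - move=> _ _ [f1 [l1 [b1 [c1 [lb1 lc1 e1]]]] ->] [f2 [l2 [b2 [c2 [lb2 lc2 e2]]]] ->].
    exists (f1 - f2); last by rewrite -muB.
    split; first by apply: laurent_add => //; exact: laurent_opp.
    exists (b1 - b2), (c1 - c2); split; try by apply: laurent_add => //; exact: laurent_opp.
    apply: eqf => v; rewrite {1}e1 {1}e2.
    rewrite -[LHS]/(f1 w + hx v * b1 v + hy v * c1 v - (f2 w + hx v * b2 v + hy v * c2 v)).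
    rewrite -[RHS]/(f1 w - f2 w + hx v * (b1 v - b2 v) + hy v * (c1 v - c2 v)).
    by ring.
  - move=> _ _ [f1 [l1 [b1 [c1 [lb1 lc1 e1]]]] ->] [f2 [l2 [b2 [c2 [lb2 lc2 e2]]]] ->].
    exists (f1 * f2); last by rewrite -muM.
    split; first exact: laurent_mul.
    exists (b1 * f2 + (fun=> f1 w) * b2), (c1 * f2 + (fun=> f1 w) * c2).
    split; try by apply: laurent_add; apply: laurent_mul => //; exact: laurent_cst.
    apply: eqf => v; rewrite -[LHS]/(f1 v * f2 v).
    rewrite -[RHS]/(f1 w * f2 w + hx v * (b1 v * f2 v + f1 w * b2 v)
                    + hy v * (c1 v * f2 v + f1 w * c2 v)).
    rewrite {1}e1 -[LHS]/((f1 w + hx v * b1 v + hy v * c1 v) * f2 v).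
    have e2v : f2 v = f2 w + hx v * b2 v + hy v * c2 v by rewrite {1}e2.
    have -> : (f1 w + hx v * b1 v + hy v * c1 v) * f2 v =
      f1 w * f2 v + hx v * b1 v * f2 v + hy v * c1 v * f2 v by ring.
    rewrite {1}e2v; ring.
have inv u (h : torus -> C) : (forall v, mono u v - mono u w = h v) ->
    (exists b c, [/\ laurent b, laurent c & h = hx * b + hy * c]) ->
    exists2 f, laurent f /\ Q f & muT (mono u) = muT f.
  move=> hu [b [c [lb lc hE]]]; exists (mono u) => //; split; first exact: laurent_mono.
  exists b, c; split=> //; apply: eqf => v.
  rewrite -[RHS]/(mono u w + hx v * b v + hy v * c v) -addrA.
  have -> : hx v * b v + hy v * c v = h v by rewrite hE.
  by rewrite -hu addrC subrK.
have l0 := laurent_cst 0; have l1 := laurent_cst 1.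
apply: setA_min => //.
- move=> _ [c _ <-]; exists (fun=> c); last by apply: lop_ext => F t.
  split; first exact: laurent_cst.
  exists (fun=> 0), (fun=> 0); split=> //.
  by apply: eqf => v; rewrite -[RHS]/(c + hx v * 0 + hy v * 0) !mulr0 !addr0.
- apply: (inv vX hx) => //; exists (fun=> 1), (fun=> 0); split=> //.
  by apply: eqf => v; rewrite -[RHS]/(hx v * 1 + hy v * 0) mulr0 addr0 mulr1.
(* From 1/x - 1/a = - (x - a) / (a x). *)
- pose b : torus -> C := (fun=> - (mono (-1, 0) w)) * mono (-1, 0).
  apply: (inv (-1, 0) (hx * b)) => [v|]; last first.
    exists b, (fun=> 0); split=> //; first by apply: laurent_mul; [exact: laurent_cst|exact: laurent_mono].
    by apply: eqf => v; rewrite -[RHS]/(hx v * b v + hy v * 0) mulr0 addr0.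
  rewrite -[RHS]/((mono vX v - mono vX w) * (- mono (-1, 0) w * mono (-1, 0) v)).
  have ev z : mono vX z * mono (-1, 0) z = 1 by rewrite -monoD -[RHS](mono0 z).
  have h1 := ev v; have h2 := ev w.
  have -> : (mono vX v - mono vX w) * (- mono (-1, 0) w * mono (-1, 0) v) =
    - mono (-1, 0) w * (mono vX v * mono (-1, 0) v) +
    mono (-1, 0) v * (mono vX w * mono (-1, 0) w) by ring.
  by rewrite h1 h2 !mulr1 addrC.
- apply: (inv vY hy) => //; exists (fun=> 0), (fun=> 1); split=> //.
  by apply: eqf => v; rewrite -[RHS]/(hx v * 0 + hy v * 1) mulr0 add0r mulr1.
- pose b : torus -> C := (fun=> - (mono (0, -1) w)) * mono (0, -1).
  apply: (inv (0, -1) (hy * b)) => [v|]; last first.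
    exists (fun=> 0), b; split=> //; first by apply: laurent_mul; [exact: laurent_cst|exact: laurent_mono].
    by apply: eqf => v; rewrite -[RHS]/(hx v * 0 + hy v * b v) mulr0 add0r.
  rewrite -[RHS]/((mono vY v - mono vY w) * (- mono (0, -1) w * mono (0, -1) v)).
  have ev z : mono vY z * mono (0, -1) z = 1 by rewrite -monoD -[RHS](mono0 z).
  have h1 := ev v; have h2 := ev w.
  have -> : (mono vY v - mono vY w) * (- mono (0, -1) w * mono (0, -1) v) =
    - mono (0, -1) w * (mono vY v * mono (0, -1) v) +
    mono (0, -1) v * (mono vY w * mono (0, -1) w) by ring.
  by rewrite h1 h2 !mulr1 addrC.
Qed.

Definition prime_in (E : nzRingType) (S P : set E) : Prop :=
  [/\ ideal_in S P, ~ P 1 & forall I J, ideal_in S I -> ideal_in S J ->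
     (forall x y, I x -> J y -> P (x * y)) -> I `<=` P \/ J `<=` P].

Lemma laurent_poly u (p : {poly C}) : laurent (fun w => p.[mono u w]).
Proof.
suff h n : laurent (fun w => \sum_(i < n) p`_i * mono u w ^+ i).
  rewrite (_ : (fun=> _) = fun w => \sum_(i < size p) p`_i * mono u w ^+ i) //.
  by apply/funext => w; rewrite horner_coef.
elim: n => [|n IH].
  rewrite (_ : (fun=> _) = fun=> 0); first exact: laurent_cst.
  by apply/funext => w; rewrite big_ord0.
rewrite (_ : (fun=> _) = (fun w => \sum_(i < n) p`_i * mono u w ^+ i)
  + (fun=> p`_n) * mono (u *+ n)).
  apply: laurent_add => //; apply: laurent_mul; first exact: laurent_cst.
  exact: laurent_mono.
apply/funext => w; rewrite big_ord_recr /=.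
by rewrite -[RHS]/(_ + p`_n * mono (u *+ n) w) mono_mulrn.
Qed.

Lemma orbit_ideal_coef w n (a : nat -> torus -> C) :
  (forall t, orbit w t.1 -> poly_fun n a t = 0) ->
  forall i v, (i < n)%N -> orbit w v -> a i v = 0.
Proof.
move=> f0 i v lin wv; pose q : {poly C} := \poly_(i < n) a i v.
suff q0 : q = 0 by have := coef_poly n (fun i => a i v) i; rewrite -/q q0 coef0 lin.
apply: poly_eq0_horner => s; rewrite horner_poly.
exact: f0 (v, s) wv.
Qed.

(* The product of the orbit ideal by its residual lies in [P], so that a prime
   [P] contains one of the two. *)
Definition residual (P : set lop) (w : torus) : set lop :=
  [set r | setR r /\ forall f, laurent f -> (forall v, orbit w v -> f v = 0) ->
     P (muT f * r)].

Section ResidualIdeal.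
Variables (P : set lop) (hP : ideal_in setR P) (w : torus).

Lemma laurent_tpsi f : laurent f -> laurent (f \o tpsi).
Proof.
move=> /setA_laurent Af; apply/setA_laurent.
by rewrite /muT -lift_psi -opZi_muK; exact: setA_conjZi.
Qed.

(** Stability on the left is the delicate part: a generator crosses [muT f] at the cost of replacing
    [f] by itself or its composite with [tphi] or [tpsi], which still vanishes on the orbit. *)
Lemma residual_ideal : ideal_in setR (residual P w).
Proof.
have [R1 RB RM] := subring_setR.
have NB x y : residual P w x -> residual P w y -> residual P w (x - y).
  move=> [Rx hx] [Ry hy]; split; first exact: RB.
  by move=> f lf fw; rewrite mulrBr; apply: (idealB hP); [exact: hx|exact: hy].
split; last first.
  move=> a x Ra [Rx hx]; split; first exact: RM.
  by move=> f lf fw; rewrite mulrA; apply: (idealMr hP) => //; exact: hx.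
split=> //; first by move=> x [].
  split; first exact: subring_set0 subring_setR.
  by move=> f lf fw; rewrite mulr0; exact: ideal0.
move=> a x Ra; move: x.
suff : setR `<=` [set a | setR a /\ forall x, residual P w x -> residual P w (a * x)].
  by move=> /(_ _ Ra)[].
have hmu g : setR (mu g) -> setR (mu g) /\
    forall x, residual P w x -> residual P w (mu g * x).
  move=> Rg; split=> // x [Rx hx]; split; first exact: RM.
  move=> f lf fw; rewrite mulrA muC -mulrA; apply: (idealMl hP) => //; exact: hx.
apply: setR_min.
- split; first by split=> // x; rewrite mul1r.
    move=> b c [Rb hb] [Rc hc]; split; first exact: RB.
    by move=> x Nx; rewrite mulrBl; apply: NB; [exact: hb|exact: hc].
  move=> b c [Rb hb] [Rc hc]; split; first exact: RM.
  by move=> x Nx; rewrite -mulrA; apply: hb; exact: hc.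
- move=> _ [c _ <-]; have Rc : setR c%:A by apply: scalars_setR; exists c.
  have [f _ fE] : range mu (c%:A : lop) by apply: scalars_range_mu; exists c.
  by move: Rc; rewrite -[in_alg _ c]fE; rewrite -fE; exact: hmu.
- by apply: hmu; apply: setA_sub_setR; exact: setA_mono.
- by apply: hmu; apply: setA_sub_setR; exact: setA_mono.
- by apply: hmu; apply: setA_sub_setR; exact: setA_mono.
- by apply: hmu; apply: setA_sub_setR; exact: setA_mono.
- by apply: hmu; exact: setR_opU.
- split=> [|x [Rx hx]]; first exact: setR_opZ.
  split; first by apply: RM => //; exact: setR_opZ.
  move=> f lf fw; have -> : muT f * (opZ * x) = opZ * (muT (f \o tpsi) * x).
    rewrite !mulrA; congr (_ * _); rewrite /muT opZ_mu; congr (mu _ * _).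
    by apply/funext => t; rewrite /lift /= tphiK.
  apply: (idealMl hP); first exact: setR_opZ.
  by apply: hx => [|v wv]; [exact: laurent_tpsi|apply: fw => /=; apply/orbit_tpsi].
- split=> [|x [Rx hx]]; first exact: setR_opZi.
  split; first by apply: RM => //; exact: setR_opZi.
  move=> f lf fw; have -> : muT f * (opZi * x) = opZi * (muT (f \o tphi) * x).
    rewrite !mulrA; congr (_ * _); rewrite /muT opZi_mu; congr (mu _ * _).
    by apply/funext => t; rewrite /lift /= tpsiK.
  apply: (idealMl hP); first exact: setR_opZi.
  by apply: hx => [|v wv]; [exact: (@laurent_tphi _ 1%N)|apply: fw => /=; apply/orbit_tphi].
Qed.

(** The coefficients of [x] in z and then in u are Laurent functions that vanish on the orbit; the
    powers of u and z to their right are absorbed by the residual, which is an ideal. *)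
Lemma orbit_ideal_residual x y : orbit_ideal w x -> residual P w y -> P (x * y).
Proof.
move=> Ox Ny; have [n [m [b [Bb Ob ->]]]] := ideal_coefs (orbit_ideal_ideal w) Ox.
rewrite -mulrA; apply: (idealMl hP); first exact: setRX_opZi.
rewrite mulr_suml; apply: (ideal_sum hP) => i _.
have [d [a [la bE]]] := setB_mu_sum (Bb i).
have a0 : forall j v, (j < d)%N -> orbit w v -> a j v = 0.
  apply: orbit_ideal_coef.
  have := Ob i (ltn_ord i); rewrite bE => /orbit_ideal_mu; apply.
  by rewrite -bE; exact: setB_sub_setR.
have -> : b i = \sum_(j < d) muT (a j) * opU ^+ j.
  rewrite bE; apply: lop_ext => F t; rewrite lop_sumE muE mulr_suml.
  by apply: eq_bigr => j _; rewrite /opU muX -[RHS]/(a j t.1 * (t.2 ^+ j * F t)) mulrA.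
rewrite -mulrA mulr_suml; apply: (ideal_sum hP) => j _; rewrite -mulrA.
have [_ hN] : residual P w (opU ^+ j * (opZ ^+ i * y)).
  apply: (idealMl residual_ideal); first by apply: subring_setX; [exact: subring_setR|exact: setR_opU].
  by apply: (idealMl residual_ideal); first exact: setRX_opZ.
by apply: hN => // v; exact: a0.
Qed.

End ResidualIdeal.

Lemma common_zeros_list (p q : {poly C}) : p != 0 -> q != 0 ->
  exists l : seq torus,
    forall w, p.[val w.1] = 0 -> q.[val w.2] = 0 -> w \in l.
Proof.
have roots (g : {poly C}) : g != 0 ->
    exists l : seq Cx, forall x, g.[val x] = 0 -> x \in l.
  move=> g0; have [rs gE] := closed_field_poly_normal g.
  exists (pmap insub rs) => x gx; rewrite mem_pmap_sub.
  have : root g (val x) by rewrite rootE gx.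
  by rewrite gE rootZ ?lead_coef_eq0 // root_prod_XsubC.
move=> /roots[l hl] /roots[l' hl']; exists [seq (x, y) | x <- l, y <- l'] => w pw qw.
by apply/allpairsP; exists w; split; [exact: hl|exact: hl'|case: (w)].
Qed.

Lemma common_zeros_periodic (p q : {poly C}) w : p != 0 -> q != 0 ->
  (forall n, p.[val (iter n tphi w).1] = 0 /\ q.[val (iter n tphi w).2] = 0) ->
  periodic w.
Proof.
move=> p0 q0 h; have [l hl] := common_zeros_list p0 q0.
apply: (@iter_periodic _ _ l); first exact: can_inj tphiK.
by move=> n; have [h1 h2] := h n; exact: hl.
Qed.

Section PrimeClassification.
Variables (P : set lop) (hP : prime_in setR P).

Let iP : ideal_in setR P. Proof. by have [] := hP. Qed.

Variables (p q : {poly C}) (p0 : p != 0) (q0 : q != 0).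
Variables (Pp : P (muT (fun w => p.[mono vX w]))) (Pq : P (muT (fun w => q.[mono vY w]))).

Lemma unit_cancel r f fi : setR (mu fi) -> mu fi * mu f = 1 -> P (mu f * r) -> P r.
Proof. by move=> Rfi e h; rewrite -[r]mul1r -e -mulrA; apply: (idealMl iP). Qed.

(** When both coordinates are nonzero, [r] is killed modulo [P] by all functions that vanish at the
    point [w] they define. If [r] is not in [P], then [r] is in the residual of [w] but not in [P],
    so that primeness puts the orbit ideal inside [P]. *)
Lemma prime_local alpha beta r : setR r ->
  P (opMinus vX alpha * r) -> P (opMinus vY beta * r) ->
  P r \/ exists2 w, periodic w & orbit_ideal w `<=` P.
Proof.
move=> Rr Pa Pb.
have [a0|a0] := eqVneq alpha 0.
  left; apply: (@unit_cancel r (lift (mono vX)) (lift (mono (-1, 0)))).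
  - by apply: setA_sub_setR; exact: setA_mono.
  - exact: opXK.
  move: Pa; rewrite /opMinus a0; congr (P (mu _ * _)); apply/funext => t.
  by rewrite -[LHS]/(mono vX t.1 + - 0) oppr0 addr0.
have [b0|b0] := eqVneq beta 0.
  left; apply: (@unit_cancel r (lift (mono vY)) (lift (mono (0, -1)))).
  - by apply: setA_sub_setR; exact: setA_mono.
  - exact: opYK.
  move: Pb; rewrite /opMinus b0; congr (P (mu _ * _)); apply/funext => t.
  by rewrite -[LHS]/(mono vY t.1 + - 0) oppr0 addr0.
pose w : torus := (exist (fun c : C => c != 0) _ a0, exist (fun c : C => c != 0) _ b0).
have vanish f : laurent f -> f w = 0 -> P (muT f * r).
  move=> lf fw; have [b [c [lb lc ->]]] := laurent_vanish lf fw.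
  rewrite muTD !muTM mulrDl; apply: (idealD iP).
    rewrite muTC -mulrA; apply: (idealMl iP); first exact: setR_muT.
    by move: Pa; rewrite /opMinus mono_vX.
  rewrite muTC -mulrA; apply: (idealMl iP); first exact: setR_muT.
  by move: Pb; rewrite /opMinus mono_vY.
have [Pr|nPr] := pselect (P r); [by left|right; exists w].
  (* A Laurent function in [P] must vanish at [w], as otherwise its value there, a unit, would bring
     [r] into [P]; stability under [tphi] extends this to the forward orbit. *)
  have zero n f : laurent f -> P (muT f) -> f (iter n tphi w) = 0.
    elim: n f => [|n IH] f lf Pf.
      apply: contrapT => /eqP fw; apply: nPr.
      pose g : torus -> C := f + (fun=> - f w).
      have Pg : P (muT g * r).
        apply: vanish; last by rewrite -[LHS]/(f w - f w) subrr.
        by apply: laurent_add => //; exact: laurent_cst.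
      rewrite -[r]scale1r -(mulVf fw) -scalerA; apply: (idealZ iP).
      have -> : f w *: r = muT f * r - muT g * r.
        rewrite -mulrBl; have -> : muT f - muT g = (f w)%:A.
          apply: lop_ext => F t; rewrite -[LHS]/(f t.1 * F t - (f t.1 - f w) * F t).
          by rewrite -[RHS]/(f w * F t) -mulrBl opprB addrC subrK.
        by rewrite mulr_algl.
      by apply: (idealB iP) => //; apply: (idealMr iP).
    rewrite iterS; apply: (IH (f \o tphi)); first exact: (@laurent_tphi _ 1%N).
    rewrite /muT -lift_phi -opZ_muK; apply: (idealMr iP); first exact: setR_opZi.
    by apply: (idealMl iP) => //; exact: setR_opZ.
  apply: (common_zeros_periodic p0 q0) => n; split.
    rewrite -mono_vX; apply: (zero n (fun w => p.[mono vX w])) => //.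
    exact: laurent_poly.
  rewrite -mono_vY; apply: (zero n (fun w => q.[mono vY w])) => //.
  exact: laurent_poly.
have [_ _ prP] := hP.
have [//|NP] := prP _ _ (orbit_ideal_ideal w) (residual_ideal iP w)
  (@orbit_ideal_residual P iP w).
case: nPr; apply: NP; split=> // f lf fw.
by apply: vanish => //; exact: fw (orbit_refl w).
Qed.

(** Nesting, instead of a product followed by one multiplication, lets linear factors be peeled off
    from the left. *)
Definition factors u (l : seq C) (r : lop) := foldr (fun z acc => opMinus u z * acc) r l.

Lemma setR_factors u l r : setR r -> setR (factors u l r).
Proof.
have [_ _ RM] := subring_setR.
by elim: l => //= z l IH Rr; apply: RM; [exact: setR_opMinus|exact: IH].
Qed.

Lemma factorsM u l r s : factors u l (r * s) = factors u l r * s.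
Proof. by elim: l => //= z l ->; rewrite mulrA. Qed.

Lemma muT_poly_factors u (g : {poly C}) l :
  g = lead_coef g *: \prod_(z <- l) ('X - z%:P) ->
  muT (fun w => g.[mono u w]) = lead_coef g *: factors u l 1.
Proof.
move=> gE; rewrite {1}gE.
apply: lop_ext => F t; rewrite -[RHS]/(lead_coef g * factors u l 1 F t).
rewrite -[LHS]/((lead_coef g *: \prod_(z <- l) ('X - z%:P)).[mono u t.1] * F t).
rewrite hornerZ -mulrA; congr (_ * _); elim: l {gE} => [|z l IH].
  by rewrite big_nil hornerC mul1r.
rewrite big_cons hornerM /= -mulrA IH hornerXsubC.
by rewrite -[RHS]/((mono u t.1 - z) * factors u l 1 F t).
Qed.

(** Otherwise [prime_local] always allows cancellation. The linear factors of [p] are removed one at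
    a time, each by running through all those of [q], until 1 lies in [P]. *)
Lemma prime_contains_orbit_ideal : exists2 w, periodic w & orbit_ideal w `<=` P.
Proof.
apply: contrapT => nw.
have local alpha beta r : setR r -> P (opMinus vX alpha * r) ->
    P (opMinus vY beta * r) -> P r.
  by move=> Rr Pa Pb; have [//|] := prime_local Rr Pa Pb.
have [rs pE] := closed_field_poly_normal p; have [ss qE] := closed_field_poly_normal q.
have strip u (g : {poly C}) l : g != 0 -> g = lead_coef g *: \prod_(z <- l) ('X - z%:P) ->
    P (muT (fun w => g.[mono u w])) -> P (factors u l 1).
  move=> g0 gE; rewrite (muT_poly_factors u gE) => /(idealZ iP (lead_coef g)^-1).
  by rewrite scalerA mulVf ?lead_coef_eq0 // scale1r.
have {pE}Prs := strip _ _ _ p0 pE Pp; have {qE}Pss := strip _ _ _ q0 qE Pq.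
have inner alpha l r : setR r -> P (opMinus vX alpha * r) -> P (factors vY l r) -> P r.
  elim: l r => //= beta l IH r Rr Pa Pl; apply: IH => //.
  apply: (local alpha beta) => //; first exact: setR_factors.
  elim: l {Pl} => //= z l IHl; rewrite mulrA [opMinus vX _ * _]muTC -mulrA.
  by apply: (idealMl iP) => //; exact: setR_opMinus.
have [_ nP1 _] := hP; apply: nP1.
elim: rs Prs => //= alpha l IH Pl; apply: IH.
have Rl : setR (factors vX l 1).
  by apply: setR_factors; have [] := subring_setR.
apply: (inner alpha ss) => //.
by rewrite -[factors vX l 1]mul1r factorsM; apply: (idealMr iP).
Qed.

Lemma prime_orbit_ideal : exists2 w, periodic w & P = orbit_ideal w.
Proof.
have [w [n n0 nw] wP] := prime_contains_orbit_ideal; exists w; first by exists n.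
apply/seteqP; split=> // x Px; apply: contrapT => nx.
have [_ nP1 _] := hP; apply: nP1; exact: (orbit_ideal_maximal n0 nw iP wP Px nx).
Qed.

End PrimeClassification.

(** * The algebra and its faithful simple module *)

Definition algR_pred : {pred lop} := [in setR].

Lemma algR_subalg_closed : GRing.subalg_closed algR_pred.
Proof.
have [R1 RB RM] := subring_setR; split; rewrite ?inE //.
- move=> c x y; rewrite !inE => Rx Ry; apply: (subring_setD subring_setR) => //.
  by rewrite -mulr_algl; apply: RM => //; apply: scalars_setR; exists c.
- by move=> x y; rewrite !inE; exact: RM.
Qed.

HB.instance Definition _ :=
  GRing.isSubalgClosed.Build C lop algR_pred algR_subalg_closed.

Definition algR := {r : lop | r \in algR_pred}.

HB.instance Definition _ := Choice.on algR.
HB.instance Definition _ := SubType.on algR.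
HB.instance Definition _ := [SubChoice_isSubAlgebra of algR by <:].

Lemma algRP (x : algR) : setR (val x).
Proof. by apply/set_mem; exact: valP. Qed.

Definition toR (r : lop) (h : setR r) : algR := exist _ r (mem_set h).

Lemma valM (x y : algR) : val (x * y) = val x * val y. Proof. by []. Qed.
Lemma val1 : val (1 : algR) = 1. Proof. by []. Qed.
Lemma valZ (c : C) (x : algR) : val (c *: x) = c *: val x. Proof. by []. Qed.

(** Ideals are studied as subsets of the operator algebra; [img] and [pre] carry them to and from
    the type [algR]. *)
Definition img (I : set algR) : set lop := [set r | exists2 x, I x & val x = r].
Definition pre (J : set lop) : set algR := [set x | J (val x)].

Lemma img_val (I : set algR) x : img I (val x) <-> I x.
Proof. by split=> [[y Iy /val_inj <-]|Ix] //; exists x. Qed.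

Lemma lideal_img I : left_ideal I -> lideal_in setR (img I).
Proof.
move=> [I0 IB IM]; split.
- by move=> _ [x _ <-]; exact: algRP.
- by exists 0.
- by move=> _ _ [x Ix <-] [y Iy <-]; exists (x - y); first exact: IB.
- by move=> a _ Ra [x Ix <-]; exists (toR Ra * x) => //; exact: IM.
Qed.

Lemma rideal_img I : right_ideal I -> @lideal_in lop^c setR (img I).
Proof.
move=> [I0 IB IM]; split.
- by move=> _ [x _ <-]; exact: algRP.
- by exists 0.
- by move=> _ _ [x Ix <-] [y Iy <-]; exists (x - y); first exact: IB.
- by move=> a _ Ra [x Ix <-]; exists (x * toR Ra) => //; exact: IM.
Qed.

Lemma ideal_img I : two_sided_ideal I -> ideal_in setR (img I).
Proof.
move=> [hl [I0 IB IM]]; split; first exact: lideal_img.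
by move=> a _ Ra [x Ix <-]; exists (x * toR Ra) => //; exact: IM.
Qed.

Lemma ideal_pre J : ideal_in setR J -> two_sided_ideal (pre J).
Proof.
move=> hJ; split; split.
- exact: (ideal0 hJ).
- by move=> x y Jx Jy; exact: (idealB hJ).
- by move=> a x Jx; apply: (idealMl hJ) => //; exact: algRP.
- exact: (ideal0 hJ).
- by move=> x y Jx Jy; exact: (idealB hJ).
- by move=> a x Jx; apply: (idealMr hJ) => //; exact: algRP.
Qed.

Lemma proper_ideal1 (R : nzRingType) (P : set R) : prime_ideal P -> ~ P 1.
Proof.
move=> [[[_ _ PM] _] /eqP PT _] P1; apply: PT; apply/seteqP; split=> // x _.
by rewrite -[x]mulr1; exact: PM.
Qed.

Lemma prime_img P : prime_ideal P -> prime_in setR (img P).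
Proof.
move=> hP; have [iP _ pP] := hP; split; first exact: ideal_img.
  by rewrite -val1 img_val; exact: proper_ideal1.
move=> I J hI hJ IJP.
have sub K : ideal_in setR K -> pre K `<=` P -> K `<=` img P.
  move=> hK KP r Kr; have Rr : setR r by have [[h _ _ _] _] := hK; exact: h.
  by exists (toR Rr) => //; exact: KP.
have [||x y Ix Jy|/(sub _ hI)|/(sub _ hJ)] := pP (pre I) (pre J); try exact: ideal_pre.
- by apply/img_val; exact: IJP.
- by left.
- by right.
Qed.

Lemma noetherian_algR : noetherian algR.
Proof.
have [lR rR] := noetherian_setR; split=> I hI asc.
  have [n||N hN] := lR (fun n => img (I n)).
  - exact: lideal_img.
  - by move=> n _ [x Ix <-]; exists x => //; exact: asc.
  exists N => n Nn; apply/seteqP; split=> x.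
    by move/img_val => /(hN _ Nn) /img_val.
  exact: (chain_le (E := algR) asc Nn).
have [n||N hN] := rR (fun n => img (I n)).
- exact: rideal_img.
- by move=> n _ [x Ix <-]; exists x => //; exact: asc.
exists N => n Nn; apply/seteqP; split=> x.
  by move/img_val => /(hN _ Nn) /img_val.
exact: (chain_le (E := algR) asc Nn).
Qed.

Lemma fg_algR : fg_algebra algR.
Proof.
have RX := setA_sub_setR (setA_mono (1, 0)); have RXi := setA_sub_setR (setA_mono (-1, 0)).
have RY := setA_sub_setR (setA_mono (0, 1)); have RYi := setA_sub_setR (setA_mono (0, -1)).
exists [:: toR RX; toR RXi; toR RY; toR RYi; toR setR_opU; toR setR_opZ; toR setR_opZi].
move=> B [B1 BZ BM] sB x.
have hB : subring_set [set r | exists2 b : algR, b \in B & val b = r].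
  split; first by exists 1.
    move=> _ _ [b Bb <-] [c Bc <-]; exists (b - c) => //.
    by have := BZ (-1) c b Bc Bb; rewrite scaleN1r addrC.
  by move=> _ _ [b Bb <-] [c Bc <-]; exists (b * c) => //; exact: BM.
have gen (b : algR) : b \in [:: toR RX; toR RXi; toR RY; toR RYi; toR setR_opU; toR setR_opZ; toR setR_opZi] ->
    [set r | exists2 b : algR, b \in B & val b = r] (val b).
  by move=> /sB Bb; exists b.
have : setR `<=` [set r | exists2 b : algR, b \in B & val b = r].
  apply: setR_min => //.
  - move=> _ [c _ <-]; exists (c%:A : algR) => //.
    have B0 : (0 : algR) \in B by have := BZ (-1) 1 1 B1 B1; rewrite scaleN1r addNr.
    by have := BZ c 1 0 B1 B0; rewrite addr0.
  - by apply: (gen (toR RX)); rewrite !inE eqxx ?orbT.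
  - by apply: (gen (toR RXi)); rewrite !inE eqxx ?orbT.
  - by apply: (gen (toR RY)); rewrite !inE eqxx ?orbT.
  - by apply: (gen (toR RYi)); rewrite !inE eqxx ?orbT.
  - by apply: (gen (toR setR_opU)); rewrite !inE eqxx ?orbT.
  - by apply: (gen (toR setR_opZ)); rewrite !inE eqxx ?orbT.
  - by apply: (gen (toR setR_opZi)); rewrite !inE eqxx ?orbT.
by move=> /(_ _ (algRP x))[b Bb /val_inj <-].
Qed.

Lemma val_sum (J : Type) (r : seq J) (P : pred J) (F : J -> algR) :
  val (\sum_(i <- r | P i) F i) = \sum_(i <- r | P i) val (F i).
Proof. by apply: (big_morph val). Qed.

Lemma valX (x : algR) n : val (x ^+ n) = val x ^+ n.
Proof. by elim: n => // n IH; rewrite !exprS valM IH. Qed.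

(** A linear relation between powers of u, evaluated at heights s, is a polynomial with every s as a
    root. *)
Lemma infinite_dimensional_algR : ~ finite_dimensional algR.
Proof.
move=> [n [e he]]; pose u := toR setR_opU.
have /choice[c hc] : forall i : nat, exists c : 'I_n -> C, u ^+ i = \sum_(j < n) c j *: e j.
  by move=> i; exact: he.
pose M : 'M[C]_(n.+1, n) := \matrix_(i, j) c i j.
have [d d0 dM] := left_kernel_nonzero M (ltnSn n).
have u0 : \sum_(i < n.+1) d 0 i *: u ^+ i = 0.
  under eq_bigr do rewrite hc scaler_sumr.
  rewrite exchange_big /= big1 // => j _.
  under eq_bigr do rewrite scalerA.
  rewrite -scaler_suml; have := congr1 (fun A : 'rV_n => A 0 j) dM; rewrite !mxE.
  by under eq_bigr do rewrite mxE; move=> ->; rewrite scale0r.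
pose p : {poly C} := \poly_(i < n.+1) d 0 (inord i).
have p0 : p != 0.
  apply: contraNneq d0 => p0; apply/eqP/rowP => i; rewrite mxE.
  by have := congr1 (fun p : {poly C} => p`_i) p0; rewrite coef_poly ltn_ord coef0 inord_val.
have pr s : p.[s] = 0.
  have := congr1 (fun r : algR => val r 1 ((one_Cx, one_Cx), s)) u0.
  rewrite val_sum lop_sumE horner_poly => h; rewrite -[RHS]h; apply: eq_bigr => i _.
  rewrite inord_val valZ valX -[RHS]/(d 0 i * (opU ^+ i) 1 ((one_Cx, one_Cx), s)).
  by rewrite /opU muX muE -[X in _ * (_ * X)]/(1 : C) mulr1.
by case/eqP: p0; exact: poly_eq0_horner.
Qed.

(** * The module of the orbit of (2, 2, 0) *)

Lemma two_neq0 : 2%:R != 0 :> C. Proof. by rewrite pnatr_eq0. Qed.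
Definition two_Cx : Cx := exist (fun c : C => c != 0) 2%:R two_neq0.
Definition base : point := ((two_Cx, two_Cx), 0).

(** Both coordinates stay above 1, so that their product strictly increases along the orbit. *)
Lemma base_not_periodic : ~ periodic base.1.
Proof.
pose size2 (w : torus) := val w.1 * val w.2.
have grow n : 1 < val (iter n tphi base.1).1 /\ 1 < val (iter n tphi base.1).2.
  elim: n => [|n [h1 h2]]; first by rewrite /= ltr1n.
  by rewrite iterS /=; split=> //; exact: mulr_egt1.
have mono_size n : size2 (iter n tphi base.1) < size2 (iter n.+1 tphi base.1).
  have [h1 h2] := grow n; rewrite iterS /size2 /=.
  by rewrite ltr_pMl // mulr_gt0 // (lt_trans ltr01).
move=> [n n0 e].
have : size2 base.1 < size2 (iter n tphi base.1).
  case: n n0 {e} => // n _; elim: n => [|n IH]; first exact: (mono_size 0%N).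
  by apply: lt_trans IH _; exact: mono_size.
by rewrite e ltxx.
Qed.

Definition delta : Fn := fun t => (t == base)%:R.

(** The module is taken as the cyclic one generated by [delta]; simplicity then amounts to
    recovering [delta] from any nonzero element. *)
Definition orbit_module_pred : {pred Fn} :=
  [in [set F | exists2 r, setR r & F = r delta]].

Lemma orbit_module_zmod_closed : zmod_closed orbit_module_pred.
Proof.
have [_ RB _] := subring_setR; split; rewrite ?inE.
  by exists 0 => //; exact: subring_set0 subring_setR.
move=> F G; rewrite !inE => -[r Rr ->] [s Rs ->].
by exists (r - s) => //; exact: RB.
Qed.

HB.instance Definition _ :=
  GRing.isZmodClosed.Build Fn orbit_module_pred orbit_module_zmod_closed.

Definition orbit_module := {F : Fn | F \in orbit_module_pred}.

HB.instance Definition _ := Choice.on orbit_module.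
HB.instance Definition _ := SubType.on orbit_module.
HB.instance Definition _ := [SubChoice_isSubZmodule of orbit_module by <:].

Lemma orbit_moduleP (m : orbit_module) : exists2 r, setR r & val m = r delta.
Proof. by have := valP m; rewrite inE. Qed.

Lemma orbit_module_act (r : lop) (m : orbit_module) :
  setR r -> r (val m) \in orbit_module_pred.
Proof.
move=> Rr; have [s Rs ->] := orbit_moduleP m; rewrite inE; exists (r * s) => //.
by have [_ _ RM] := subring_setR; exact: RM.
Qed.

Definition orbit_scale (x : algR) (m : orbit_module) : orbit_module :=
  exist _ (val x (val m)) (orbit_module_act m (algRP x)).

Fact orbit_scaleA x y m : orbit_scale x (orbit_scale y m) = orbit_scale (x * y) m.
Proof. exact: val_inj. Qed.
Fact orbit_scale1 : left_id 1 orbit_scale.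
Proof. by move=> m; exact: val_inj. Qed.
Fact orbit_scaleDr : right_distributive orbit_scale +%R.
Proof. by move=> x m n; apply: val_inj; rewrite /= lopD. Qed.
Fact orbit_scaleDl m : {morph orbit_scale^~ m : x y / x + y}.
Proof. by move=> x y; exact: val_inj. Qed.

HB.instance Definition _ := GRing.Zmodule_isLmodule.Build algR orbit_module
  orbit_scaleA orbit_scale1 orbit_scaleDr orbit_scaleDl.

(** Composition with [phi] moves supports backwards: this is the indicator of [iter i psi base]. *)
Definition delta_at i : Fn := (opZ ^+ i) delta.

Lemma delta_atE i t : delta_at i t = (iter i phi t == base)%:R.
Proof. by rewrite /delta_at opZX. Qed.

Lemma delta_at_eq0 i t : iter i phi t != base -> delta_at i t = 0.
Proof. by rewrite delta_atE => /negPf ->. Qed.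

Lemma mu_delta_at f i : exists c, mu f (delta_at i) = fscale c (delta_at i).
Proof.
exists (f (iter i psi base)); apply/funext => t.
rewrite muE -[RHS]/(f (iter i psi base) * delta_at i t).
have [e|ne] := eqVneq (iter i phi t) base; last by rewrite !delta_at_eq0 ?mulr0.
have -> // : iter i psi base = t.
rewrite -e; elim: i {e} => // i IH; by rewrite [iter i.+1 phi t]iterS iterSr phiK.
Qed.

Lemma opU_delta_at i : opU (delta_at i) = fscale (- i%:R) (delta_at i).
Proof.
apply/funext => t; rewrite muE -[RHS]/(- i%:R * delta_at i t).
have [|ne] := eqVneq (iter i phi t) base; last by rewrite !delta_at_eq0 ?mulr0.
rewrite iter_phi => /(congr1 snd) /= e; congr (_ * _).
by apply/eqP; rewrite -addr_eq0 e.
Qed.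

Lemma lop_fsum (r : lop) (I : Type) (s : seq I) (F : I -> Fn) :
  r (\sum_(i <- s) F i) = \sum_(i <- s) r (F i).
Proof. by apply: (big_morph r); [exact: lopD|exact: lop0]. Qed.

Lemma lopSumE (I : Type) (s : seq I) (r : I -> lop) F :
  (\sum_(i <- s) r i) F = \sum_(i <- s) r i F.
Proof. by apply: (big_morph (fun x : lop => x F)). Qed.

Section Submodule.
Variables (N : set Fn).
Hypothesis N0 : N 0.
Hypothesis NB : forall F G, N F -> N G -> N (F - G).
Hypothesis NR : forall r F, setR r -> N F -> N (r F).

Lemma N_scale c F : N F -> N (fscale c F).
Proof.
by move=> NF; apply: (NR (r := c%:A)) => //; apply: scalars_setR; exists c.
Qed.

Lemma N_opp F : N F -> N (- F).
Proof. by rewrite -sub0r; exact: NB. Qed.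

Lemma N_sum m (F : nat -> Fn) : (forall i, (i < m)%N -> N (F i)) -> N (\sum_(i < m) F i).
Proof.
elim: m => [|m IH] h; first by rewrite big_ord0.
rewrite big_ord_recr /= -[F m]opprK; apply: NB; first by apply: IH => i im; apply: h; exact: ltnW.
by apply: N_opp; exact: h.
Qed.

(** The functions [delta_at i] are eigenvectors of u with the distinct eigenvalues -i. Applying u +
    m kills the last term and multiplies the others by the nonzero m - i. *)
Lemma submodule_homogeneous m (c : nat -> C) :
  N (\sum_(i < m) fscale (c i) (delta_at i)) ->
  forall i, (i < m)%N -> N (fscale (c i) (delta_at i)).
Proof.
elim: m c => // m IH c; set G := \sum_(i < _) _ => NG.
have Ge : opU G - fscale (- m%:R) G =
    \sum_(i < m) fscale ((m%:R - i%:R) * c i) (delta_at i).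
  have -> : fscale (- m%:R) G = \sum_(i < m.+1) fscale (- m%:R * c i) (delta_at i).
    rewrite /G; elim: (index_enum _) => [|i s IHs]; first by rewrite !big_nil fscale0.
    by rewrite !big_cons fscaleD IHs fscaleA.
  have -> : \sum_(i < m) fscale ((m%:R - i%:R) * c i) (delta_at i) =
      \sum_(i < m.+1) fscale ((m%:R - i%:R) * c i) (delta_at i).
    rewrite big_ord_recr /= subrr mul0r.
    rewrite [fscale 0 _](_ : _ = 0) ?addr0 //.
    by apply/funext => t; exact: mul0r.
  rewrite lop_fsum -sumrB; apply: eq_bigr => i _; rewrite lopZ opU_delta_at fscaleA.
  apply/funext => t; rewrite -[LHS]/(c i * - i%:R * delta_at i t - - m%:R * c i * delta_at i t).
  by rewrite -[RHS]/((m%:R - i%:R) * c i * delta_at i t); ring.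
have low i : (i < m)%N -> N (fscale (c i) (delta_at i)).
  move=> im; have h : N (fscale ((m%:R - i%:R) * c i) (delta_at i)).
    apply: (IH (fun i => (m%:R - i%:R) * c i)) im; rewrite -Ge.
    by apply: NB; [apply: NR => //; exact: setR_opU|exact: N_scale].
  have d0 : m%:R - i%:R != 0 :> C by rewrite subr_eq0 eqr_nat gtn_eqF.
  have := N_scale (m%:R - i%:R)^-1 h; rewrite fscaleA mulrA mulVf // mul1r.
  by [].
move=> i; rewrite ltnS leq_eqVlt => /predU1P[->|]; last exact: low.
have -> : fscale (c m) (delta_at m) = G - \sum_(i < m) fscale (c i) (delta_at i).
  by rewrite /G big_ord_recr /= addrAC subrr add0r.
by apply: NB => //; exact: (N_sum (F := fun i => fscale (c i) (delta_at i))).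
Qed.

(** A power of [opZ] clears the denominator of [r], homogeneity isolates one nonzero term, and a
    power of [opZi] carries it back to [delta]. *)
Lemma submodule_delta r : setR r -> N (r delta) -> r delta != 0 -> N delta.
Proof.
move=> Rr Nr r0; have [n [s [Ss rE]]] : exists n s, pol_left setB opZ s /\ r = opZi ^+ n * s.
  by have := Rr; rewrite /setR -(pol_left_right setB_normalizesZ).
have [m [b [Bb sE]]] := Ss.
have /choice[c hc] : forall i, exists c, b i (delta_at i) = fscale c (delta_at i).
  by move=> i; have [f _ <-] := setB_mu (Bb i); exact: mu_delta_at.
have sdE : s delta = \sum_(i < m) fscale (c i) (delta_at i).
  by rewrite sE lopSumE; apply: eq_bigr => i _; rewrite -hc.
have Ns : N (\sum_(i < m) fscale (c i) (delta_at i)).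
  rewrite -sdE (_ : s = opZ ^+ n * r); first exact: NR (setRX_opZ n) Nr.
  by rewrite rE mulrA opZiXK mul1r.
have [i ci] : exists i : 'I_m, c i != 0.
  apply: contrapT => h; case/eqP: r0.
  rewrite rE -[LHS]/((opZi ^+ n) (s delta)) sdE big1 ?lop0 // => i _.
  have -> : c i = 0 by apply: contrapT => /eqP ci; apply: h; exists i.
  by apply/funext => t; exact: mul0r.
have := N_scale (c i)^-1 (submodule_homogeneous Ns (ltn_ord i)).
rewrite fscaleA mulVf // fscale1 => /(NR (setRX_opZi i)).
rewrite -[X in N X -> _]/((opZi ^+ i * opZ ^+ i) delta) opZXK.
by [].
Qed.

End Submodule.

Lemma orbit_module_simple : simple_module orbit_module.
Proof.
have R1 : setR 1 by have [] := subring_setR.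
have dM : delta \in orbit_module_pred by rewrite inE; exists 1.
split.
  exists (exist _ delta dM : orbit_module); apply/eqP => /(congr1 val) /= e.
  have := congr1 (fun F : Fn => F base) e; rewrite /delta eqxx => /eqP.
  by rewrite -[X in _ == X]/(0 : C) oner_eq0.
move=> N hN; have [N0 NL] := hN.
pose NS : set Fn := [set F | exists2 m : orbit_module, m \in N & val m = F].
have [hz|nz] := pselect (forall m, m \in N -> m = 0); [by left|right=> m].
have [m0 [m0N m00]] : exists m, m \in N /\ m != 0.
  apply: contrapT => h; apply: nz => m' m'N; apply: contrapT => /eqP m'0.
  by apply: h; exists m'.
have NSR r F : setR r -> NS F -> NS (r F).
  move=> Rr [n nN <-]; exists (toR Rr *: n) => //.
  by rewrite -[_ *: n]addr0; exact: NL.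
have NS0 : NS 0 by exists 0.
have NSB F G : NS F -> NS G -> NS (F - G).
  move=> [n nN <-] [n' n'N <-]; exists (n - n') => //.
  by have := NL (-1) n' n n'N nN; rewrite scaleN1r addrC.
have [r Rr m0E] := orbit_moduleP m0.
have NSd : NS delta.
  apply: (submodule_delta NS0 NSB NSR Rr); first by exists m0.
  by rewrite -m0E; apply: contraNneq m00 => e; apply/eqP; exact: val_inj.
have [s Rs mE] := orbit_moduleP m.
by have [n nN /val_inj <-] : NS (val m) by rewrite mE; exact: NSR.
Qed.

Lemma opZiX_delta n : (opZi ^+ n) delta (iter n phi base) = 1.
Proof.
have h F t : (opZi ^+ n) F (iter n phi t) = F t.
  by rewrite -opZX -[LHS]/((opZ ^+ n * opZi ^+ n) F t) opZiXK.
by rewrite h /delta eqxx.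
Qed.

(** A nonzero annihilator would contain nonzero polynomials in each coordinate. Evaluated against
    the translates of [delta], they vanish along the forward orbit of the base point, which would
    then be periodic. *)
Lemma orbit_module_faithful : annihilator orbit_module = [set 0].
Proof.
apply/seteqP; split=> x /=; last by move=> -> m; rewrite scale0r.
move=> hx; apply: contrapT => x0.
have [R1 RB RM] := subring_setR.
pose J : set lop := [set r | setR r /\ forall s, setR s -> r (s delta) = 0].
have hJ : ideal_in setR J.
  split; first split.
  - by move=> r [].
  - by split=> //; exact: subring_set0 subring_setR.
  - move=> r s [Rr hr] [Rs hs]; split; first exact: RB.
    by move=> u Ru; rewrite -[LHS]/(r (u delta) - s (u delta)) hr // hs // subrr.
  - move=> a r Ra [Rr hr]; split; first exact: RM.
    by move=> u Ru; rewrite -[LHS]/(a (r (u delta))) hr // lop0.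
  - move=> a r Ra [Rr hr]; split; first exact: RM.
    by move=> u Ru; rewrite -[LHS]/(r ((a * u) delta)) hr //; exact: RM.
have Jx : J (val x).
  split; first exact: algRP.
  move=> s Rs; have sM : s delta \in orbit_module_pred by rewrite inE; exists s.
  by have := congr1 val (hx (exist _ (s delta) sM)).
have vx0 : val x != 0 by apply/eqP => e; apply: x0; exact: val_inj.
have [p p0 [_ Jp]] := ideal_polys hJ vX Jx vx0.
have [q q0 [_ Jq]] := ideal_polys hJ vY Jx vx0.
apply: base_not_periodic; apply: (common_zeros_periodic p0 q0) => n.
have ev (g : torus -> C) : muT g ((opZi ^+ n) delta) = 0 -> g (iter n tphi base.1) = 0.
  move/(congr1 (fun F : Fn => F (iter n phi base))).
  rewrite muE opZiX_delta mulr1 iter_phi => h; exact: h.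
by split; [rewrite -mono_vX|rewrite -mono_vY];
  [apply: (ev (fun w => p.[mono vX w])); apply: Jp|apply: (ev (fun w => q.[mono vY w])); apply: Jq];
  exact: setRX_opZi.
Qed.

Lemma two_sided0 (R : nzRingType) : two_sided_ideal [set (0 : R)].
Proof.
by split; split=> //= [x y -> ->|a x ->]; rewrite ?subrr ?mulr0 ?mul0r.
Qed.

(** If I J = 0 with J nonzero, the elements killed by I form a submodule containing J M, which is
    nonzero; so I kills the whole module. *)
Lemma faithful_simple_prime (R : nzRingType) (M : lmodType R) :
  simple_module M -> annihilator M = [set 0] -> prime_ring R.
Proof.
move=> [_ simM] annM; split; first exact: two_sided0.
  apply/eqP => e; have : [set (0 : R)] 1 by rewrite e.
  by move/eqP; rewrite oner_eq0.
move=> I J hI hJ IJ; have [|nJ] := pselect (J `<=` [set 0]); first by right.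
left=> x Ix.
have [y [Jy y0]] : exists y, J y /\ y <> 0.
  apply: contrapT => h; apply: nJ => y Jy; apply: contrapT => y0.
  by apply: h; exists y.
have [m ym] : exists m : M, y *: m <> 0.
  apply: contrapT => h; apply: y0; suff : annihilator M y by rewrite annM.
  by move=> m; apply: contrapT => ym; apply: h; exists m.
pose N : {pred M} := [in [set m : M | forall z, I z -> z *: m = 0]].
have hN : GRing.submod_closed N.
  split; first by rewrite inE => z _; rewrite scaler0.
  move=> a u v; rewrite !inE => hu hv z Iz.
  rewrite scalerDr (hv z Iz) addr0 scalerA; apply: hu.
  by have [_ [_ _ h]] := hI; exact: h.
have [h|h] := simM N hN.
  exfalso; apply: ym; apply: h; rewrite inE => z Iz.
  by rewrite scalerA (IJ z y Iz Jy) scale0r.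
rewrite -annM => u; have := h u; rewrite inE; exact.
Qed.

(** If neither ideal lies in [P], each contains an element congruent to 1 modulo [P]; multiplying
    these two puts 1 in [P]. *)
Lemma maximal_prime (R : nzRingType) (P : set R) : two_sided_ideal P -> ~ P 1 ->
  (forall I x, two_sided_ideal I -> P `<=` I -> I x -> ~ P x -> I 1) ->
  prime_ideal P.
Proof.
move=> hP nP1 maxP; split=> //; first by apply/eqP => e; apply: nP1; rewrite e.
have [[P0 PB PM] [_ _ PM']] := hP.
have PD x y : P x -> P y -> P (x + y).
  by move=> Px Py; rewrite -[y]opprK; apply: (PB) => //; rewrite -sub0r; exact: PB.
have sum_one K : two_sided_ideal K -> ~ K `<=` P -> exists a b, [/\ K a, P b & a + b = 1].
  move=> [[K0 KB KM] [_ _ KM']] nK.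
  have [x [Kx nPx]] : exists x, K x /\ ~ P x.
    apply: contrapT => h; apply: nK => x Kx; apply: contrapT => nPx.
    by apply: h; exists x.
  pose S : set R := [set z | exists a b, [/\ K a, P b & a + b = z]].
  apply: (maxP S x) => //.
  - split; split.
    + by exists 0, 0; rewrite addr0.
    + move=> _ _ [a [b [Ka Pb <-]]] [c [d [Kc Pd <-]]]; exists (a - c), (b - d).
      by split; [exact: KB|exact: PB|rewrite opprD addrACA].
    + move=> r _ [a [b [Ka Pb <-]]]; exists (r * a), (r * b).
      by split; [exact: KM|exact: PM|rewrite mulrDr].
    + by exists 0, 0; rewrite addr0.
    + move=> _ _ [a [b [Ka Pb <-]]] [c [d [Kc Pd <-]]]; exists (a - c), (b - d).
      by split; [exact: KB|exact: PB|rewrite opprD addrACA].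
    + move=> r _ [a [b [Ka Pb <-]]]; exists (a * r), (b * r).
      by split; [exact: KM'|exact: PM'|rewrite mulrDl].
  - by move=> z Pz; exists 0, z; rewrite add0r.
  - by exists x, 0; rewrite addr0.
move=> I J hI hJ IJ; apply: contrapT => /not_orP[nI nJ].
have [a [b [Ia Pb ab]]] := sum_one I hI nI.
have [c [d [Jc Pd cd]]] := sum_one J hJ nJ.
apply: nP1; rewrite -[1]mulr1 -{1}ab -cd mulrDl; apply: (PD); last exact: PM'.
by rewrite mulrDr; apply: (PD); [exact: IJ|exact: PM].
Qed.

(** * Spectra shaped like the affine line *)

(* These properties determine the Zariski topology up to homeomorphism: the
   spectrum is countably infinite, and its proper closed subsets are the finite
   sets of nonzero primes. *)
Record curve_like (R : nzRingType) (W : countType) (pts : W -> set R) : Prop := {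
  curve_prime0 : prime_ideal [set (0 : R)];
  curve_pts : forall P : set R, prime_ideal P -> P <> [set 0] -> exists w, P = pts w;
  curve_finite : forall I x, two_sided_ideal I -> I x -> x <> 0 ->
    exists s : seq W, forall w, I `<=` pts w -> w \in s;
  curve_max : forall P Q : set R, prime_ideal P -> prime_ideal Q -> P <> [set 0] ->
    P `<=` Q -> P = Q;
  curve_dense : forall I x, two_sided_ideal I -> I x -> x <> 0 ->
    exists P : set R, [/\ prime_ideal P, P <> [set 0] & ~ I `<=` P]
}.

(** All points of the torus serve as indices, since [curve_like] only asks that each nonzero prime
    occur; countability is that of the field. *)
Definition algR_pts (w : torus) : set algR := pre (orbit_ideal w).

Lemma prime_ring_algR : prime_ring algR.
Proof. exact: faithful_simple_prime orbit_module_simple orbit_module_faithful. Qed.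

Lemma nonzero_elt (R : nzRingType) (I : set R) : I 0 -> I <> [set 0] ->
  exists2 x, I x & x <> 0.
Proof.
move=> I0 nI; apply: contrapT => h; apply: nI; apply/seteqP; split=> x; last by move=> ->.
by move=> Ix; apply: contrapT => x0; apply: h; exists x.
Qed.

Lemma algR_pts_prime w : periodic w -> prime_ideal (algR_pts w).
Proof.
move=> [n n0 nw]; apply: maximal_prime.
- by apply: ideal_pre; exact: orbit_ideal_ideal.
- exact: orbit_ideal1.
move=> I x hI wI Ix nx; apply/img_val.
apply: (orbit_ideal_maximal n0 nw (ideal_img hI) _ (x := val x)) => //; last exact/img_val.
by move=> r Or; have [Rr _] := Or; exists (toR Rr) => //; exact: wI.
Qed.

Lemma algR_prime P : prime_ideal P -> P <> [set 0] ->
  exists2 w, periodic w & P = algR_pts w.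
Proof.
move=> hP P0; have [[[P00 _ _] _] _ _] := hP.
have [x Px x0] := nonzero_elt P00 P0.
have ix : img P (val x) by apply/img_val.
have vx0 : val x != 0 by apply/eqP => e; apply: x0; exact: val_inj.
have hP' := prime_img hP; have [iP _ _] := hP'.
have [p p0 Pp] := ideal_polys iP vX ix vx0.
have [q q0 Pq] := ideal_polys iP vY ix vx0.
have [w pw PE] := prime_orbit_ideal hP' p0 q0 Pp Pq; exists w => //.
by apply/seteqP; split=> y; rewrite /algR_pts /pre /= -PE => /img_val.
Qed.

Lemma algR_pts_mem w f : laurent f -> orbit_ideal w (muT f) -> f w = 0.
Proof.
move=> lf /orbit_ideal_mu h; apply: (h _ (w, 0)); first exact: setR_muT.
exact: orbit_refl.
Qed.

Lemma algR_curve_like : curve_like algR_pts.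
Proof.
split.
- exact: prime_ring_algR.
- by move=> P hP /(algR_prime hP)[w _ ->]; exists w.
- move=> I x hI Ix x0.
  have ix : img I (val x) by apply/img_val.
  have vx0 : val x != 0 by apply/eqP => e; apply: x0; exact: val_inj.
  have iI := ideal_img hI.
  have [p p0 Ip] := ideal_polys iI vX ix vx0.
  have [q q0 Iq] := ideal_polys iI vY ix vx0.
  have [l hl] := common_zeros_list p0 q0; exists l => w Iw.
  have sub r : img I r -> orbit_ideal w r by move=> [y Iy <-]; exact: Iw.
  apply: hl; [rewrite -mono_vX|rewrite -mono_vY].
    by apply: (algR_pts_mem (laurent_poly vX p)); exact: sub.
  by apply: (algR_pts_mem (laurent_poly vY q)); exact: sub.
- move=> P Q hP hQ P0 PQ; have [w [n n0 nw] PE] := algR_prime hP P0.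
  apply/seteqP; split=> // x Qx; apply: contrapT => nPx.
  apply: (proper_ideal1 hQ); apply/img_val.
  have [iQ _ _] := hQ.
  apply: (orbit_ideal_maximal n0 nw (ideal_img iQ) _ (x := val x)).
  + move=> r Or; have [Rr _] := Or; exists (toR Rr) => //; apply: PQ.
    by rewrite PE.
  + exact/img_val.
  + by move=> Ox; apply: nPx; rewrite PE.
- move=> I x hI Ix x0.
  have ix : img I (val x) by apply/img_val.
  have vx0 : val x != 0 by apply/eqP => e; apply: x0; exact: val_inj.
  have [f [lf If f0]] := ideal_setA (ideal_img hI) ix vx0.
  have [w tw fw] := torsion_dense lf f0.
  have pw := torsion_periodic tw.
  exists (algR_pts w); split; first exact: algR_pts_prime.
    move=> e; have [n n0 nw] := pw.
    pose l := [seq iter i tphi w | i <- iota 0 n].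
    (* A nonzero polynomial in x that vanishes on the orbit; the factor ['X] ensures that a point
       where it does not vanish is a nonzero scalar, hence a coordinate on the torus. *)
    pose g : {poly C} := 'X * \prod_(v <- l) ('X - (val v.1)%:P).
    have g0 : g != 0.
      rewrite mulf_neq0 ?polyX_eq0 // prodf_seq_neq0; apply/allP => v _ /=.
      by rewrite polyXsubC_eq0.
    have [c gc] := nonzero_horner g0.
    have c0 : c != 0 by apply: contraNneq gc => ->; rewrite hornerM hornerX mul0r.
    have lg := laurent_poly vX g.
    have : algR_pts w (toR (setR_muT lg)).
      apply/orbit_ideal_mu; first exact: setR_muT.
      move=> t wt; rewrite /lift mono_vX; have [i iN ->] := orbit_periodic n0 nw wt.
      rewrite hornerM horner_prod (big_rem (iter i tphi w)) /=; last first.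
        by apply: map_f; rewrite mem_iota.
      by rewrite hornerXsubC subrr mul0r mulr0.
    rewrite e => /(congr1 val) /= e0; case/eqP: gc.
    pose v : torus := (exist (fun c : C => c != 0) _ c0, one_Cx).
    have := congr1 (fun r : lop => r 1 (v, 0)) e0.
    by rewrite muE -[X in _ * X]/(1 : C) mulr1 /lift mono_vX.
  move=> Iw; case/eqP: fw; apply: (algR_pts_mem lf).
  by have [y Iy <-] := If; exact: Iw.
Qed.

Lemma Spec_ext (R : nzRingType) (P Q : Spec R) : spec_set P = spec_set Q -> P = Q.
Proof.
case: P Q => P hP [Q hQ] /= PQ; case: Q / PQ hQ => hQ.
by congr MkSpec; exact: Prop_irrelevance.
Qed.

Lemma prime_two_sided (R : nzRingType) (P : set R) (hP : prime_ideal P) : two_sided_ideal P.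
Proof. by have [] := hP. Qed.

Section CurveLikeSpec.
Variables (R : nzRingType) (W : countType) (pts : W -> set R).
Hypothesis hR : curve_like pts.

Definition generic : Spec R := MkSpec (curve_prime0 hR).

Lemma generic_sub (P : Spec R) : generic `<=` P.
Proof. by have [[[P0 _ _] _] _ _] := spec_prime P; move=> x ->. Qed.

Lemma zariski_V_finite (I : set R) x : two_sided_ideal I -> I x -> x <> 0 ->
  finite_set (zariski_V I) /\ ~ zariski_V I generic.
Proof.
move=> hI Ix x0; split; last by move=> /(_ x Ix).
have [s hs] := curve_finite hR hI Ix x0.
(* [h w] is the point of the spectrum with underlying set [pts w], or the generic point by default
   when that set is not prime. *)
have /choice[h hh] : forall w, exists Q : Spec R,
    forall P : Spec R, spec_set P = pts w -> P = Q.
  move=> w; have [[Q hQ]|nQ] := pselect (exists Q : Spec R, spec_set Q = pts w).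
    by exists Q => P PQ; apply: Spec_ext; rewrite PQ.
  by exists generic => P PQ; case: nQ; exists P.
apply: (@sub_finite_set _ _ (h @` [set` s])); last exact/finite_image/finite_seq.
move=> P /= IP; have P0 : spec_set P <> [set 0] by move=> P0; move: (IP x Ix); rewrite P0.
have [w Pw] := curve_pts hR (spec_prime P) P0.
by exists w; [apply: hs; rewrite -Pw|rewrite (hh w P Pw)].
Qed.

Lemma spec_closedP (A : set (Spec R)) :
  closed A <-> A = setT \/ (finite_set A /\ ~ A generic).
Proof.
split=> [/zariski_closedP[I hI ->]|].
  have [I0|nI0] := pselect (I `<=` [set 0]).
    left; apply/seteqP; split=> // P _ x /I0 ->; exact: generic_sub.
  have [x [Ix x0]] : exists x, I x /\ x <> 0.
    apply: contrapT => h; apply: nI0 => x Ix; apply: contrapT => x0.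
    by apply: h; exists x.
  by right; exact: zariski_V_finite Ix x0.
move=> [->|[/finite_seqP[s ->] nA]]; first exact: closedT.
elim: s nA => [|P s IH] nA.
  by rewrite (_ : [set` [::]] = set0) //; [exact: closed0|apply/seteqP; split].
have -> : [set` P :: s] = [set P] `|` [set` s].
  apply/seteqP; split=> Q /=; first by rewrite inE => /predU1P[->|]; [left|right].
  by rewrite inE => -[->|->]; rewrite ?eqxx ?orbT.
apply: closedU; last by apply: IH => h; apply: nA; rewrite /= inE; move: h => /= ->; rewrite orbT.
apply/zariski_closedP; exists (spec_set P); first exact: prime_two_sided (spec_prime P).
apply/seteqP; split=> [Q -> //|Q PQ]; apply: Spec_ext; apply/esym.
apply: (curve_max hR (spec_prime P) (spec_prime Q)) => // P0.
apply: nA => /=; rewrite inE; apply/orP; left; apply/eqP; exact: Spec_ext.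
Qed.

Lemma spec_countable : countable [set: Spec R].
Proof.
have /choice[f hf] : forall P : Spec R, exists w : option W,
    if w is Some w then spec_set P = pts w else spec_set P = [set 0].
  move=> P; have [P0|P0] := pselect (spec_set P = [set 0]); first by exists None.
  by have [w Pw] := curve_pts hR (spec_prime P) P0; exists (Some w).
apply/countable_injP; exists (fun P => choice.pickle (f P)) => P Q _ _.
move/(pcan_inj choice.pickleK) => fPQ; apply: Spec_ext.
by have := hf P; have := hf Q; rewrite fPQ; case: (f Q) => [w|] -> ->.
Qed.

(** If the spectrum were finite, the nonzero primes would form a closed set, cut out by a nonzero
    ideal contained in all of them, against [curve_dense]. *)
Lemma spec_infinite : infinite_set [set: Spec R].
Proof.
move=> fin; pose A : set (Spec R) := ~` [set generic].
have : closed A.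
  apply/spec_closedP; right; split; last by apply.
  exact: sub_finite_set fin.
move/zariski_closedP => [I hI AI].
have [x [Ix x0]] : exists x, I x /\ x <> 0.
  apply: contrapT => h; suff : A generic by apply.
  rewrite AI => x Ix; apply: contrapT => x0; by apply: h; exists x.
have [P [hP P0 nIP]] := curve_dense hR hI Ix x0.
have : A (MkSpec hP) by move=> /= e; apply: P0; rewrite -[P]/(spec_set (MkSpec hP)) e.
by rewrite AI.
Qed.

(** The only closed set through the generic point is the whole space, so that point would be open;
    its complement, closed and proper, would be finite. *)
Lemma generic_not_locally_closed : ~ locally_closed [set generic].
Proof.
move=> [U [D [oU cD UD]]].
have [Ug Dg] : (U `&` D) generic by rewrite -UD.
have DT : D = setT by have [//|[_]] := (spec_closedP D).1 cD.
move: UD; rewrite DT setIT => gU.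
have /spec_closedP[h|[fin _]] : closed (~` [set generic]) by rewrite gU; exact: open_closedC.
  by have : (~` [set generic]) generic; [rewrite h|apply].
apply: spec_infinite; rewrite -(setUv [set generic]) finite_setU; by split.
Qed.

Lemma spec_nat : exists (f : Spec R -> nat) (g : nat -> Spec R),
  [/\ cancel f g, cancel g f & f generic = 0%N].
Proof.
have /pcard_eqP/unsquash h := eq_card_nat spec_countable spec_infinite.
have [g fg gf] : bijective h by rewrite -setTT_bijective; exact: 'bij_h.
(* The transposition of 0 and [h generic] corrects the bijection so that the generic point is sent
   to 0. *)
pose sw n := if n == h generic then 0%N else if n == 0%N then h generic else n.
have swK : involutive sw.
  move=> n; rewrite /sw; have [->|n1] := eqVneq n (h generic).
    by rewrite eqxx; case: eqP.
  have [->|n0] := eqVneq n 0%N; first by rewrite eqxx.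
  by rewrite (negPf n1) (negPf n0).
exists (sw \o h), (g \o sw); split=> [P|n|] /=; rewrite ?swK ?fg ?gf ?swK //.
by rewrite /sw eqxx.
Qed.

End CurveLikeSpec.

(** By [spec_closedP], a bijection that matches generic points preserves closed sets in both
    directions. *)
Lemma curve_like_homeo (R S : nzRingType) (W W' : countType) (p : W -> set R) (p' : W' -> set S)
    (hR : curve_like p) (hS : curve_like p') :
  exists (f : Spec R -> Spec S) (g : Spec S -> Spec R),
    [/\ cancel f g, cancel g f, continuous f, continuous g & f (generic hR) = generic hS].
Proof.
have [a [b [ab ba a0]]] := spec_nat hR; have [c [d [cd dc c0]]] := spec_nat hS.
have cont (A B : nzRingType) (V V' : countType) (q : V -> set A) (q' : V' -> set B)
  (hA : curve_like q) (hB : curve_like q') (f : Spec A -> Spec B) (g : Spec B -> Spec A) :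
  cancel f g -> cancel g f -> f (generic hA) = generic hB -> continuous f.
  move=> fg gf fe; apply/continuous_closedP => D /(spec_closedP hB)[->|[fin nD]].
    by rewrite preimage_setT; exact: closedT.
  apply/(spec_closedP hA); right; split; last by rewrite /= fe.
  suff -> : f @^-1` D = g @` D by exact: finite_image.
  apply/seteqP; split=> P /=; first by move=> DP; exists (f P).
  by move=> [Q DQ <-]; rewrite gf.
exists (d \o a), (b \o c).
have f0 : (d \o a) (generic hR) = generic hS by rewrite /= a0 -c0 cd.
have g0 : (b \o c) (generic hS) = generic hR by rewrite /= c0 -a0 ab.
have fg : cancel (d \o a) (b \o c) by move=> P; rewrite /= dc ab.
have gf : cancel (b \o c) (d \o a) by move=> P; rewrite /= ba cd.
by split=> //; [exact: (cont _ _ _ _ _ _ hR hS _ _ fg gf)|exact: (cont _ _ _ _ _ _ hS hR _ _ gf fg)].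
Qed.

Lemma curve_like_poset_iso (R S : nzRingType) (W W' : countType) (p : W -> set R)
    (p' : W' -> set S) : curve_like p -> curve_like p' -> spec_poset_iso R S.
Proof.
move=> hR hS; have [f [g [fg gf _ _ f0]]] := curve_like_homeo hR hS.
have sub (A : nzRingType) (V : countType) (q : V -> set A) (hA : curve_like q) (P Q : Spec A) :
    P `<=` Q <-> P = generic hA \/ P = Q.
  split=> [PQ|[->|-> //]]; last exact: generic_sub.
  have [P0|P0] := pselect (spec_set P = [set 0]); first by left; exact: Spec_ext.
  by right; apply: Spec_ext; exact: (curve_max hA (spec_prime P) (spec_prime Q)).
exists f; first by exists g.
move=> P Q; rewrite (sub _ _ _ hR) (sub _ _ _ hS) -f0.
by split=> -[h|h]; [left|right|left|right]; try exact: (can_inj fg); rewrite h.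
Qed.

(** The whole spectrum, as the single stratum of a stratification, appears as a subspace. *)
Lemma homeomorphic_setT (T U : topologicalType) : homeomorphic T U ->
  homeomorphic ([set: T] : topologicalType) U.
Proof.
move=> [f [g [fg gf cf cg]]].
pose s (x : T) : [set: T] := SigSub (mem_set (I : [set: T] x)).
exists (f \o set_val), (s \o g); split.
- by move=> x; apply: val_inj; rewrite /= fg.
- by move=> y; rewrite /= gf.
- move=> x; apply: continuous_comp; [exact: initial_continuous|exact: cf].
- apply/continuousP => _ [B oB <-].
  rewrite (_ : (s \o g) @^-1` _ = g @^-1` B) //.
  by move/continuousP : cg; exact.
Qed.

(** * The polynomial ring in one variable *)

Definition root_ideal (a : C) : set {poly C} := [set f | f.[a] = 0].

Lemma root_ideal_ideal a : two_sided_ideal (root_ideal a).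
Proof.
rewrite /root_ideal; split; split => /=.
- exact: horner0.
- by move=> x y hx hy; rewrite hornerD hornerN hx hy subrr.
- by move=> c x hx; rewrite hornerM hx mulr0.
- exact: horner0.
- by move=> x y hx hy; rewrite hornerD hornerN hx hy subrr.
- by move=> c x hx; rewrite hornerM hx mul0r.
Qed.

Lemma root_ideal_maximal a I x : two_sided_ideal I -> root_ideal a `<=` I -> I x ->
  ~ root_ideal a x -> I 1.
Proof.
move=> [[I0 IB IM] _] aI Ix /eqP xa.
have Ic : I (x.[a])%:P.
  rewrite -[X in I X](subKr x); apply: IB => //; apply: aI.
  by rewrite /root_ideal /= hornerD hornerN hornerC subrr.
by have := IM (x.[a]^-1)%:P _ Ic; rewrite -polyCM mulVf.
Qed.

Lemma root_ideal1 a : ~ root_ideal a 1.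
Proof. by rewrite /root_ideal /= hornerC => /eqP; rewrite oner_eq0. Qed.

Lemma root_ideal_prime a : prime_ideal (root_ideal a).
Proof.
apply: maximal_prime; [exact: root_ideal_ideal|exact: root_ideal1|].
by move=> I x; exact: root_ideal_maximal.
Qed.

Lemma poly_prime0 : prime_ideal [set (0 : {poly C})].
Proof.
split; first exact: two_sided0.
  apply/eqP => e; have : [set (0 : {poly C})] 1 by rewrite e.
  by move/eqP; rewrite oner_eq0.
move=> I J _ _ IJ; have [|nJ] := pselect (J `<=` [set 0]); first by right.
left=> x Ix; apply: contrapT => /eqP x0; apply: nJ => y Jy.
by have /eqP := IJ x y Ix Jy; rewrite mulf_eq0 (negPf x0) => /eqP.
Qed.

(** The ideal form of primeness, applied to principal ideals. *)
Lemma comm_prime_mul (A : comNzRingType) (P : set A) x y : prime_ideal P ->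
  P (x * y) -> P x \/ P y.
Proof.
move=> [[[_ _ PM] _] _ pP] Pxy.
pose pr z : set A := [set r | exists s, r = s * z].
have ipr z : two_sided_ideal (pr z).
  split; split.
  - by exists 0; rewrite mul0r.
  - by move=> _ _ [s ->] [t ->]; exists (s - t); rewrite mulrBl.
  - by move=> a _ [s ->]; exists (a * s); rewrite mulrA.
  - by exists 0; rewrite mul0r.
  - by move=> _ _ [s ->] [t ->]; exists (s - t); rewrite mulrBl.
  - by move=> a _ [s ->]; exists (s * a); rewrite mulrAC.
have [_ _ [s ->] [t ->]|h|h] := pP _ _ (ipr x) (ipr y).
- by rewrite mulrACA; exact: PM.
- by left; apply: h; exists 1; rewrite mul1r.
- by right; apply: h; exists 1; rewrite mul1r.
Qed.

Lemma poly_primeE P : prime_ideal P -> P <> [set 0] -> exists a, P = root_ideal a.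
Proof.
move=> hP P0; have [hPi _ _] := hP; have [[P00 PB PM] _] := hPi.
have [f Pf /eqP f0] := nonzero_elt P00 P0.
have [rs fE] := closed_field_poly_normal f.
have [a Pa] : exists a, P ('X - a%:P).
  have : P (\prod_(z <- rs) ('X - z%:P)).
    have := PM ((lead_coef f)^-1)%:P _ Pf; rewrite mul_polyC {2}fE scalerA.
    by rewrite mulVf ?lead_coef_eq0 // scale1r.
  elim: rs {fE} => [|z rs IH]; first by rewrite big_nil => /(proper_ideal1 hP).
  by rewrite big_cons => /(comm_prime_mul hP)[h|//]; exists z.
exists a.
have aP : root_ideal a `<=` P.
  move=> g ga; have /factor_theorem[q ->] : root g a by rewrite rootE; apply/eqP.
  exact: PM.
apply/seteqP; split=> // g Pg; apply: contrapT => ng.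
by apply: (proper_ideal1 hP); exact: (root_ideal_maximal hPi aP Pg ng).
Qed.

Lemma poly_curve_like : curve_like root_ideal.
Proof.
split.
- exact: poly_prime0.
- exact: poly_primeE.
- move=> I x _ Ix /eqP x0; have [rs xE] := closed_field_poly_normal x.
  exists rs => a Ia; have : root x a by rewrite rootE; apply/eqP; exact: Ia.
  by rewrite xE rootZ ?lead_coef_eq0 // root_prod_XsubC.
- move=> P Q hP hQ P0 PQ; have [a PE] := poly_primeE hP P0.
  apply/seteqP; split=> // x Qx; apply: contrapT => nPx.
  have [iQ _ _] := hQ; apply: (proper_ideal1 hQ).
  by apply: (root_ideal_maximal (a := a) iQ _ Qx); rewrite -PE.
- move=> I x _ Ix /eqP x0; have [c xc] := nonzero_horner x0.
  exists (root_ideal c); split; first exact: root_ideal_prime.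
    move=> e; have : root_ideal c ('X - c%:P) by rewrite /root_ideal /= hornerXsubC subrr.
    by rewrite e => /eqP; rewrite polyXsubC_eq0.
  by move=> /(_ x Ix)/eqP; rewrite (negPf xc).
Qed.

(** Another instance of the skew basis theorem, with the scalars as coefficients and ['X] as
    normalizing element. *)
Lemma left_noetherian_poly : left_noetherian {poly C}.
Proof.
have hk := subring_scalars {poly C}.
have [+ _] := noetherian_pol (t := 'X) hk (normalizes_scalars 'X) (noetherian_scalars {poly C}).
have -> : pol_right (scalars {poly C}) 'X = setT.
  apply/seteqP; split=> // f _; exists (size f), (fun i => (f`_i)%:A); split.
    by move=> i; exists f`_i.
  rewrite -{1}[f]coefK poly_def; apply: eq_bigr => i _.
  by rewrite mulr_algr.
move=> noe I hI asc.
have [n|//|N hN] := noe I.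
  by have [I0 IB IM] := hI n; split=> // a x _; exact: IM.
exists N => n Nn; apply/seteqP; split; first exact: hN.
exact: chain_le asc _ _ Nn.
Qed.

Lemma fg_poly : fg_algebra {poly C}.
Proof.
exists [:: 'X] => B [B1 BZ BM] sB f.
have B0 : 0 \in B by have := BZ (-1) 1 1 B1 B1; rewrite scaleN1r addNr.
have BX n : 'X^n \in B.
  elim: n => [|n IH]; rewrite ?expr0 // exprS; apply: BM => //.
  by apply: sB; rewrite inE.
rewrite -[f]coefK poly_def; elim: (size f) => [|n IH]; first by rewrite big_ord0.
by rewrite big_ord_recr /= addrC; exact: BZ.
Qed.

(* The phantom argument keeps the module structures for distinct points apart. *)
Definition eval_module (a : C) : Type := C.
HB.instance Definition _ a := GRing.Zmodule.copy (eval_module a) C.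

Section EvaluationModule.
Variable a : C.

Definition eval_scale (f : {poly C}) (m : eval_module a) : eval_module a := f.[a] * m.
Fact eval_scaleA f g m : eval_scale f (eval_scale g m) = eval_scale (f * g) m.
Proof. by rewrite /eval_scale hornerM mulrA. Qed.
Fact eval_scale1 : left_id 1 eval_scale.
Proof. by move=> m; rewrite /eval_scale hornerC mul1r. Qed.
Fact eval_scaleDr : right_distributive eval_scale +%R.
Proof. by move=> f m n; exact: mulrDr. Qed.
Fact eval_scaleDl m : {morph eval_scale^~ m : f g / f + g}.
Proof. by move=> f g; rewrite /eval_scale hornerD mulrDl. Qed.
HB.instance Definition _ := GRing.Zmodule_isLmodule.Build {poly C} (eval_module a)
  eval_scaleA eval_scale1 eval_scaleDr eval_scaleDl.

Lemma eval_actE (f : {poly C}) (m : eval_module a) : f *: m = (f.[a] * (m : C) : C).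
Proof. by []. Qed.

Lemma eval_module_simple : simple_module (eval_module a).
Proof.
split; first by exists (1 : C); exact: oner_neq0.
move=> N [N0 NL]; have [h|h] := pselect (forall m, m \in N -> m = 0); [by left|right=> m].
have [n [nN n0]] : exists n, n \in N /\ n != 0.
  apply: contrapT => nh; apply: h => n nN; apply: contrapT => /eqP n0.
  by apply: nh; exists n.
have := NL ((m : C) / (n : C))%:P n 0 nN N0; rewrite addr0.
by rewrite eval_actE hornerC divfK.
Qed.

Lemma eval_module_annihilator : annihilator (eval_module a) = root_ideal a.
Proof.
apply/seteqP; split=> f hf.
  by have := hf (1 : C); rewrite eval_actE mulr1.
by move=> m; rewrite eval_actE (_ : f.[a] = 0) // mul0r.
Qed.

End EvaluationModule.

(** On a faithful simple module ['X] acts surjectively, so m0 = X v with v = g m0. Then 1 - X g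
    kills the generator m0, hence the module, although its value at 0 is 1. *)
Lemma zero_not_primitive_poly (P : Spec {poly C}) : spec_set P = [set 0] -> ~ primitive P.
Proof.
move=> P0 [M [[[m0 m00] simM] annP]].
have ann0 f : (forall m : M, f *: m = 0) -> f = 0.
  by move=> h; suff : annihilator M f by rewrite -annP P0.
pose N : {pred M} := [in [set m : M | exists m', m = 'X *: m']].
have hN : GRing.submod_closed N.
  split; first by rewrite inE; exists 0; rewrite scaler0.
  move=> f u v; rewrite !inE => -[u' ->] [v' ->]; exists (f *: u' + v').
  by rewrite scalerDr !scalerA mulrC.
have [h|h] := simM N hN.
  have : 'X = 0 :> {poly C} by apply: ann0 => m; apply: h; rewrite inE; exists m.
  by move/eqP; rewrite polyX_eq0.
have := h m0; rewrite inE => -[v m0E].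
pose N' : {pred M} := [in [set m : M | exists g : {poly C}, m = g *: m0]].
have hN' : GRing.submod_closed N'.
  split; first by rewrite inE; exists 0; rewrite scale0r.
  move=> f u w; rewrite !inE => -[u' ->] [v' ->]; exists (f * u' + v').
  by rewrite scalerDl scalerA.
have [h'|h'] := simM N' hN'.
  by case/eqP: m00; apply: h'; rewrite inE; exists 1; rewrite scale1r.
have := h' v; rewrite inE => -[g vE].
have e : 1 - 'X * g = 0.
  apply: ann0 => m; have := h' m; rewrite inE => -[g' ->].
  rewrite scalerA mulrC -scalerA scalerBl scale1r -scalerA -vE -m0E subrr.
  exact: scaler0.
have := congr1 (fun f : {poly C} => f.[0]) e.
by rewrite hornerD hornerN hornerM hornerX mul0r subr0 hornerC horner0 => /eqP; rewrite oner_eq0.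
Qed.

Lemma residue_sum (P : Spec {poly C}) n (F : 'I_n -> {poly C}) :
  residue P (\sum_(i < n) F i) = \sum_(i < n) residue P (F i).
Proof. by apply: (big_morph (residue P)); [exact: residueD|exact: residue0]. Qed.

Lemma residue1 (P : Spec {poly C}) : residue P 1 = 1. Proof. by []. Qed.

Lemma residueX (P : Spec {poly C}) x n : residue P (x ^+ n) = residue P x ^+ n.
Proof. by elim: n => // n IH; rewrite !exprS residueM IH. Qed.

Lemma residueZ (P : Spec {poly C}) c x : residue P (c *: x) = c *: residue P x.
Proof. by rewrite -residue_scaleE. Qed.

Lemma zero_not_rational_poly (P : Spec {poly C}) : spec_set P = [set 0] -> ~ rational P.
Proof.
move=> P0 [Q [iota [[inj inv frac] alg]]].
pose z := iota (residue P 'X).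
(* Every element of [Q] is a left fraction of elements of the commutative residue ring. So the image
   of ['X] is central, and it will be seen to be transcendental. *)
have cz q : GRing.comm z q.
  have [s [b [rs sq]]] := frac q; have [t [ts st]] := inv s rs.
  have comm (u v : residue_ring P) : u * v = v * u.
    by rewrite -[u]residueK -[v]residueK -!residueM mulrC.
  have sz : iota s * z = z * iota s by rewrite /z -!rmorphM comm.
  have bz : iota b * z = z * iota b by rewrite /z -!rmorphM comm.
  rewrite /GRing.comm -[LHS]mul1r -[RHS]mul1r -ts -!mulrA; congr (_ * _).
  by rewrite mulrA sz -mulrA sq mulrA sq bz.
have [p p0 rp] := alg z cz; case/eqP: p0.
suff : residue P p = 0 by rewrite -residue0 => /residueP; rewrite subr0 P0.
apply: inj; rewrite rmorph0; move/rootP: rp => <-.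
rewrite -[in LHS](coefK p) poly_def residue_sum raddf_sum.
have iA : injective (in_alg Q) by exact: fmorph_inj.
rewrite horner_coef size_map_inj_poly ?rmorph0 //; apply: eq_bigr => i _.
rewrite residueZ residueX coef_map /= mulr_algl.
etransitivity; first exact: (linearZ_LR iota p`_i (residue P 'X ^+ i)).
by congr (_ *: _); exact: (rmorphXn iota).
Qed.

Lemma residue_root (P : Spec {poly C}) a : spec_set P = root_ideal a ->
  forall u : residue_ring P, exists c : C, u = c%:A.
Proof.
move=> Pa u; exists (residue_repr u).[a]; rewrite -{1}[u]residueK.
rewrite -(residue1 P) -residueZ; apply/residueP; rewrite Pa /root_ideal /=.
by rewrite hornerD hornerN hornerZ hornerC mulr1 subrr.
Qed.

(** The residue ring consists of scalars, so that it is its own ring of quotients. *)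
Lemma root_ideal_rational (P : Spec {poly C}) a : spec_set P = root_ideal a -> rational P.
Proof.
move=> Pa; exists (residue_ring P), idfun; split; first split.
- by [].
- move=> s [sl sr]; have [c sE] := residue_root Pa s.
  have c0 : c != 0.
    apply/eqP => c0; have : s * 1 = s * 0 by rewrite sE c0 scale0r !mul0r.
    by move/sl/eqP; rewrite oner_eq0.
  exists (c^-1)%:A; rewrite sE /= !mulr_algl !scalerA mulfV // mulVf // scale1r.
  by split.
- move=> q; exists 1, q; split; last by rewrite /= mul1r.
  by split=> x y; rewrite ?mul1r ?mulr1.
move=> z _; have [c ->] := residue_root Pa z.
exists ('X - c%:P); first by rewrite polyXsubC_eq0.
by rewrite map_polyXsubC root_XsubC.
Qed.

Lemma dixmier_moeglin_poly : dixmier_moeglin {poly C}.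
Proof.
move=> P; have [P0|P0] := pselect (spec_set P = [set 0]).
  have Pg : P = generic poly_curve_like by exact: Spec_ext.
  have h1 := zero_not_primitive_poly P0; have h2 := zero_not_rational_poly P0.
  have h3 : ~ locally_closed [set P] by rewrite Pg; exact: generic_not_locally_closed.
  by split; split.
have [a Pa] := poly_primeE (spec_prime P) P0.
have h1 : primitive P.
  exists (eval_module a : lmodType {poly C}); split; first exact: eval_module_simple.
  by rewrite Pa eval_module_annihilator.
have h2 := root_ideal_rational Pa.
have h3 : locally_closed [set P].
  exists setT, [set P]; split; [exact: openT| |by rewrite setTI].
  apply/(spec_closedP poly_curve_like); right; split; first exact: finite_set1.
  by move=> /= e; apply: P0; rewrite -e.
by split; split.
Qed.

Lemma not_dixmier_moeglin_algR : ~ dixmier_moeglin algR.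
Proof.
move=> /(_ (generic algR_curve_like))[[_ lc] _].
apply: (generic_not_locally_closed (hR := algR_curve_like)); apply: lc.
exists (orbit_module : lmodType algR); split; first exact: orbit_module_simple.
by rewrite orbit_module_faithful.
Qed.

Theorem mainTheorem4 :
  (exists R : algType algC,
     fg_algebra R /\ ~ finite_dimensional R /\ prime_ring R /\ noetherian R /\
     ~ dixmier_moeglin R /\ homeomorphic (Spec R) (Spec {poly algC}))
  /\
  ~ (forall (k : fieldType) (R S : algType k),
       left_noetherian R -> left_noetherian S -> spec_poset_iso R S ->
       (dixmier_moeglin R <-> dixmier_moeglin S))
  /\
  ~ (forall (k : fieldType) (R : algType k),
       fg_algebra R -> left_noetherian R -> finitely_stratified R ->
       dixmier_moeglin R).
Proof.
have homeo : homeomorphic (Spec algR) (Spec {poly algC}).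
  have [f [g [fg gf cf cg _]]] := curve_like_homeo algR_curve_like poly_curve_like.
  by exists f, g.
have [lnR rnR] := noetherian_algR.
split; [|split].
- exists algR; split; first exact: fg_algR.
  split; first exact: infinite_dimensional_algR.
  split; first exact: prime_ring_algR.
  split; first exact: noetherian_algR.
  by split; first exact: not_dixmier_moeglin_algR.
- move=> /(_ algC algR {poly algC} lnR left_noetherian_poly) h.
  apply: not_dixmier_moeglin_algR; apply/h; last exact: dixmier_moeglin_poly.
  exact: curve_like_poset_iso algR_curve_like poly_curve_like.
- move=> /(_ algC algR fg_algR lnR) h; apply: not_dixmier_moeglin_algR; apply: h.
  (* A single stratum suffices, since the whole spectrum is homeomorphic to that of k[t]. *)
  exists 1%N, (fun=> setT); split.
  + by apply/seteqP; split=> // P _; exists ord0.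
  + by move=> i j _ _ _; rewrite !ord1.
  + by move=> i; exists setT, setT; split; [exact: openT|exact: closedT|rewrite setTI].
  + move=> i; exists {poly algC}; split; first exact: fg_poly.
    exact: homeomorphic_setT.
Qed.
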